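(* Let $f(x)=\int_0^\infty (1-e^{-xs})\,\overline{\nu}(ds)$, $x>0$, be a Bernstein function whose Lévy measure $\overline{\nu}$ on $(0,\infty)$ satisfies $\int_0^\infty (s\wedge 1)\,\overline{\nu}(ds)<\infty$. Assume that $\overline{\nu}(0,\infty)=\infty$ and that the tail $\nu(s)=\overline{\nu}(s,\infty)$, $s>0$, is absolutely continuous. Let $Y^f$ be the inverse of a subordinator $H^f$ with Laplace exponent $f$, and let $l^f(t,\cdot)$ be the density of $Y^f(t)$. Let $N$ be a non-homogeneous Poisson process with intensity function $\lambda:[0,\infty)\to[0,\infty)$, independent of $Y^f$. For $v\ge 0$ set $$p_x(u,v)=\mathsf{P}\{N(u+v)-N(v)=x\},\qquad I^f(t,v)=N(Y^f(t)+v)-N(v),\qquad p_x^f(t,v)=\mathsf{P}\{I^f(t,v)=x\},$$ for $u,t\ge 0$ and $x=0,1,2,\dots$, and $p_{-1}(u,v)\equiv 0$. Then for every $v\ge 0$ and every $x=0,1,2,\dots$ the marginal distributions $p_x^f(t,v)$ satisfy, for $t>0$, the differential-integral equation $$ {}^f\mathcal{D}_t\, p_x^f(t,v)=\int_0^\infty \lambda(u+v)\left[-p_x(u,v)+p_{x-1}(u,v)\right] l^f(t,u)\,du,$$ with initial condition $p_x^f(0,v)=1$ if $x=0$ and $p_x^f(0,v)=0$ if $x\ge 1$.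
   Context: Subordinator and inverse: $H^f(t)$, $t\ge0$, is the subordinator with $\mathsf{E}e^{-xH^f(t)}=e^{-tf(x)}$ for $x>0$, and $Y^f(t)=\inf\{s\ge 0: H^f(s)>t\}$. Under the stated conditions on $\overline{\nu}$, for $t>0$ the random variable $Y^f(t)$ has a density $u\mapsto l^f(t,u)$ on $(0,\infty)$, and $\int_0^\infty e^{-rt}l^f(t,u)\,dt=\frac{f(r)}{r}e^{-uf(r)}$, $r>0$ (known fact). Absolute continuity of the tail is understood on $(0,\infty)$, i.e. on compact subintervals. Convolution-type derivative: the generalized Caputo-Djrbashian derivative with respect to $f$ is defined on absolutely continuous functions $w$ by $${}^f\mathcal{D}_t w(t)=\int_0^t \frac{\partial}{\partial t}w(t-s)\,\nu(s)\,ds,\qquad \nu(s)=\overline{\nu}(s,\infty).$$ Non-homogeneous Poisson process: with $\Lambda(s,t)=\int_s^t\lambda(u)\,du$ (assumed finite), $N$ has independent increments and $$\mathsf{P}\{N(t+v)-N(v)=x\}=\frac{e^{-\Lambda(v,t+v)}\Lambda(v,t+v)^x}{x!},\quad x=0,1,2,\dots$$ Consequently $p_x^f(t,v)=\int_0^\infty p_x(u,v)\,l^f(t,u)\,du$.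
   Formalization: The equation is asserted at every t>0 where the right-hand integral converges absolutely, which is proved for almost every t, rather than at all t>0: for some Lévy measures and locally integrable λ that integral diverges at exceptional t. *)

(* Defs.v *)
From HB Require Import structures.
From mathcomp Require Import all_boot all_order all_algebra.
From mathcomp Require Import all_classical all_reals all_analysis.
Import Order.TTheory GRing.Theory Num.Theory.
Import numFieldNormedType.Exports.
Set Implicit Arguments.
Unset Strict Implicit.
Unset Printing Implicit Defensive.

Local Open Scope classical_set_scope.
Local Open Scope ring_scope.

Section real_functions.
Context (R : realType).
Local Notation leb := (@lebesgue_measure R).

Definition abs_continuous_on (a b : R) (g : R -> R) : Prop :=
  forall e : R, 0 < e -> exists2 dlt : R, 0 < dlt &
    forall (n : nat) (l r : nat -> R),
      (forall i, (i < n)%N -> a <= l i /\ l i <= r i /\ r i <= b) ->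
      (forall i j, (i < n)%N -> (j < n)%N -> i <> j ->
        r i <= l j \/ r j <= l i) ->
      \sum_(i < n) (r i - l i) < dlt ->
      \sum_(i < n) `|g (r i) - g (l i)| < e.

Definition levy_measure (nub : {measure set (measurableTypeR R) -> \bar R}) :=
  nub `]-oo, 0%R]%classic = 0%E /\
  (\int[nub]_(s in `]0%R, +oo[) (Num.min s 1)%:E < +oo)%E.

Definition levy_tail (nub : {measure set (measurableTypeR R) -> \bar R})
  (s : R) : R := fine (nub `]s, +oo[%classic).

(* Integrand of the convolution-type derivative of w at t. The derivative is
   library-total: where w is not derivable (a null set of points when w is
   absolutely continuous) it has an unspecified value. *)
Definition conv_integrand (nub : {measure set (measurableTypeR R) -> \bar R})
  (w : R -> R) (t s : R) : R :=
  derive1 (fun r => w (r - s)) t * levy_tail nub s.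

Definition conv_derivative (nub : {measure set (measurableTypeR R) -> \bar R})
  (w : R -> R) (t : R) : R :=
  \int[leb]_(s in `]0, t[) conv_integrand nub w t s.

Definition cumulative_intensity (lam : R -> R) (s t : R) : R :=
  \int[leb]_(u in `[s, t]) lam u.

End real_functions.

(* A process indexed by [0, +oo[ is a function X : R -> T -> R of which only
   the values X t with 0 <= t are used. *)
Section processes.
Context (R : realType) (d : measure_display) (T : measurableType d).
Context (P : probability T R).

(* For the finitely many increments of a partition, the product rule over all
   families of Borel sets contains the one over subfamilies (take A i = setT). *)
Definition independent_increments (X : R -> T -> R) : Prop :=
  forall (n : nat) (t : nat -> R) (A : nat -> set R),
    0 <= t 0%N -> (forall i, (i < n)%N -> t i <= t i.+1) ->
    (forall i, (i < n)%N -> measurable (A i)) ->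
    P [set w | forall i, (i < n)%N -> A i (X (t i.+1) w - X (t i) w)] =
    (\prod_(i < n) P [set w | A i (X (t i.+1) w - X (t i) w)%R])%E.

Definition stationary_increments (X : R -> T -> R) : Prop :=
  forall (s t : R) (A : set R), 0 <= s -> 0 <= t -> measurable A ->
    P [set w | A (X (s + t) w - X s w)] = P [set w | A (X t w - X 0 w)].

Definition process_sigma_algebra (X : R -> T -> R) : set (set T) :=
  <<s [set E | exists (t : R) (B : set R),
         [/\ 0 <= t, measurable B & E = X t @^-1` B]] >>.

Definition independent_processes (X Y : R -> T -> R) : Prop :=
  forall A B : set T, process_sigma_algebra X A -> process_sigma_algebra Y B ->
    P (A `&` B) = (P A * P B)%E.

(* Path properties are required for every outcome. *)
Record subordinator (H : R -> T -> R) : Prop := Subordinator {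
  sub_meas : forall t : R, 0 <= t -> measurable_fun setT (H t);
  sub_0 : forall w, H 0 w = 0;
  sub_nondecreasing : forall w (s t : R), 0 <= s -> s <= t -> H s w <= H t w;
  sub_right_continuous : forall w (t : R), 0 <= t -> H u w @[u --> t^'+] --> H t w;
  sub_stationary : stationary_increments H;
  sub_independent : independent_increments H }.

Definition laplace_exponent (H : R -> T -> R) (f : R -> R) : Prop :=
  forall t x : R, 0 <= t -> 0 < x ->
    ('E_P[fun w => expR (- (x * H t w))] = (expR (- (t * f x)))%:E)%E.

(* When the subordinator is almost surely unbounded the set below is almost
   surely nonempty; inf set0 = 0 is a convention on the exceptional event. *)
Definition inverse_process (H : R -> T -> R) (t : R) (w : T) : R :=
  inf [set s | 0 <= s /\ t < H s w].

Definition density_on_positives (Z : T -> R) (g : R -> R) : Prop :=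
  [/\ measurable_fun (`]0, +oo[%classic : set R) g,
      (forall u : R, 0 < u -> 0 <= g u) &
      (forall A : set R, measurable A ->
        P (Z @^-1` A) =
        (\int[@lebesgue_measure R]_(u in A `&` `]0%R, +oo[) (g u)%:E)%E)].

Definition real_process (N : R -> T -> nat) : R -> T -> R :=
  fun t w => (N t w)%:R.

Record nonhomogeneous_poisson (lam : R -> R) (N : R -> T -> nat) : Prop :=
  NonhomogeneousPoisson {
  nhp_meas : forall t : R, 0 <= t -> measurable_fun setT (real_process N t);
  nhp_0 : forall w, N 0 w = 0%N;
  nhp_nondecreasing : forall w (s t : R), 0 <= s -> s <= t -> (N s w <= N t w)%N;
  nhp_right_continuous : forall w (t : R), 0 <= t ->
    real_process N u w @[u --> t^'+] --> real_process N t w;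
  nhp_independent : independent_increments (real_process N);
  nhp_law : forall (v t : R) (x : nat), 0 <= v -> 0 <= t ->
    P [set w | (N (t + v)%R w - N v w)%N = x] =
    (expR (- cumulative_intensity lam v (t + v)) *
       cumulative_intensity lam v (t + v) ^+ x / x`!%:R)%:E }.

Definition increment_prob (N : R -> T -> nat) (x : nat) (u v : R) : R :=
  fine (P [set w | (N (u + v)%R w - N v w)%N = x]).

(* p_{x-1}, with p_{-1} = 0 *)
Definition increment_prob_pred (N : R -> T -> nat) (x : nat) (u v : R) : R :=
  if x is y.+1 then increment_prob N y u v else 0.

Definition time_changed_increment (N : R -> T -> nat) (Y : R -> T -> R)
  (t v : R) (w : T) : nat := (N (Y t w + v)%R w - N v w)%N.

Definition time_changed_prob (N : R -> T -> nat) (Y : R -> T -> R)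
  (x : nat) (t v : R) : R :=
  fine (P [set w | time_changed_increment N Y t v w = x]).

Definition governing_integrand (lam : R -> R) (N : R -> T -> nat)
  (l : R -> R -> R) (x : nat) (v t u : R) : R :=
  lam (u + v) * (- increment_prob N x u v + increment_prob_pred N x u v) * l t u.

End processes.

(* Main.v *)
Require Import Defs.
From HB Require Import structures.
From mathcomp Require Import all_boot all_order all_algebra.
From mathcomp Require Import all_classical all_reals all_analysis.
From mathcomp Require Import measurable_realfun ring lra.
Import Order.TTheory GRing.Theory Num.Theory.
Import numFieldNormedType.Exports.
Set Implicit Arguments.
Unset Strict Implicit.
Unset Printing Implicit Defensive.
Local Open Scope classical_set_scope.
Local Open Scope ring_scope.

(** Let U be the potential measure of H, so that U has Laplace transform 1/f,
    and let tl(y) = nu(y, oo) for y > 0 and 0 otherwise.  The renewal identity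
    [int tl(t - a) U(da) = 1] holds for almost every t by uniqueness of Laplace
    transforms; decomposing U at the first passage over a level x0 upgrades it
    to every t > 0 and shows that U is absolutely continuous (the overshoot law
    is, because nu is).  Splitting the identity at the operational time
    a and comparing Laplace transforms yields, for every t,
    [int_0^a E tl(t - H u) du = P(t < H a) = P(Y t <= a)],
    so that [l t u = E tl(t - H u)] for almost every u.

    The probabilities p_x(u, v) are obtained by integrating
    g u = lam(u + v) * (p_(x-1)(u, v) - p_x(u, v)) in u (a chain rule for the
    absolutely continuous intensity), and g is integrable on (0, oo).
    Conditioning on Y and using u < Y t iff H u <= t (up to a null set), the
    function pf is, up to a constant, the distribution function of the signed
    measure M(B) = int g u * P(H u in B) du.  It is absolutely
    continuous because U is, and its density is the derivative of pf; convolving it with tl gives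
    [int tl(t - y) M(dy) = int g u * E tl(t - H u) du = int g u * l t u du]. *)

(** * Measure-theoretic preliminaries *)

(** The equation is claimed at every t > 0, whereas inverting a Laplace transform in time yields
    only almost every t; nothing excludes beforehand that U is singular and that the convolution
    with [tl] misbehaves at a particular time. The overshoot law removes this obstacle: it charges
    no null set, so a null set of exceptional times becomes invisible once the renewal identity is
    averaged against it. What U may still put on a null set is carried by [0, x0[ and is at most e /
    f(1/x0); this tends to 0 with x0 because f(1/x) is at least (1 - 1/e) nu(x, oo) and nu(0, oo) is
    infinite.

    The split at the operational time a also starts from almost every t. There, a Fatou argument
    gives upper bounds for both halves at the given t; as the bounds add up to the total mass 1,
    they are equalities.

    The function g and the measure M are signed, while Tonelli and image measures are used for
    nonnegative functions with values in the extended reals. Hence g and M are carried as pairs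
    ([gp], [gn] and [Mp], [Mn]), every identity is written without subtraction, and finite values
    are subtracted only at the end, where integrability of the right-hand side enters. *)

Section measurability.
Context d (X : measurableType d) (R : realType).

Lemma measurable_natr_bool (D : set X) (b : X -> bool) :
  measurable_fun D b -> measurable_fun D (fun x => (b x)%:R : R).
Proof.
exact: (measurableT_comp (f := fun b : bool => b%:R : R)).
Qed.

End measurability.

(** Syntax-directed measurability: the shape of the function selects the closure property, and
    measurability hypotheses of the context serve as leaves. With [nonneg_tac] it discharges the
    side conditions of Tonelli and of linearity for nonnegative integrands. *)
Ltac meas_step := lazymatch goal with
  | H : measurable_fun _ ?f |- measurable_fun _ ?f => exact: H
  | |- measurable_fun _ (fun x => x) => exact: measurable_id
  | |- measurable_fun _ (fun x => fst x) => exact: measurable_fst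
  | |- measurable_fun _ fst => exact: measurable_fst
  | |- measurable_fun _ snd => exact: measurable_snd
  | |- measurable_fun _ (fun x => snd x) => exact: measurable_snd
  | |- measurable_fun _ (fun x => fst _) =>
      apply: (measurableT_comp (@measurable_fst _ _ _ _))
  | |- measurable_fun _ (fun x => snd _) =>
      apply: (measurableT_comp (@measurable_snd _ _ _ _))
  | |- measurable_fun _ (fun x => (_ * _)%E) => apply: emeasurable_funM
  | |- measurable_fun _ (fun x => (_)%:E) => apply/measurable_EFinP
  | |- measurable_fun _ (fun x => (_ * _)%R) => apply: measurable_funM
  | |- measurable_fun _ (fun x => (- _)%R) =>
      apply: (measurableT_comp (@oppr_measurable _ _))
  | |- measurable_fun _ (fun x => (_ - _)%R) => apply: measurable_funB
  | |- measurable_fun _ (fun x => (_ + _)%R) =>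
      first [apply: measurable_funD | apply: emeasurable_funD]
  | |- measurable_fun _ (fun x => (nat_of_bool _)%:R) =>
      apply: measurable_natr_bool
  | |- measurable_fun _ (fun x => andb _ _) => apply: measurable_and
  | |- measurable_fun _ (fun x => (_ < _)%R) => apply: measurable_fun_ltr
  | |- measurable_fun _ (fun x => (_ <= _)%R) => apply: measurable_fun_ler
  | |- measurable_fun _ (Order.lt _) => apply: measurable_fun_ltr
  | |- measurable_fun _ (Order.le _) => apply: measurable_fun_ler
  | |- measurable_fun _ ( *%R _) => exact: mulrl_measurable
  | |- measurable_fun _ (+%R _) => apply: measurable_funD
  | |- measurable_fun _ (fun x => expR _) =>
      apply: (measurableT_comp (@measurable_expR _))
  | |- measurable_fun _ (fun x => ?f _) => first [ match goal with
      H : measurable_fun _ f |- _ => apply: (measurableT_comp H) end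
      | exact: measurable_cst ]
  | |- measurable_fun _ _ => exact: measurable_cst
  end.
Ltac meas_tac := repeat meas_step.

Ltac nonneg_tac := intros; repeat first [ assumption | done |
  match goal with
  | |- is_true (_ <= _%:E)%E => rewrite lee_fin
  | |- is_true (_ <= _ * _)%E => apply: mule_ge0
  | |- is_true (_ <= _ * _)%R => apply: mulr_ge0
  | |- is_true (_ <= _ + _)%R => first [apply: addr_ge0 | apply: adde_ge0]
  | |- is_true (_ <= _ + _)%E => apply: adde_ge0
  | |- is_true (_ <= expR _)%R => exact: expR_ge0
  | |- is_true (_ <= integral _ _ _)%E => apply: integral_ge0
  | H : forall x, is_true (_ <= ?f x)%E |- is_true (_ <= ?f _)%E => exact: H
  | H : forall x, is_true (_ <= ?f x)%R |- is_true (_ <= ?f _)%R => exact: H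
  | |- is_true (_ <= _)%R => exact: ltW
  end ].
Ltac side_tac := try solve [meas_tac | nonneg_tac].

Section image_measure.
Local Open Scope ereal_scope.
Context d d' (X : measurableType d) (Y : measurableType d') (R : realType).
Variables (m : {measure set X -> \bar R}) (Z : X -> Y) (c : X -> R).
Hypotheses (mZ : measurable_fun setT Z) (mc : measurable_fun setT c)
  (c0 : forall x, (0 <= c x)%R).

Let im (A : set Y) := \int[m]_x ((c x)%:E * (\1_A (Z x))%:E).

Let mindic (A : set Y) : measurable A ->
  measurable_fun setT (fun x => (c x)%:E * (\1_A (Z x))%:E).
Proof.
move=> mA; apply: emeasurable_funM; apply/measurable_EFinP => //.
exact: measurableT_comp.
Qed.

Let im0 : im set0 = 0.
Proof. by apply: integral0_eq => x _; rewrite indic0 mule0. Qed.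

Let im_ge0 A : 0 <= im A.
Proof. by apply: integral_ge0 => x _; rewrite mule_ge0 ?lee_fin. Qed.

Let im_sigma_additive : semi_sigma_additive im.
Proof.
move=> F mF tF mUF.
have -> : im (\bigcup_n F n) = \sum_(n <oo) im (F n).
  rewrite /im -integral_nneseries//; last 2 first.
  - by move=> n; exact: mindic.
  - by move=> n x _; rewrite mule_ge0 ?lee_fin.
  apply: eq_integral => x _.
  rewrite indic_bigcup//.
  rewrite -nneseriesZl//.
by apply: is_cvg_nneseries => n _ _; exact: im_ge0.
Qed.

HB.instance Definition _ :=
  isMeasure.Build _ _ _ im im0 im_ge0 im_sigma_additive.

Import HBNNSimple.

(** The image under [Z] of the measure with density [c], known to its users only through the
    change-of-variables formula. The formula holds for indicators by construction and passes to
    simple functions and monotone limits. The potential measure, the overshoot law, tilted measures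
    and joint laws are all instances. *)
Lemma image_measure_exists : exists mu : {measure set Y -> \bar R},
  forall g : Y -> \bar R, measurable_fun setT g -> (forall y, 0 <= g y) ->
  \int[mu]_y g y = \int[m]_x ((c x)%:E * g (Z x)).
Proof.
exists im => g mg g0.
pose h := nnsfun_approx measurableT mg.
have hE y : g y = limn (EFin \o h^~ y).
  by apply/esym/cvg_lim => //; exact: cvg_nnsfun_approx.
transitivity (limn (fun n => \int[im]_y (h n y)%:E)).
  rewrite -monotone_convergence//.
  - by apply: eq_integral => y _; rewrite hE.
  - by move=> n; exact/measurable_EFinP.
  - by move=> n y _; rewrite lee_fin.
  - by move=> y _ a b ab; rewrite lee_fin; exact/lefP/nd_nnsfun_approx.
transitivity (limn (fun n => \int[m]_x ((c x)%:E * (h n (Z x))%:E))); last first.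
  rewrite -monotone_convergence//.
  - apply: eq_integral => x _; apply/cvg_lim => //; apply: cvgeZl => //.
    exact: cvg_nnsfun_approx.
  - move=> n; apply: emeasurable_funM; apply/measurable_EFinP => //.
    exact: measurableT_comp.
  - by move=> n y _; rewrite mule_ge0 ?lee_fin.
  - move=> x _ a b ab; rewrite lee_wpmul2l ?lee_fin//.
    exact/lefP/nd_nnsfun_approx.
apply/congr_lim/funext => n.
transitivity (\int[im]_y
   (\sum_(r \in range (h n)) (r * \1_(h n @^-1` [set r]) y)%:E)).
  by apply: eq_integral => y _; rewrite fimfunE -fsumEFin.
rewrite ge0_integral_fsum//; last 2 first.
- by move=> r; apply/measurable_EFinP; exact: measurable_funM.
- by move=> r y _; exact: nnfun_muleindic_ge0.
have E r : \int[im]_y (r * \1_(h n @^-1` [set r]) y)%:E =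
    \int[m]_x ((c x)%:E * (r * \1_(h n @^-1` [set r]) (Z x))%:E).
  have [r0|r0] := ltP r 0%R.
    rewrite !integral0_eq// => x _; rewrite preimage_nnfun0// indic0 mulr0//.
    by rewrite mule0.
  under eq_integral do rewrite EFinM.
  rewrite integralZl_indic_nnsfun// integral_indic// setIT.
  rewrite /= /im -ge0_integralZl//; last 2 first.
  - exact: mindic.
  - by move=> x _; rewrite mule_ge0 ?lee_fin.
  by apply: eq_integral => x _; rewrite muleCA.
under eq_fsbigr do rewrite E.
rewrite -ge0_integral_fsum//; last 2 first.
- move=> r; apply: emeasurable_funM; apply/measurable_EFinP => //.
  by apply: measurable_funM => //; exact: measurableT_comp.
- by move=> r x _; rewrite mule_ge0 ?nnfun_muleindic_ge0// lee_fin.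
apply: eq_integral => x _.
rewrite -ge0_mule_fsumr; last by move=> r; exact: nnfun_muleindic_ge0.
by rewrite fsumEFin// -fimfunE.
Qed.
End image_measure.

Section null_sets.
Local Open Scope ereal_scope.
Context d (T : measurableType d) (R : realType).
Variable m : {measure set T -> \bar R}.

Lemma ge0_integral_null (N : set T) (f : T -> \bar R) :
  measurable N -> m N = 0 -> measurable_fun setT f -> (forall x, 0 <= f x) ->
  (forall x, ~ N x -> f x = 0) -> \int[m]_x f x = 0.
Proof.
move=> mN N0 mf f0 fN.
rewrite (@ge0_ae_eq_integral _ _ _ m setT f (cst 0))//; first exact: integral0.
by exists N; split => // x /= h; apply: contrapT => /fN fx; exact: h.
Qed.

Lemma measure_integral_indic (A : set T) : measurable A ->
  m A = \int[m]_x (\1_A x)%:E.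
Proof. by move=> mA; rewrite integral_indic// setIT. Qed.

Lemma measurable_EFin_indic (A : set T) : measurable A ->
  measurable_fun setT (fun x => (\1_A x)%:E : \bar R).
Proof. by move=> mA; apply/measurable_EFinP. Qed.

End null_sets.

Section measure_copies.
Context d (T : measurableType d) (R : realType).
Implicit Type mu : {measure set T -> \bar R}.

(** An alias that takes the proof of sigma-finiteness as an argument, so that a structure can be
    attached to a measure for which the property is only a proposition. *)
Definition sigma_finite_copy mu of sigma_finite setT mu : set T -> \bar R := mu.

HB.instance Definition _ mu (h : sigma_finite setT mu) :=
  Measure.on (sigma_finite_copy h).
HB.instance Definition _ mu (h : sigma_finite setT mu) :=
  Measure_isSigmaFinite.Build _ _ _ (sigma_finite_copy h) h.

Definition finite_copy mu of fin_num_fun mu : set T -> \bar R := mu.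

HB.instance Definition _ mu (h : fin_num_fun mu) :=
  Measure.on (finite_copy h).
HB.instance Definition _ mu (h : fin_num_fun mu) :=
  Measure_isFinite.Build _ _ _ (finite_copy h) h.

Lemma sigma_finite_pack mu : sigma_finite setT mu ->
  exists mu' : {sigma_finite_measure set T -> \bar R},
    mu' = mu :> (set T -> \bar R).
Proof. by move=> h; exists (sigma_finite_copy h). Qed.

Lemma finite_pack mu : (mu setT < +oo)%E ->
  exists mu' : {finite_measure set T -> \bar R},
    mu' = mu :> (set T -> \bar R).
Proof. by move=> /lty_fin_num_fun h; exists (finite_copy h). Qed.

End measure_copies.

(** Packing the product as one sigma-finite measure lets Tonelli be applied again with the whole
    product as a single factor. The exhaustion uses squares of the two increasing exhaustions. *)
Lemma sigma_finite_product d1 d2 (X : measurableType d1) (Y : measurableType d2)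
    (R : realType) (m : {sigma_finite_measure set X -> \bar R})
    (n : {sigma_finite_measure set Y -> \bar R}) :
  exists mn : {sigma_finite_measure set (X * Y)%type -> \bar R},
    mn = (m \x n)%E :> (set (X * Y) -> \bar R).
Proof.
apply: sigma_finite_pack.
have /sigma_finiteP[F [FT ndF Foo]] := sigma_finiteT m.
have /sigma_finiteP[G [GT ndG Goo]] := sigma_finiteT n.
exists (fun k => F k `*` G k) => [|k].
  apply/esym/seteqP; split=> // -[x y] _.
  have [i _ Fx] : (\bigcup_k F k) x by rewrite -FT.
  have [j _ Gy] : (\bigcup_k G k) y by rewrite -GT.
  exists (maxn i j) => //; split => /=.
    by move/subsetPset: (ndF _ _ (leq_maxl i j)); apply.
  by move/subsetPset: (ndG _ _ (leq_maxr i j)); apply.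
have [mF Fk] := Foo k; have [mG Gk] := Goo k.
split; first exact: measurableX.
by rewrite /= product_measure1E// lte_mul_pinfty// ge0_fin_numE.
Qed.

(** * Invariance of Lebesgue measure under reflections and translations *)

Section lebesgue_reflection.
Local Open Scope ereal_scope.
Context (R : realType).
Notation leb := (@lebesgue_measure R).

Lemma measurable_reflection (t : R) :
  measurable_fun [set: R] (fun s : R => t - s)%R.
Proof. exact: measurable_funB. Qed.

Lemma lebesgue_measure_reflection (t : R) (A : set R) : measurable A ->
  pushforward leb ((fun s => t - s)%R : _ -> measurableTypeR R) A = leb A.
Proof.
move=> mA; apply/esym/lebesgue_measure_unique => //=.
  exact: measurable_reflection.
move=> mt _ [[a b]] _ <-; rewrite /pushforward.
have -> : (fun s : R => t - s)%R @^-1` `]a, b] = `[(t - b)%R, (t - a)%R[%classic.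
  by apply/seteqP; split => x /=; rewrite !in_itv /= => /andP[? ?];
    apply/andP; split; lra.
rewrite !lebesgue_measure_itv/= !lte_fin; case: ltP => ab.
  by rewrite ifT; [rewrite -!EFinD; congr (_%:E); lra|lra].
by rewrite ifF//; apply/negbTE; rewrite -leNgt; lra.
Qed.

Lemma ge0_integral_reflection (t : R) (g : R -> \bar R) :
  measurable_fun setT g -> (forall s, 0 <= g s) ->
  \int[leb]_s g (t - s)%R = \int[leb]_s g s.
Proof.
move=> mg g0.
have := @ge0_integral_pushforward _ _ (measurableTypeR R) (measurableTypeR R)
  R _ (measurable_reflection t) leb setT g.
rewrite preimage_setT => /(_ measurableT mg (fun y _ => g0 y)) /= <-.
apply: eq_measure_integral => [|mt A mA _].
  exact: measurable_reflection.
exact: lebesgue_measure_reflection.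
Qed.

Lemma lebesgue_null_reflection (t : R) (A : set R) : measurable A ->
  leb A = 0 -> leb ((fun s => t - s)%R @^-1` A) = 0.
Proof. by move=> mA <-; exact: lebesgue_measure_reflection. Qed.

(** A translation is the composition of two reflections. *)
Lemma ge0_integral_translation (t : R) (g : R -> \bar R) :
  measurable_fun setT g -> (forall s, 0 <= g s) ->
  \int[leb]_s g (t + s)%R = \int[leb]_s g s.
Proof.
move=> mg g0; rewrite -(ge0_integral_reflection t mg g0).
have mh : measurable_fun setT (fun s => g (t + s)%R).
  by apply: measurableT_comp => //; exact: measurable_funD.
rewrite -(ge0_integral_reflection 0 mh)//.
by apply: eq_integral => s _; rewrite sub0r.
Qed.

Lemma lebesgue_null_translation (t : R) (A : set R) : measurable A ->
  leb A = 0 -> leb ((fun s => t + s)%R @^-1` A) = 0.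
Proof.
move=> mA A0; have := lebesgue_null_reflection t mA A0.
have mt : measurable ((fun s => t - s)%R @^-1` A).
  by rewrite -[X in measurable X]setTI; exact: measurable_reflection.
move=> /(lebesgue_null_reflection 0 mt); congr (leb _ = _).
by apply/seteqP; split => x /=; rewrite sub0r opprK.
Qed.
End lebesgue_reflection.

Lemma cvg_measure_itvoy (R : realType)
    (m : {measure set (measurableTypeR R) -> \bar R}) (b : R) :
  (m `](b + n.+1%:R^-1)%R, +oo[%classic @[n --> \oo] --> m `]b, +oo[%classic)%E.
Proof.
pose F (n : nat) : set (measurableTypeR R) :=
  `](b + n.+1%:R^-1)%R, +oo[%classic.
have -> : `]b, +oo[%classic = \bigcup_n F n.
  apply/seteqP; split=> y; rewrite /F /=.
    rewrite in_itv/= andbT -subr_gt0 => y0.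
    have /ltW/archi_boundP yb : 0 < (y - b)^-1 by rewrite invr_gt0.
    exists (Num.bound (y - b)^-1) => //=; rewrite in_itv/= andbT.
    rewrite -ltrBrDl invf_plt ?posrE//; apply: lt_trans yb _.
    by rewrite ltr_nat.
  move=> [n _] /=; rewrite !in_itv/= !andbT; apply: lt_trans.
  by rewrite ltrDl invr_gt0.
apply: nondecreasing_cvg_mu.
- by move=> n; apply: measurable_itv.
- by apply: bigcup_measurable => n _; apply: measurable_itv.
- move=> i j ij; apply/subsetPset => y; rewrite /F /= !in_itv/= !andbT.
  by apply: le_lt_trans; rewrite lerD2l lef_pV2 ?posrE// ler_nat.
Qed.

Lemma cvg_measure_itv0y (R : realType)
    (m : {measure set (measurableTypeR R) -> \bar R}) :
  (m `](n.+1%:R^-1)%R, +oo[%classic @[n --> \oo] --> m `]0%R, +oo[%classic)%E.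
Proof. by have := @cvg_measure_itvoy R m 0; under eq_fun do rewrite add0r. Qed.

(** * Laplace transforms *)

Section laplace_uniqueness.
Context (R : realType).

Lemma bernoulli_le (t : R) (n : nat) : 0 <= t <= 1 ->
  1 - n%:R * t <= (1 - t) ^+ n.
Proof.
move=> /andP[t0 t1]; elim: n => [|n ih]; first by rewrite expr0; lra.
have n0 : 0 <= n%:R :> R by [].
rewrite exprS -natr1.
have : (1 - t) * (1 - n%:R * t) <= (1 - t) * (1 - t) ^+ n.
  by rewrite ler_wpM2l//; lra.
apply: le_trans; nra.
Qed.

(** With s the square root of q, induction gives n (1 - s) s^n + s^n <= 1, hence n q^n = n s^n s^n
    <= s^n / (1 - s). *)
Lemma cvg_nat_geometric (q : R) : 0 <= q < 1 ->
  n%:R * q ^+ n @[n --> \oo] --> (0 : R).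
Proof.
move=> /andP[q0 q1]; set s := Num.sqrt q.
have s0 : 0 <= s by exact: sqrtr_ge0.
have ss : s ^+ 2 = q by rewrite sqr_sqrtr.
have s1 : s < 1 by rewrite -(@ltr_pXn2r _ 2)// ?nnegrE// ss expr1n.
have H n : n%:R * (1 - s) * s ^+ n <= 1.
  have := @bernoulli_le (1 - s) n; rewrite subKr => B.
  suff : forall m, m%:R * (1 - s) * s ^+ m + s ^+ m <= 1.
    by move=> /(_ n); have := exprn_ge0 n s0; lra.
  elim=> [|m ih]; first by rewrite expr0; lra.
  rewrite exprS -natr1.
  have b1 : s * s ^+ m <= 1 by rewrite -exprS exprn_ile1//; lra.
  have h1 := ler_wpM2l s0 ih.
  have h2 : (1 - s) * (s * s ^+ m) <= (1 - s) * 1 by rewrite ler_wpM2l//; lra.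
  lra.
apply: (@squeeze_cvgr _ _ _ _ (fun=> 0) (fun n => (1 - s)^-1 * s ^+ n)).
- near=> n; rewrite mulr_ge0//= ?exprn_ge0//.
  rewrite -ss -exprM mulnC exprM expr2 mulrA.
  rewrite ler_wpM2r ?exprn_ge0//.
  by rewrite -[_^-1]mul1r ler_pdivlMr ?subr_gt0// mulrAC.
- exact: cvg_cst.
- rewrite -(mulr0 (1 - s)^-1); apply: cvgMr; apply: cvg_expr.
  by rewrite ger0_norm.
Unshelve. all: by end_near. Qed.

(* As n grows, psi (expR (- d * s)) n tends to the indicator of s > a when
   d = ln 2 / a, while being a polynomial in expR (- d * s). *)
Let psi (x : R) (n : nat) : R := (1 - x ^+ n) ^+ (n * 2 ^ n).

(** Bernoulli's inequality bounds [psi x n] below by 1 - n (2x)^n, which tends to 1 exactly because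
    2x < 1. *)
Lemma psi_cvg1 (x : R) : 0 <= x < 2^-1 -> psi x n @[n --> \oo] --> (1 : R).
Proof.
move=> /andP[x0 x1].
apply: (@squeeze_cvgr _ _ _ _ (fun n => 1 - n%:R * (2 * x) ^+ n) (fun=> 1)).
- near=> n.
  have xn : 0 <= x ^+ n <= 1 by rewrite exprn_ge0//= exprn_ile1//; lra.
  apply/andP; split.
    rewrite exprMn mulrA -natrX -natrM; exact: bernoulli_le.
  by rewrite /psi exprn_ile1//; lra.
- rewrite -[X in _ --> X]subr0; apply: cvgB; first exact: cvg_cst.
  by apply: cvg_nat_geometric; lra.
- exact: cvg_cst.
Unshelve. all: by end_near. Qed.

(** From 1 - y <= exp(-y) comes [psi x n] <= exp(-n (2x)^n) <= exp(-n). The factor n in the exponent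
    of [psi] is what makes the limit 0 at the threshold x = 1/2 itself. *)
Lemma psi_cvg0 (x : R) : 2^-1 <= x <= 1 -> psi x n @[n --> \oo] --> (0 : R).
Proof.
move=> /andP[x0 x1].
apply: (@squeeze_cvgr _ _ _ _ (fun=> 0) (fun n => (expR (- 1)) ^+ n)).
- near=> n.
  have xn : 0 <= x ^+ n <= 1 by rewrite exprn_ge0//= ?exprn_ile1//; lra.
  rewrite /psi exprn_ge0/=; last lra.
  have h : 1 - x ^+ n <= expR (- x ^+ n) by have := @expR_ge1Dx R (- x ^+ n).
  apply: (@le_trans _ _ (expR (- x ^+ n) ^+ (n * 2 ^ n))).
    by apply: lerXn2r => //; rewrite nnegrE ?expR_ge0//; lra.
  rewrite -!expRM_natl ler_expR mulrN1 mulrN lerN2 natrM -mulrA.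
  rewrite -[leLHS]mulr1 ler_wpM2l// natrX -exprMn exprn_ege1//; lra.
- exact: cvg_cst.
- by apply: cvg_expr; rewrite ger0_norm ?expR_ge0// expR_lt1; lra.
Unshelve. all: by end_near. Qed.

Local Open Scope ereal_scope.
Implicit Types m : {measure set (measurableTypeR R) -> \bar R}.

Notation pos := (`[0%R, +oo[%classic : set (measurableTypeR R)).

Let mpos : measurable pos. Proof. exact: measurable_itv. Qed.

Let integrable_bounded m (f : R -> R) : m setT < +oo -> measurable_fun setT f ->
  (forall y, 0 <= y -> 0 <= f y <= 1)%R -> m.-integrable pos (EFin \o f).
Proof.
move=> moo mf f01; apply: (@le_integrable _ _ _ _ _ mpos _ (cst 1)).
- by apply/measurable_EFinP; exact: measurable_funTS.
- move=> y /=; rewrite in_itv/= andbT => y0; have /andP[h0 h1] := f01 y y0.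
  by rewrite ger0_norm// normr1 lee_fin.
- apply/integrableP; split; first exact: measurable_cst.
  under eq_integral do rewrite /= normr1.
  rewrite integral_cst// mul1e; apply: le_lt_trans moo.
  by apply: le_measure; rewrite ?inE.
Qed.

(** Multiplying by 1 - exp(-cy) replaces an integral at r by the difference of those at r and c + r;
    the induction therefore carries all r >= 0. Finiteness of the measures makes the differences
    meaningful, r = 0 included. *)
Let eq_power m1 m2 (c : R) : (0 <= c)%R -> m1 setT < +oo -> m2 setT < +oo ->
  (forall r, (0 <= r)%R -> \int[m1]_(y in pos) (expR (- (r * y)))%:E =
     \int[m2]_(y in pos) (expR (- (r * y)))%:E) ->
  forall n r, (0 <= r)%R ->
    \int[m1]_(y in pos) ((1 - expR (- (c * y))) ^+ n * expR (- (r * y)))%:E =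
    \int[m2]_(y in pos) ((1 - expR (- (c * y))) ^+ n * expR (- (r * y)))%:E.
Proof.
move=> c0 m1oo m2oo eqL.
have e01 (r : R) : (0 <= r)%R -> forall y : R, (0 <= y -> 0 <= expR (- (r * y)) <= 1)%R.
  by move=> r0 y y0; rewrite expR_ge0/= expR_le1 oppr_le0 mulr_ge0.
have fint m n r : m setT < +oo -> (0 <= r)%R -> m.-integrable pos
    (EFin \o (fun y => (1 - expR (- (c * y))) ^+ n * expR (- (r * y))))%R.
  move=> moo r0; apply: integrable_bounded => //.
    by apply: measurable_funM; [apply: measurable_funX|]; meas_tac.
  move=> y y0; have /andP[h0 h1] := e01 c c0 y y0.
  have /andP[h2 h3] := e01 r r0 y y0.
  rewrite mulr_ge0//= ?exprn_ge0 ?subr_ge0// mulr_ile1// ?exprn_ge0 ?subr_ge0//.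
  by rewrite exprn_ile1// ?subr_ge0// gerBl.
have fE n r (y : R) : (((1 - expR (- (c * y))) ^+ n.+1 * expR (- (r * y)))%:E =
    ((1 - expR (- (c * y))) ^+ n * expR (- (r * y)))%:E -
    ((1 - expR (- (c * y))) ^+ n * expR (- ((c + r) * y)))%:E)%E.
  rewrite -EFinB mulrDl opprD expRD exprS; congr (_%:E); ring.
elim=> [r r0|n ih r r0].
  by under eq_integral do rewrite expr0 mul1r;
     under [RHS]eq_integral do rewrite expr0 mul1r; exact: eqL.
under eq_integral do rewrite fE; under [RHS]eq_integral do rewrite fE.
rewrite (integralB mpos (fint m1 n r m1oo r0) (fint m1 n (c + r)%R m1oo _)) ?addr_ge0//.
rewrite (integralB mpos (fint m2 n r m2oo r0) (fint m2 n (c + r)%R m2oo _)) ?addr_ge0//.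
by rewrite ih// ih// addr_ge0.
Qed.

Let eq_tail m1 m2 (a : R) : (0 < a)%R -> m1 setT < +oo -> m2 setT < +oo ->
  (forall r, (0 <= r)%R -> \int[m1]_(y in pos) (expR (- (r * y)))%:E =
     \int[m2]_(y in pos) (expR (- (r * y)))%:E) ->
  m1 `]a, +oo[%classic = m2 `]a, +oo[%classic.
Proof.
move=> a0 m1oo m2oo eqL; pose dl : R := (ln 2 / a)%R.
have dl0 : (0 < dl)%R by rewrite divr_gt0// ln_gt0// ltr1n.
have c0 n : (0 <= n%:R * dl)%R by rewrite mulr_ge0// ltW.
pose h n (y : R) : R := ((1 - expR (- (n%:R * dl * y))) ^+ (n * 2 ^ n))%R.
have lim m : m setT < +oo ->
    \int[m]_(y in pos) (h n y)%:E @[n --> \oo] --> m `]a, +oo[%classic.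
  move=> moo.
  have -> : m `]a, +oo[%classic = \int[m]_(y in pos) (\1_(`]a, +oo[%classic) y)%:E.
    rewrite integral_indic//; congr (m _); apply/seteqP; split=> y /=.
      rewrite !in_itv/= !andbT => ay; split => //; exact/ltW/(lt_trans a0).
    by case.
  have H n y : (0 <= y -> 0 <= h n y <= 1)%R.
    move=> y0; rewrite /h.
    have : (0 < expR (- (n%:R * dl * y)) <= 1)%R.
      by rewrite expR_gt0 expR_le1 oppr_le0 mulr_ge0.
    by move=> /andP[e0 e1]; rewrite exprn_ge0/= ?exprn_ile1//; lra.
  have mh n : measurable_fun setT (h n) by apply: measurable_funX; meas_tac.
  have [|||||_ _] := @dominated_convergence _ _ _ m pos mpos
    (fun n y => (h n y)%:E) (fun y => (\1_(`]a, +oo[%classic) y)%:E) (cst 1); last exact.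
  - move=> n; apply/measurable_EFinP; apply: measurable_funTS; exact: mh.
  - by apply/measurable_EFinP; exact: measurable_indic.
  - apply: aeW => y; rewrite /= in_itv/= andbT => y0.
    have xE n : h n y = psi (expR (- (dl * y))) n.
      by rewrite /h /psi -expRM_natl -mulrA mulrN.
    under eq_fun do rewrite xE.
    have half : (2^-1 = expR (- (dl * a)))%R.
      by rewrite divfK ?gt_eqF// expRN lnK// posrE.
    rewrite indicE mem_setE in_itv/= andbT; case: ltP => ay.
      apply/cvg_EFin; first by near=> n.
      apply: psi_cvg1; rewrite expR_ge0/= half ltr_expR ltrN2 ltr_pM2l//.
    apply/cvg_EFin; first by near=> n.
    apply: psi_cvg0; rewrite half ler_expR lerN2 ler_pM2l// ay/=.
    by rewrite expR_le1 oppr_le0 mulr_ge0// ltW.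
  - have := @integrable_bounded m (cst 1%R) moo (measurable_cst _).
    by apply => y _; rewrite ler01 lexx.
  - apply: aeW => y n; rewrite /= in_itv/= andbT => /(H n) /andP[? ?].
    by rewrite lee_fin ger0_norm.
have := lim m1 m1oo.
under eq_fun => n.
  rewrite (_ : \int[m1]_(y in pos) (h n y)%:E = \int[m2]_(y in pos) (h n y)%:E).
    over.
  have := @eq_power m1 m2 _ (c0 n) m1oo m2oo eqL (n * 2 ^ n)%N 0%R (lexx _).
  by under eq_integral do rewrite mul0r oppr0 expR0 mulr1;
     under [in RHS]eq_integral do rewrite mul0r oppr0 expR0 mulr1.
move=> l1; have l2 := lim m2 m2oo; apply: (cvg_unique _ l1 l2) => //.
Unshelve. all: by end_near. Qed.

(** The open right half-lines form a pi-system generating the Borel sets. They agree at a > 0 by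
    [eq_tail], at 0 by continuity from below, and at a < 0 because they then carry the total mass,
    which is the transform at r = 0. *)
Let eq_finite m1 m2 : m1 `]-oo, 0%R[%classic = 0 -> m2 `]-oo, 0%R[%classic = 0 ->
  m1 setT < +oo -> m2 setT < +oo ->
  (forall r, (0 <= r)%R -> \int[m1]_(y in pos) (expR (- (r * y)))%:E =
     \int[m2]_(y in pos) (expR (- (r * y)))%:E) ->
  forall A, measurable A -> m1 A = m2 A.
Proof.
move=> m10 m20 m1oo m2oo eqL.
have mpE m B : m `]-oo, 0%R[%classic = 0 -> measurable B -> pos `<=` B ->
    m B = m pos.
  move=> m0 mB pB; have mn : measurable (B `&` `]-oo, 0%R[%classic).
    exact: measurableI.
  rewrite -(measureU0 mpos mn); last first.
    by apply: subset_measure0 m0 => //; exact: subIsetr.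
  congr (m _); apply/seteqP; split=> y /=.
    by move=> By; have [y0|y0] := leP 0%R y; [left|right];
       rewrite ?in_itv/= ?andbT.
  by move=> [/pB//|[]].
have mT m : m `]-oo, 0%R[%classic = 0 ->
    m setT = \int[m]_(y in pos) (expR (- (0 * y)))%:E.
  move=> m0; under eq_integral do rewrite mul0r oppr0 expR0.
  by rewrite integral_cst// mul1e; apply: mpE.
have eqT : m1 setT = m2 setT by rewrite !mT// eqL.
have eqpos a : (0 < a)%R -> m1 `]a, +oo[%classic = m2 `]a, +oo[%classic.
  by move=> a0; exact: eq_tail.
have eq0 : m1 `]0%R, +oo[%classic = m2 `]0%R, +oo[%classic.
  have FU := @cvg_measure_itv0y R.
  apply: (cvg_unique _ (FU m1)) => //.
  have := FU m2; apply: cvg_trans; apply: near_eq_cvg; near=> n.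
  by rewrite eqpos ?invr_gt0.
have eqneg a : (a < 0)%R -> m1 `]a, +oo[%classic = m2 `]a, +oo[%classic.
  move=> a0; have pa : pos `<=` `]a, +oo[%classic.
    by move=> y /=; rewrite !in_itv/= !andbT; exact: lt_le_trans.
  by rewrite !(mpE _ `]a, +oo[%classic)// -(mpE m1 setT)// -(mpE m2 setT).
move=> A mA.
have := @measure_unique _ R (measurableTypeR R) (@measurable_realfun.RGenOInfty.G R)
  (fun n => `](- n%:R)%R, +oo[%classic).
move=> U.
apply: U => //.
- by rewrite measurable_realfun.RGenOInfty.measurableE.
- move=> _ _ [a ->] [b ->]; exists (Num.max a b).
  by apply/seteqP; split=> y /=; rewrite !in_itv/= !andbT gt_max => /andP.
- by move=> n; exists (- n%:R)%R.
- apply/seteqP; split=> // y _; exists (Num.bound `|y|%R) => //=.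
  rewrite in_itv/= andbT ltrNl; apply: (le_lt_trans (ler_norm _)).
  by rewrite normrN; apply: archi_boundP.
- by move=> _ [a ->]; case: (ltgtP a 0%R) => [/eqneg|/eqpos|->].
- by move=> n; apply: le_lt_trans m1oo; apply: le_measure; rewrite ?inE.
Unshelve. all: by end_near. Qed.

(** The measures may be infinite. Tilting them by exp(-y) makes them finite and shifts the
    transforms from r to 1 + r, so the finite case applies; multiplication by exp(y) then undoes the
    tilt. *)
Lemma laplace_unique m1 m2 :
  m1 `]-oo, 0%R[%classic = 0 -> m2 `]-oo, 0%R[%classic = 0 ->
  (forall r, (0 < r)%R -> \int[m1]_y (expR (- (r * y)))%:E < +oo) ->
  (forall r, (0 < r)%R -> \int[m1]_y (expR (- (r * y)))%:E =
     \int[m2]_y (expR (- (r * y)))%:E) ->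
  forall A, measurable A -> m1 A = m2 A.
Proof.
move=> m10 m20 Loo eqL.
have mid : measurable_fun [set: measurableTypeR R] (@id (measurableTypeR R)).
  exact: measurable_id.
have mexp : measurable_fun setT (fun y : R => expR (- (1 * y))) by meas_tac.
have e0 (y : R) : (0 <= expR (- (1 * y)))%R by exact: expR_ge0.
have [n1 n1E] := image_measure_exists m1 mid mexp e0.
have [n2 n2E] := image_measure_exists m2 mid mexp e0.
have ind0 (A : set R) y : 0 <= (\1_A y)%:E :> \bar R by rewrite lee_fin.
have key m : m `]-oo, 0%R[%classic = 0 -> forall f, measurable_fun setT f ->
   (forall y, 0 <= f y) ->
   \int[m]_(y in pos) f y = \int[m]_y f y.
  move=> m0 f mf f0.
  rewrite (_ : setT = pos `|` `]-oo, 0%R[%classic); last first.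
    apply/esym/seteqP; split => // y _ /=; rewrite !in_itv/= andbT.
    by have [|] := leP 0%R y; [left|right].
  rewrite ge0_integral_setU//=; last 2 first.
  - exact: measurable_funTS.
  - by apply/disj_setPS => y [] /=; rewrite !in_itv/= andbT leNgt => /negP.
  rewrite [X in _ + X](_ : _ = 0) ?adde0//.
  rewrite integral_mkcond; apply: (ge0_integral_null _ m0) => //.
  - by apply/(measurable_restrictT _ _).1 => //; exact: measurable_funTS.
  - by move=> y; rewrite patchE; case: ifP.
  - by move=> y ny; rewrite patchE memNset.
have null m (n : {measure set (measurableTypeR R) -> \bar R}) : m `]-oo, 0%R[%classic = 0 -> (forall g, measurable_fun setT g ->
    (forall y, 0 <= g y) ->
    \int[n]_y g y = \int[m]_y ((expR (- (1 * y)))%:E * g y)) ->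
    n `]-oo, 0%R[%classic = 0.
  move=> m0 nE; rewrite measure_integral_indic// nE//; last exact: measurable_EFin_indic.
  apply: (ge0_integral_null _ m0) => //.
  - by apply: emeasurable_funM; [meas_tac|exact: measurable_EFin_indic].
  - by move=> y ny; rewrite indicE memNset// mule0.
have n10 := null _ _ m10 n1E.
have n20 := null _ _ m20 n2E.
have nE : forall A, measurable A -> n1 A = n2 A.
  apply: eq_finite => //.
  - rewrite measure_integral_indic// n1E//; last exact: measurable_EFin_indic.
    under eq_integral do rewrite indicE in_setT mule1. by apply: Loo.
  - rewrite measure_integral_indic// n2E//; last exact: measurable_EFin_indic.
    under eq_integral do rewrite indicE in_setT mule1. by rewrite -eqL// Loo.
  - move=> r r0; have mr : measurable_fun setT (fun y : R => (expR (- (r * y)))%:E) by meas_tac.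
    rewrite !key// n1E// n2E//.
    have E y : (expR (- (1 * y)))%:E * (expR (- (r * y)))%:E = (expR (- ((1 + r) * y)))%:E :> \bar R.
      by rewrite -EFinM -expRD -opprD -mulrDl.
    under eq_integral do rewrite E; under [RHS]eq_integral do rewrite E.
    by apply: eqL; lra.
move=> A mA.
have mg : measurable_fun setT (fun y : R => (expR (1 * y))%:E * (\1_A y)%:E).
  by apply: emeasurable_funM; [meas_tac|exact: measurable_EFin_indic].
have g0 (y : R) : 0 <= (expR (1 * y))%:E * (\1_A y)%:E.
  by rewrite mule_ge0 ?lee_fin ?expR_ge0.
have E (y : R) : (\1_A y)%:E = (expR (- (1 * y)))%:E * ((expR (1 * y))%:E * (\1_A y)%:E) :> \bar R.
  by rewrite -!EFinM mulrA -expRD addNr expR0 mul1r.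
rewrite !measure_integral_indic//; under eq_integral do rewrite E; under [RHS]eq_integral do rewrite E.
rewrite -n1E// -n2E//; apply: eq_measure_integral => B mB _; exact: nE.
Qed.
End laplace_uniqueness.

Section laplace_functions.
Local Open Scope ereal_scope.
Context (R : realType).
Notation leb := (@lebesgue_measure R).

(** A finite integral against a strictly positive weight forces [F] to be finite almost
    everywhere. *)
Lemma ae_eq_fine d (T : measurableType d) (m : {measure set T -> \bar R}) (F : T -> \bar R) :
  measurable_fun setT F -> (forall y, 0 <= F y) ->
  (forall g : T -> R, measurable_fun setT g -> (forall y, (0 < g y)%R) ->
    \int[m]_y ((g y)%:E * F y) < +oo -> ae_eq m setT F (EFin \o (fine \o F))).
Proof.
move=> mF F0 g mg g0 goo.
have ig : m.-integrable setT (fun y => (g y)%:E * F y).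
  apply/integrableP; split; first by meas_tac.
  under eq_integral do rewrite gee0_abs ?mule_ge0 ?lee_fin ?(ltW (g0 _))//.
  by [].
have := integrable_ae measurableT ig.
apply: filterS => y /(_ I) /= h _; rewrite fineK//.
have := F0 y; case: (F y) h => //=; rewrite gt0_muley// lte_fin//.
Qed.

(** The measures with densities [F1] and [F2] coincide by [laplace_unique]. The weight exp(-y) makes
    both functions integrable, so equality of their integrals over all measurable sets gives
    equality almost everywhere, and the weight is then cancelled. *)
Lemma laplace_unique_fun (F1 F2 : R -> \bar R) :
  measurable_fun setT F1 -> measurable_fun setT F2 ->
  (forall y, 0 <= F1 y) -> (forall y, 0 <= F2 y) ->
  (forall y, (y < 0)%R -> F1 y = 0) -> (forall y, (y < 0)%R -> F2 y = 0) ->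
  (forall r, (0 < r)%R -> \int[leb]_y ((expR (- (r * y)))%:E * F1 y) < +oo) ->
  (forall r, (0 < r)%R -> \int[leb]_y ((expR (- (r * y)))%:E * F1 y) =
     \int[leb]_y ((expR (- (r * y)))%:E * F2 y)) ->
  ae_eq leb setT F1 F2.
Proof.
move=> mF1 mF2 F10 F20 F1n F2n F1oo F12.
pose c (F : R -> \bar R) := fine \o F.
have mc F : measurable_fun setT F -> measurable_fun setT (c F).
  by move=> mF; exact: measurableT_comp.
have c0 (F : R -> \bar R) : (forall y, 0 <= F y) -> forall y, (0 <= c F y)%R.
  by move=> F0 y; exact: fine_ge0.
have fin F : measurable_fun setT F -> (forall y, 0 <= F y) ->
    (forall r, (0 < r)%R -> \int[leb]_y ((expR (- (r * y)))%:E * F y) < +oo) ->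
    ae_eq leb setT F (EFin \o c F).
  move=> mF F0 Foo; apply: (@ae_eq_fine _ _ leb F mF F0 (fun y : R => expR (- (1 * y)))%R).
  - by meas_tac.
  - by move=> y; exact: expR_gt0.
  - by apply: Foo.
have F2oo r : (0 < r)%R -> \int[leb]_y ((expR (- (r * y)))%:E * F2 y) < +oo.
  by move=> r0; rewrite -F12// F1oo.
have fin1 := fin F1 mF1 F10 F1oo; have fin2 := fin F2 mF2 F20 F2oo.
have mid : measurable_fun [set: measurableTypeR R] (@id (measurableTypeR R)).
  exact: measurable_id.
have [n1 n1E] := image_measure_exists leb mid (mc _ mF1) (c0 _ F10).
have [n2 n2E] := image_measure_exists leb mid (mc _ mF2) (c0 _ F20).
have intE F (n : {measure set (measurableTypeR R) -> \bar R}) :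
    measurable_fun setT F -> (forall y, 0 <= F y) ->
    ae_eq leb setT F (EFin \o c F) ->
    (forall g : measurableTypeR R -> \bar R, measurable_fun setT g -> (forall y, 0 <= g y) ->
      \int[n]_y g y = \int[leb]_y ((c F y)%:E * g y)) ->
    forall g : R -> \bar R, measurable_fun setT g -> (forall y, 0 <= g y) ->
      \int[n]_y g y = \int[leb]_y (g y * F y).
  move=> mF F0 fF nE g mg g0; rewrite nE//; apply: ge0_ae_eq_integral => //.
  - by apply: emeasurable_funM => //; apply/measurable_EFinP; exact: mc.
  - by apply: emeasurable_funM.
  - by move=> y _; rewrite mule_ge0// lee_fin c0.
  - by move=> y _; rewrite mule_ge0.
  - by apply: filterS fF => y h /h ->; rewrite /= muleC.
have {}n1E := intE _ _ mF1 F10 fin1 n1E.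
have {}n2E := intE _ _ mF2 F20 fin2 n2E.
have neg (n : {measure set (measurableTypeR R) -> \bar R}) F : (forall y, (y < 0)%R -> F y = 0) ->
    (forall g : R -> \bar R, measurable_fun setT g -> (forall y, 0 <= g y) ->
      \int[n]_y g y = \int[leb]_y (g y * F y)) -> n `]-oo, 0%R[%classic = 0.
  move=> Fn nE; rewrite measure_integral_indic// nE//; last exact: measurable_EFin_indic.
  apply: integral0_eq => y _; rewrite indicE mem_setE in_itv/=.
  by case: ltP => [/Fn ->|]; rewrite ?mule0 ?mul0e.
have mexp r : measurable_fun setT (fun y : R => (expR (- (r * y)))%:E) by meas_tac.
have exp0 r (y : R) : 0 <= (expR (- (r * y)))%:E :> \bar R by rewrite lee_fin expR_ge0.
have n12 : forall A, measurable A -> n1 A = n2 A.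
  apply: laplace_unique (neg _ _ F1n n1E) (neg _ _ F2n n2E) _ _ => r r0.
    by rewrite n1E// F1oo.
  by rewrite n1E// n2E// F12.
have E : ae_eq leb setT (fun y => (expR (- (1 * y)))%:E * F1 y) (fun y => (expR (- (1 * y)))%:E * F2 y).
  apply: integral_ae_eq => //.
  - apply/integrableP; split; first by meas_tac.
    by under eq_integral do rewrite gee0_abs ?mule_ge0//; exact: F1oo.
  - by meas_tac.
  - move=> A _ mA.
    have H (n : {measure set (measurableTypeR R) -> \bar R}) F :
     (forall y, 0 <= F y) ->
     (forall g : R -> \bar R, measurable_fun setT g -> (forall y, 0 <= g y) ->
      \int[n]_y g y = \int[leb]_y (g y * F y)) ->
      \int[leb]_(y in A) ((expR (- (1 * y)))%:E * F y) =
      \int[n]_y ((expR (- (1 * y)))%:E * (\1_A y)%:E).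
      move=> F0 nE; rewrite nE; last 2 first.
      + by apply: emeasurable_funM => //; exact: measurable_EFin_indic.
      + by move=> y; rewrite mule_ge0.
      rewrite integral_mkcond; apply: eq_integral => y _; rewrite patchE indicE.
      by case: ifP; rewrite ?mule1 ?mule0 ?mul0e.
    by rewrite (H n1)// (H n2)//; apply: eq_measure_integral => B mB _; exact: n12.
apply: filterS E => y h /h {h}.
move=> /(congr1 (fun z => (expR (1 * y))%:E * z)).
by rewrite !muleA -EFinM -expRD subrr expR0 !mul1e.
Qed.

End laplace_functions.

Section exponential_kernel.
Local Open Scope ereal_scope.
Context (R : realType).
Notation leb := (@lebesgue_measure R).

Lemma integral_expR_itv (r a b : R) : (0 < r)%R -> (a <= b)%R ->
  \int[leb]_y (r * expR (- (r * y)) * ((a < y) && (y < b))%:R)%:E =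
  (expR (- (r * a)) - expR (- (r * b)))%:E.
Proof.
move=> r0; rewrite le_eqVlt => /predU1P[->|ab].
  rewrite subrr integral0_eq// => y _; case: (ltP b y) => //= by_; last by rewrite mulr0.
  by rewrite ltNge ltW//= mulr0.
transitivity (\int[leb]_(y in `]a, b[) (r * expR (- (r * y)))%:E).
  rewrite [RHS]integral_mkcond; apply: eq_integral => y _.
  by rewrite patchE mem_setE in_itv/=; case: andP; rewrite ?mulr1 ?mulr0.
rewrite -(@integral_itv_bndoo _ a b _ true false); last first.
  by apply/measurable_EFinP; apply: measurable_funTS; meas_tac.
pose F (y : R) : R := (- expR (- (r * y)))%R.
have dF (y : R) : is_derive y 1%R F (r * expR (- (r * y)))%R.
  by apply: is_derive_eq; rewrite -[(r%:A)%R]/(r * 1)%R mulr1 mulrN opprK mulrC.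
have cF : continuous F.
  by move=> y; apply/differentiable_continuous/derivable1_diffP; exact: ex_derive.
have cf : continuous (fun y : R => r * expR (- (r * y)))%R.
  by move=> y; apply/differentiable_continuous/derivable1_diffP; exact: ex_derive.
rewrite (@continuous_FTC2 _ (fun y => r * expR (- (r * y)))%R F)//; first last.
- by move=> y _; rewrite derive1E; exact: derive_val.
- split; first by move=> x _; exact: ex_derive.
  + by apply: cvg_at_right_filter; exact: cF.
  + by apply: cvg_at_left_filter; exact: cF.
- by apply: continuous_subspaceT => x; exact: cf.
by rewrite /F -EFinB; congr (_%:E); rewrite opprK addrC.
Qed.

Context d (X : measurableType d) (m : {sigma_finite_measure set X -> \bar R}).

(** Tonelli, then the integral of r exp(-ry) over the interval ]a x, b x[. The closed form is wrong
    when b x < a x, hence the alternative that the coefficient vanishes there. *)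
Lemma laplace_strip (c a b : X -> R) (r : R) : (0 < r)%R ->
  measurable_fun setT c -> measurable_fun setT a -> measurable_fun setT b ->
  (forall x, (0 <= c x)%R) -> (forall x, c x = 0%R \/ (a x <= b x)%R) ->
  \int[leb]_y ((r * expR (- (r * y)))%:E *
    \int[m]_x (c x * ((a x < y) && (y < b x))%:R)%:E) =
  \int[m]_x (c x * (expR (- (r * a x)) - expR (- (r * b x))))%:E.
Proof.
move=> r0 mc ma mb c0 ab.
pose h (p : R * X) : \bar R := (r * expR (- (r * p.1)))%:E *
   (c p.2 * ((a p.2 < p.1) && (p.1 < b p.2))%:R)%:E.
have mh : measurable_fun setT h by rewrite /h; meas_tac.
have h0 p : 0 <= h p.
  by rewrite /h mule_ge0// lee_fin mulr_ge0// ?expR_ge0// ltW.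
transitivity (\int[leb]_y \int[m]_x h (y, x)).
  apply: eq_integral => y _; rewrite /h /= ge0_integralZl//.
  - by meas_tac.
  - by move=> x _; rewrite lee_fin mulr_ge0.
  - by rewrite lee_fin mulr_ge0// ?expR_ge0// ltW.
rewrite (fubini_tonelli (m1 := leb) (m2 := m) h)//.
apply: eq_integral => x _; rewrite /h /=.
transitivity ((c x)%:E * \int[leb]_y (r * expR (- (r * y)) * ((a x < y) && (y < b x))%:R)%:E).
  rewrite -ge0_integralZl//.
  - by apply: eq_integral => y _; rewrite -!EFinM; congr (_%:E); ring.
  - by meas_tac.
  - by move=> y _; rewrite lee_fin !mulr_ge0// ?expR_ge0// ltW.
  - by rewrite lee_fin.
have [->|abx] := ab x; first by rewrite !mul0r mul0e.
by rewrite integral_expR_itv.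
Qed.
End exponential_kernel.

(** * The tail of the Lévy measure and its convolutions *)

Definition tail_fun (R : realType) (nu : set R -> \bar R) (y : R) : \bar R :=
  if (0 < y)%R then nu `]y, +oo[%classic else 0%E.

Section tail_fun.
Local Open Scope ereal_scope.
Context (R : realType).
Notation leb := (@lebesgue_measure R).
Variable nu : {sigma_finite_measure set (measurableTypeR R) -> \bar R}.

(** The shifted tail counts the jump sizes s that carry a strictly across y, from a < y to a + s >
    y. In this form a convolution with the tail becomes a strip integral for [laplace_strip]. *)
Lemma tail_fun_shift (y a : R) : tail_fun nu (y - a) =
  \int[nu]_s ((0 < s)%R%:R * ((a < y) && (y < a + s))%R%:R)%:E.
Proof.
rewrite /tail_fun subr_gt0; case: ifPn => ay.
  rewrite measure_integral_indic; last exact: measurable_itv.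
  apply: eq_integral => s _; rewrite indicE mem_setE in_itv/= andbT ltrBlDl.
  congr (_%:E); case: ltP => h; last by rewrite mulr0.
  by rewrite mulr1 (_ : (0 < s)%R)//; lra.
by rewrite integral0_eq// => s _; rewrite mulr0.
Qed.

Lemma tail_funE (y : R) : tail_fun nu y =
  \int[nu]_s ((0 < s)%R%:R * ((0 < y) && (y < s))%R%:R)%:E.
Proof.
by rewrite -[y in LHS]subr0 tail_fun_shift; under eq_integral do rewrite add0r.
Qed.

Lemma tail_fun_ge0 (y : R) : 0 <= tail_fun nu y.
Proof. by rewrite /tail_fun; case: ifP. Qed.

Lemma measurable_tail_fun : measurable_fun setT (tail_fun nu).
Proof.
rewrite (_ : tail_fun nu = fun y => \int[nu]_s
    ((0 < s)%R%:R * ((0 < y) && (y < s))%R%:R)%:E); last first.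
  by apply/funext => y; exact: tail_funE.
apply: (measurable_fun_fubini_tonelli_F (m2 := nu)
  (fun p : R * R => ((0 < p.2)%R%:R * ((0 < p.1) && (p.1 < p.2))%R%:R)%:E)).
- by meas_tac.
- by move=> p; rewrite lee_fin mulr_ge0.
Qed.

Lemma measurable_tail_conv d (X : measurableType d)
    (m : {sigma_finite_measure set X -> \bar R}) (c Z : X -> R) :
  measurable_fun setT c -> (forall x, (0 <= c x)%R) -> measurable_fun setT Z ->
  measurable_fun setT (fun y : R => \int[m]_x ((c x)%:E * tail_fun nu (y - Z x))).
Proof.
move=> mc c0 mZ.
apply: (measurable_fun_fubini_tonelli_F (m2 := m)
  (fun p : R * X => (c p.2)%:E * tail_fun nu (p.1 - Z p.2))).
- apply: emeasurable_funM; first by meas_tac.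
  by apply: (measurableT_comp measurable_tail_fun); meas_tac.
- by move=> p; rewrite mule_ge0 ?lee_fin ?tail_fun_ge0.
Qed.

(** Against the kernel r exp(-ry) the tail has transform f(r), because integration by parts turns it
    into the integral of 1 - exp(-rs) against nu; a convolution becomes a product. The strip is ]Z,
    Z + s[ over the product of [m] and [nu]. *)
Lemma laplace_tail_conv d (X : measurableType d)
    (m : {sigma_finite_measure set X -> \bar R}) (c Z : X -> R) (r fr : R) :
  measurable_fun setT c -> (forall x, (0 <= c x)%R) -> measurable_fun setT Z ->
  (0 < r)%R ->
  \int[nu]_s ((0 < s)%R%:R * (1 - expR (- (r * s))))%:E = fr%:E ->
  \int[leb]_y ((r * expR (- (r * y)))%:E *
    \int[m]_x ((c x)%:E * tail_fun nu (y - Z x))) =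
  fr%:E * \int[m]_x (c x * expR (- (r * Z x)))%:E.
Proof.
move=> mc c0 mZ r0 frE.
have [mnu mnuE] := sigma_finite_product m nu.
have /= := @laplace_strip R _ _ mnu
  (fun p => c p.1 * (0 < p.2)%R%:R)%R (fun p => Z p.1) (fun p => Z p.1 + p.2)%R r r0.
have m1 : measurable_fun setT (fun p : X * measurableTypeR R => c p.1 * (0 < p.2)%R%:R)%R by meas_tac.
have m2 : measurable_fun setT (fun p : X * measurableTypeR R => Z p.1) by meas_tac.
have m3 : measurable_fun setT (fun p : X * measurableTypeR R => Z p.1 + p.2)%R by meas_tac.
move=> /(_ m1 m2 m3) H; rewrite {}mnuE in H.
have {}H := H (fun p => mulr_ge0 (c0 p.1) (ler0n _ _)).
have {}H := H _.
have fr0 : (0 <= fr)%R.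
  rewrite -lee_fin -frE; apply: integral_ge0 => s _; rewrite lee_fin.
  by case: ltP => s0; rewrite ?mul0r// mul1r subr_ge0 expR_le1 oppr_le0 mulr_ge0// ltW.
transitivity (\int[m \x nu]_p (c p.1 * (0 < p.2)%R%:R *
    (expR (- (r * Z p.1)) - expR (- (r * (Z p.1 + p.2)))))%:E).
  rewrite -H; last first.
    by move=> p; case: ltP => p0; [right; lra|left; rewrite mulr0].
  apply: eq_integral => y _; congr (_ * _).
  rewrite (fubini_tonelli1 (m1 := m) (m2 := nu)); last 2 first.
  - by meas_tac.
  - by move=> p; rewrite lee_fin !mulr_ge0.
  apply: eq_integral => x _; rewrite /fubini_F/= tail_fun_shift -ge0_integralZl//.
  - by apply: eq_integral => s _; rewrite -EFinM mulrA.
  - by meas_tac.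
  - by rewrite lee_fin.
have E (x : X) (s : R) : (c x * (0 < s)%R%:R * (expR (- (r * Z x)) - expR (- (r * (Z x + s)))) =
    (c x * expR (- (r * Z x))) * ((0 < s)%R%:R * (1 - expR (- (r * s)))))%R.
  have -> : (expR (- (r * (Z x + s))) = expR (- (r * Z x)) * expR (- (r * s)))%R.
    by rewrite -expRD -opprD -mulrDr.
  by ring.
have ge0 (s : R) : (0 <= (0 < s)%R%:R * (1 - expR (- (r * s))))%R.
  by case: ltP => s0; rewrite ?mul0r// mul1r subr_ge0 expR_le1 oppr_le0 mulr_ge0// ltW.
rewrite (fubini_tonelli1 (m1 := m) (m2 := nu)); last 2 first.
- by meas_tac.
- by move=> p; rewrite lee_fin E mulr_ge0// mulr_ge0// expR_ge0.
rewrite -ge0_integralZl//; side_tac.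
apply: eq_integral => x _; rewrite /fubini_F/= muleC -frE -ge0_integralZl//; side_tac.
by apply: eq_integral => s _; rewrite -EFinM E.
Qed.

Lemma laplace_survival d (X : measurableType d)
    (m : {sigma_finite_measure set X -> \bar R}) (Z : X -> R) (r : R) :
  measurable_fun setT Z -> (0 < r)%R ->
  \int[leb]_y ((r * expR (- (r * y)))%:E *
    \int[m]_x (((0 < y) && (y < Z x))%R%:R)%:E) =
  \int[m]_x ((0 < Z x)%R%:R * (1 - expR (- (r * Z x))))%:E.
Proof.
move=> mZ r0.
have mc : measurable_fun setT (fun x => (0 < Z x)%R%:R : R) by meas_tac.
have E (x : X) : (1 - expR (- (r * Z x)) = expR (- (r * 0)) - expR (- (r * Z x)))%R.
  by rewrite mulr0 oppr0 expR0.
under [RHS]eq_integral do rewrite E.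
rewrite -(@laplace_strip R _ _ m (fun x => (0 < Z x)%R%:R) (fun=> 0%R) Z r r0 mc
  (measurable_cst _) mZ (fun x => ler0n _ _)); last first.
  by move=> x; case: ltP => x0; [right; exact: ltW|left].
apply: eq_integral => y _; congr (_ * _); apply: eq_integral => x _.
congr (_%:E); case: (ltP 0%R y) => y0 /=; last by rewrite mulr0.
by case: (ltP y) => yZ; rewrite ?mulr0// (lt_trans y0 yZ) mulr1.
Qed.

End tail_fun.

Section laplace_kernel.
Local Open Scope ereal_scope.
Context (R : realType).
Notation leb := (@lebesgue_measure R).

Lemma integral_expR_pos (r : R) : (0 < r)%R ->
  \int[leb]_y ((r * expR (- (r * y)))%:E * ((0 < y)%R%:R)%:E) = 1.
Proof.
move=> r0; rewrite -(integral_exponential_pdf r0).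
apply: ge0_ae_eq_integral => //.
- by meas_tac.
- by apply/measurable_EFinP; exact: measurable_exponential_pdf.
- by move=> y _; rewrite lee_fin !mulr_ge0// ?expR_ge0// ltW.
- by move=> y _; rewrite lee_fin exponential_pdf_ge0// ltW.
- exists [set 0%R]; split => //; first exact: lebesgue_measure_set1.
  move=> y /= h; apply: contrapT => /eqP y0; apply: h => _.
  rewrite -EFinM /exponential_pdf patchE; congr (_%:E).
  rewrite mem_setE in_itv/= andbT lt_neqAle eq_sym y0/=.
  by case: ifP; rewrite ?mulr1 ?mulr0// mulNr.
Qed.

Lemma laplace_unique_kernel (F1 F2 : R -> \bar R) :
  measurable_fun setT F1 -> measurable_fun setT F2 ->
  (forall y, 0 <= F1 y) -> (forall y, 0 <= F2 y) ->
  (forall y, (y < 0)%R -> F1 y = 0) -> (forall y, (y < 0)%R -> F2 y = 0) ->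
  (forall r, (0 < r)%R -> \int[leb]_y ((r * expR (- (r * y)))%:E * F1 y) < +oo) ->
  (forall r, (0 < r)%R -> \int[leb]_y ((r * expR (- (r * y)))%:E * F1 y) =
     \int[leb]_y ((r * expR (- (r * y)))%:E * F2 y)) ->
  ae_eq leb setT F1 F2.
Proof.
move=> mF1 mF2 F10 F20 F1n F2n F1oo F12.
have E F (r : R) : measurable_fun setT F -> (forall y, 0 <= F y) -> (0 < r)%R ->
    \int[leb]_y ((expR (- (r * y)))%:E * F y) =
    (r^-1)%:E * \int[leb]_y ((r * expR (- (r * y)))%:E * F y).
  move=> mF F0 r0; rewrite -ge0_integralZl//.
  - by apply: eq_integral => y _; rewrite muleA -EFinM mulKf// gt_eqF.
  - by meas_tac.
  - by move=> y _; rewrite mule_ge0// lee_fin mulr_ge0 ?expR_ge0// ltW.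
  - by rewrite lee_fin invr_ge0 ltW.
apply: laplace_unique_fun => // r r0.
  by rewrite E// lte_mul_pinfty ?lee_fin ?invr_ge0 ?(ltW r0)// F1oo.
by rewrite E// [RHS]E// F12.
Qed.

Lemma ae_exists (Q : R -> Prop) (a b : R) : (a < b)%R ->
  {ae leb, forall y, Q y} -> exists2 y, (a < y < b)%R & Q y.
Proof.
move=> ab [N [mN N0 QN]]; apply: contrapT => h.
have sub : `]a, b[%classic `<=` N.
  move=> y; rewrite /= in_itv/= => yab; apply: QN => Qy; apply: h.
  by exists y.
have : leb `]a, b[%classic = 0 by exact: (subset_measure0 _ mN sub N0).
rewrite lebesgue_measure_itv/= lte_fin ab -EFinB => -[] /eqP.
by rewrite subr_eq0 gt_eqF.
Qed.

End laplace_kernel.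

(** * The renewal equation *)

Section potential.
Local Open Scope ereal_scope.
Context (R : realType).
Notation leb := (@lebesgue_measure R).
Variables (nu U : {sigma_finite_measure set (measurableTypeR R) -> \bar R}).
Variable f : R -> R.
Hypotheses (f_gt0 : forall r, (0 < r)%R -> (0 < f r)%R)
  (fE : forall r, (0 < r)%R ->
    \int[nu]_s ((0 < s)%R%:R * (1 - expR (- (r * s))))%:E = (f r)%:E)
  (U_neg : U `]-oo, 0%R[%classic = 0)
  (UE : forall r, (0 < r)%R ->
    \int[U]_a (expR (- (r * a)))%:E = ((f r)^-1)%:E).

Let phi (t : R) : \bar R := \int[U]_a tail_fun nu (t - a).

Let mid : measurable_fun [set: measurableTypeR R] (@id (measurableTypeR R)).
Proof. exact: measurable_id. Qed.

Let mtail (t : R) : measurable_fun setT (fun a : R => tail_fun nu (t - a)).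
Proof. by apply: (measurableT_comp (measurable_tail_fun nu)); meas_tac. Qed.

Let mphi : measurable_fun setT phi.
Proof.
have := @measurable_tail_conv R nu _ _ U (fun=> 1%R) id (measurable_cst _) _ mid.
move=> /(_ (fun=> ler01)); apply: eq_measurable_fun => y _.
by apply: eq_integral => a _; rewrite mul1e.
Qed.

Let phi_ge0 t : 0 <= phi t.
Proof. by apply: integral_ge0 => a _; exact: tail_fun_ge0. Qed.

Let phi_le0 t : (t <= 0)%R -> phi t = 0.
Proof.
move=> t0; apply: (ge0_integral_null _ U_neg) => //.
- exact: mtail.
- by move=> a; exact: tail_fun_ge0.
- move=> a /=; rewrite in_itv/= => /negP; rewrite -leNgt => a0.
  by rewrite /tail_fun subr_gt0 ltNge (le_trans t0 a0).
Qed.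

(** The transform of [phi] is f(r) times 1/f(r), the transform of the indicator of the positive
    half-line. *)
Lemma potential_tail_ae : ae_eq leb setT phi (fun y => ((0 < y)%R%:R)%:E).
Proof.
have H r : (0 < r)%R -> \int[leb]_y ((r * expR (- (r * y)))%:E * phi y) = 1.
  move=> r0.
  have := @laplace_tail_conv R nu _ _ U (fun=> 1%R) id r (f r)
    (measurable_cst _) (fun=> ler01) mid r0 (fE r0).
  under eq_integral do under eq_integral do rewrite mul1e.
  under [in X in _ = _ * X]eq_integral do rewrite mul1r.
  by move=> ->; rewrite UE// -EFinM mulfV// gt_eqF// f_gt0.
apply: laplace_unique_kernel => //.
- by meas_tac.
- by move=> y y0; rewrite phi_le0// ltW.
- by move=> y y0; rewrite ltNge ltW.
- by move=> r r0; rewrite H// ltry.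
- by move=> r r0; rewrite H// integral_expR_pos.
Qed.

(* The law of the overshoot level, that is of the value of H just after it
   passes x0, is the image of U(da) nu(ds) on a < x0 < a + s under addition; it
   has mass phi x0, whence the choice of a level at which phi is exactly 1. *)
Section overshoot.
Variable x0 : R.
Hypotheses (x0_gt0 : (0 < x0)%R) (phix0 : phi x0 = 1).

Let cs (p : R * R) : R := ((0 < p.2)%R%:R * ((p.1 < x0) && (x0 < p.1 + p.2))%R%:R)%R.

Let mcs : measurable_fun setT cs.
Proof. by rewrite /cs; meas_tac. Qed.

Let cs_ge0 p : (0 <= cs p)%R.
Proof. by rewrite /cs mulr_ge0. Qed.

Lemma overshoot_exists : exists sg : {finite_measure set (measurableTypeR R) -> \bar R},
  forall g : R -> \bar R, measurable_fun setT g -> (forall z, 0 <= g z) ->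
  \int[sg]_z g z = \int[U]_a \int[nu]_s ((cs (a, s))%:E * g (a + s)%R).
Proof.
have mZ : measurable_fun [set: R * R] (fun p : R * R => (p.1 + p.2)%R : measurableTypeR R).
  exact: measurable_funD.
have [sg sgE] := image_measure_exists (U \x nu)%E mZ mcs cs_ge0.
have {}sgE (g : R -> \bar R) : measurable_fun setT g -> (forall z, 0 <= g z) ->
  \int[sg]_z g z = \int[U]_a \int[nu]_s ((cs (a, s))%:E * g (a + s)%R).
  move=> mg g0; rewrite sgE// (fubini_tonelli1 (m1 := U) (m2 := nu))//.
  - apply: emeasurable_funM; first by apply/measurable_EFinP.
    exact: (measurableT_comp mg mZ).
  - by move=> p; rewrite mule_ge0// lee_fin.
have [|sg' sg'E] := finite_pack (mu := sg).
  rewrite measure_integral_indic// sgE//; last exact: measurable_EFin_indic.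
  suff -> : \int[U]_a \int[nu]_s ((cs (a, s))%:E * (\1_setT (a + s)%R)%:E) = phi x0.
    by rewrite phix0 ltry.
  apply: eq_integral => a _; rewrite tail_fun_shift; apply: eq_integral => s _.
  by rewrite indicE in_setT mule1.
exists sg' => g mg g0; rewrite -sgE//.
by apply: eq_measure_integral => B _ _; exact: (congr1 (fun m => m B) sg'E).
Qed.

Variable sg : {finite_measure set (measurableTypeR R) -> \bar R}.
Hypothesis sgE : forall g : R -> \bar R, measurable_fun setT g -> (forall z, 0 <= g z) ->
  \int[sg]_z g z = \int[U]_a \int[nu]_s ((cs (a, s))%:E * g (a + s)%R).
Hypothesis nuAC : forall B : set R, measurable B -> leb B = 0 ->
  nu (B `&` `]0%R, +oo[) = 0.

Let sg_ind (g : R -> \bar R) : measurable_fun setT g -> (forall z, 0 <= g z) ->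
  (forall z, (x0 < z)%R -> g z = 0) -> \int[sg]_z g z = 0.
Proof.
move=> mg g0 gz; rewrite sgE//; apply: integral0_eq => a _.
apply: integral0_eq => s _; rewrite /cs /=.
by case: ltP => [_|]; case: (ltP x0) => [/gz ->|]; rewrite ?mule0 ?andbF ?mulr0 ?mul0r ?mul0e.
Qed.

Lemma overshoot_total : \int[sg]_z 1 = 1.
Proof.
rewrite (sgE (measurable_cst 1) (fun=> lee01)); transitivity (phi x0) => //.
apply: eq_integral => a _; rewrite tail_fun_shift; apply: eq_integral => s _.
by rewrite mule1.
Qed.

(** For a fixed starting point a, landing in [B] means that the jump size lies in a translate of
    [B], a Lebesgue-null set that [nu] does not charge on the positive half-line. *)
Lemma overshoot_AC (B : set R) : measurable B -> leb B = 0 -> sg B = 0.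
Proof.
move=> mB B0; rewrite measure_integral_indic// sgE//; last exact: measurable_EFin_indic.
apply: integral0_eq => a _.
have mBi : measurable_fun setT (fun x : R => (\1_B x)%:E : \bar R).
  exact: measurable_EFin_indic.
have mBa : measurable ((fun s : R => a + s)%R @^-1` B).
  by rewrite -[X in measurable X]setTI; apply: measurable_funD.
have Ba0 := lebesgue_null_translation a mB B0.
apply: (ge0_integral_null _ (nuAC mBa Ba0)).
- by apply: measurableI => //; exact: measurable_itv.
- apply: emeasurable_funM; first by rewrite /cs; meas_tac.
  apply: (measurableT_comp mBi); exact: measurable_funD.
- by move=> s; rewrite mule_ge0// lee_fin.
- move=> s; rewrite /= in_itv/= andbT => /not_andP[Bas|/negP s0].
    by rewrite indicE memNset ?mule0.
  by rewrite /cs /= (negbTE s0) mul0r mul0e.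
Qed.

Let S (y : R) : \bar R := \int[U]_a (((a < x0)%R%:R)%:E * tail_fun nu (y - a)).

(** A jump from below x0 across y >= x0 is a jump across x0 that lands beyond y. *)
Lemma overshoot_tail (y : R) : (x0 <= y)%R ->
  S y = \int[sg]_z ((y < z)%R%:R)%:E.
Proof.
move=> x0y; rewrite sgE//; side_tac.
apply: eq_integral => a _; rewrite tail_fun_shift -ge0_integralZl//; side_tac.
apply: eq_integral => s _; rewrite -!EFinM /cs /=; congr (_%:E).
case: (ltP a x0) => ax0; last by rewrite !mul0r mulr0 mul0r.
rewrite (lt_le_trans ax0 x0y)/= mul1r.
case: (ltP y) => h; last by rewrite !mulr0.
by rewrite (le_lt_trans x0y h) /= !mulr1.
Qed.

Let S_lt (y : R) : (y < x0)%R -> S y = phi y.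
Proof.
move=> yx0; apply: eq_integral => a _; rewrite /tail_fun subr_gt0.
by case: ltP => ax0; rewrite ?mul1e// mul0e ltNge (le_trans (ltW yx0) ax0).
Qed.

(** Above x0 this is [overshoot_tail]. Below x0, [S] agrees with [phi], hence almost everywhere with
    the indicator of y > 0, and the overshoot law has all its mass 1 beyond x0. *)
Let S_ae : ae_eq leb setT S (fun y => \int[sg]_z (((0 < y) && (y < z))%R%:R)%:E).
Proof.
apply: filterS potential_tail_ae => y /(_ I) phiy _.
have [x0y|yx0] := leP x0 y.
  rewrite overshoot_tail//; apply: eq_integral => z _.
  by rewrite (lt_le_trans x0_gt0 x0y).
rewrite S_lt// phiy; case: ltP => y0 /=; last by rewrite integral0_eq.
rewrite -overshoot_total.
have : \int[sg]_z ((z <= y)%R%:R)%:E = 0.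
  apply: sg_ind => //; side_tac.
  by move=> z x0z; rewrite leNgt (lt_trans yx0 x0z).
move=> h; rewrite -[RHS]adde0 -h -ge0_integralD//; side_tac.
by apply: eq_integral => z _; rewrite -EFinD; case: ltP => //=; rewrite ?addr0 ?add0r.
Qed.

(** The transform of [S] is computed twice: as a convolution with the tail, which gives the first
    summand, and through [S_ae], which gives 1 minus the transform of [sg]. *)
Lemma overshoot_laplace (r : R) : (0 < r)%R ->
  (f r)%:E * \int[U]_a ((a < x0)%R%:R * expR (- (r * a)))%:E +
  \int[sg]_z (expR (- (r * z)))%:E = 1.
Proof.
move=> r0.
have mA : measurable_fun setT (fun a : R => (a < x0)%R%:R : R) by meas_tac.
rewrite -(@laplace_tail_conv R nu _ _ U _ id r (f r) mA (fun a => ler0n _ _) mid r0 (fE r0)).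
have mS : measurable_fun setT S.
  by apply: (@measurable_tail_conv R nu _ _ U _ id mA (fun=> ler0n _ _) mid).
rewrite (_ : \int[leb]_y _ = \int[leb]_y ((r * expR (- (r * y)))%:E *
    \int[sg]_z (((0 < y) && (y < z))%R%:R)%:E)); last first.
  apply: ge0_ae_eq_integral => //.
  - by meas_tac.
  - apply: emeasurable_funM; first by meas_tac.
    apply: (measurable_fun_fubini_tonelli_F (m2 := sg)
       (fun p : R * R => (((0 < p.1) && (p.1 < p.2))%R%:R)%:E)); side_tac.
  - by move=> y _; apply: mule_ge0; [nonneg_tac|apply: integral_ge0 => a _; apply: mule_ge0 => //; exact: tail_fun_ge0].
  - by move=> y _; nonneg_tac.
  - by apply: filterS S_ae => y h /h; rewrite /S => ->.
have e1 (z : R) : (0 <= (0 < z)%R%:R * (1 - expR (- (r * z))))%R.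
  case: ltP => z0; rewrite ?mul0r// mul1r.
  by rewrite subr_ge0 expR_le1 oppr_le0 mulr_ge0// ltW.
rewrite (@laplace_survival R _ _ sg id r mid r0).
rewrite -ge0_integralD//; try (by move=> z _; rewrite lee_fin); side_tac.
rewrite -[RHS]overshoot_total.
(* Two integrals over z <= 0, both zero because [sg] lives beyond x0 > 0, are added so that the
   integrands of the two sides agree pointwise. *)
have h : \int[sg]_z (((z <= 0)%R%:R)%:E * (expR (- (r * z)))%:E) = 0.
  apply: sg_ind => //; side_tac.
  by move=> z x0z; rewrite leNgt (lt_trans x0_gt0 x0z) mul0e.
have h' : \int[sg]_z ((z <= 0)%R%:R)%:E = 0.
  apply: sg_ind => //; side_tac.
  by move=> z x0z; rewrite leNgt (lt_trans x0_gt0 x0z).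
rewrite -[RHS]adde0 -h -[LHS]adde0 -{1}h' -!ge0_integralD//; side_tac; last first.
  by move=> z _; rewrite adde_ge0// lee_fin// expR_ge0.
apply: eq_integral => z _; rewrite -EFinM -!EFinD; congr (_%:E).
by case: (ltP 0%R z) => z0 /=; rewrite ?mul1r ?mul0r ?addr0 ?add0r ?subrK// addrC.
Qed.

(** The strong Markov decomposition at the passage over x0: U is its restriction to a < x0 plus the
    convolution of [sg] with U. It is proved without paths: dividing [overshoot_laplace] by f(r)
    equates the Laplace transforms of the two measures. *)
Lemma potential_decomposition (g : R -> \bar R) :
  measurable_fun setT g -> (forall a, 0 <= g a) ->
  \int[U]_a g a = \int[U]_a (((a < x0)%R%:R)%:E * g a) +
    \int[sg]_z \int[U]_a g (z + a)%R.
Proof.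
have mA : measurable_fun setT (fun a : R => (a < x0)%R%:R : R) by meas_tac.
have [W1 W1E] := image_measure_exists U mid mA (fun a => ler0n _ _).
have mZ : measurable_fun [set: R * R] (fun p : R * R => (p.1 + p.2)%R : measurableTypeR R).
  exact: measurable_funD.
have m1 : measurable_fun [set: R * R] (fun=> 1%R : R) by exact: measurable_cst.
have [W2 W2E] := image_measure_exists (sg \x U)%E mZ m1 (fun=> ler01).
have {}W2E (g' : R -> \bar R) : measurable_fun setT g' -> (forall z, 0 <= g' z) ->
  \int[W2]_z g' z = \int[sg]_z \int[U]_a g' (z + a)%R.
  move=> mg g0; rewrite W2E//.
  under eq_integral do rewrite mul1e.
  rewrite (fubini_tonelli1 (m1 := sg) (m2 := U))//.
  exact: (measurableT_comp mg mZ).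
have WE (g' : R -> \bar R) : measurable_fun setT g' -> (forall z, 0 <= g' z) ->
    \int[measure_add W1 W2]_z g' z = \int[U]_a (((a < x0)%R%:R)%:E * g' a) +
    \int[sg]_z \int[U]_a g' (z + a)%R.
  by move=> mg g0; rewrite ge0_integral_measure_add// W1E// W2E.
have mn : measurable_fun setT (fun z : R => (z < 0)%R%:R%:E : \bar R) by meas_tac.
have minner (g' : R -> \bar R) : measurable_fun setT g' -> (forall z, 0 <= g' z) ->
    measurable_fun setT (fun z : R => \int[U]_a g' (z + a)%R).
  move=> mg g0; apply: (measurable_fun_fubini_tonelli_F (m2 := U) (fun p : R * R => g' (p.1 + p.2)%R)) => //.
  exact: (measurableT_comp mg mZ).
have indE (B : set R) : measurable B -> forall m : {measure set (measurableTypeR R) -> \bar R},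
    m B = \int[m]_z (\1_B z)%:E.
  by move=> mB m; exact: measure_integral_indic.
have Wneg : (measure_add W1 W2 : {measure set (measurableTypeR R) -> \bar R}) `]-oo, 0%R[%classic = 0.
  rewrite indE; last exact: measurable_itv.
  under eq_integral do rewrite indicE mem_setE in_itv/=.
  rewrite WE//.
  have U0 (h : R -> \bar R) : measurable_fun setT h -> (forall a, 0 <= h a) ->
      (forall a, (0 <= a)%R -> h a = 0) -> \int[U]_a h a = 0.
    move=> mh h0 hn; apply: (ge0_integral_null _ U_neg) => //.
    by move=> a /=; rewrite in_itv/= => /negP; rewrite -leNgt => /hn.
  rewrite U0//; side_tac; last first.
    by move=> a a0; rewrite (ltNge a 0%R) a0 mule0.
  rewrite add0e; apply: sg_ind => //.
  - exact: (minner (fun z => (z < 0)%R%:R%:E)).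
  - by nonneg_tac.
  - move=> z x0z; apply: U0 => //; side_tac.
    by move=> a a0; rewrite ltNge addr_ge0// ltW// (lt_trans x0_gt0 x0z).
have UW : forall B, measurable B -> U B = measure_add W1 W2 B.
  apply: laplace_unique => // r r0; first by rewrite UE// ltry.
  rewrite WE; last 2 first.
  - by meas_tac.
  - by nonneg_tac.
  have sgr : \int[sg]_z \int[U]_a (expR (- (r * (z + a))))%:E =
      ((f r)^-1)%:E * \int[sg]_z (expR (- (r * z)))%:E.
    rewrite -ge0_integralZl//; side_tac; last first.
      by rewrite lee_fin invr_ge0 ltW// f_gt0.
    apply: eq_integral => z _; rewrite muleC -UE// -ge0_integralZl//; side_tac.
    by apply: eq_integral => a _; rewrite -EFinM -expRD -opprD -mulrDr.
  rewrite sgr UE// -[in LHS](mule1 (_^-1)%:E) -(overshoot_laplace r0).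
  rewrite ge0_muleDr//; side_tac; last first.
    by apply: mule_ge0; [rewrite lee_fin ltW// f_gt0|nonneg_tac].
  rewrite muleA -EFinM mulVf ?gt_eqF ?f_gt0// mul1e.
  by congr (_ + _); apply: eq_integral => a _; rewrite -EFinM.
move=> mg g0; rewrite -WE//; apply: eq_measure_integral => B mB _; exact: UW.
Qed.

(** The convolution part does not charge [B], since [sg] charges no translate of it. The rest is at
    most the mass of U on a < x0, which the exponential bound 1 <= e exp(-a/x0) controls by e times
    the transform at r = 1/x0. *)
Lemma potential_null_bound (B : set R) : measurable B -> leb B = 0 ->
  U B <= (expR 1 / f (x0^-1))%:E.
Proof.
move=> mB B0; have mBi : measurable_fun setT (fun x : R => (\1_B x)%:E : \bar R).
  exact: measurable_EFin_indic.
rewrite measure_integral_indic// potential_decomposition//.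
rewrite (fubini_tonelli (m1 := sg) (m2 := U) (fun p : R * R => (\1_B (p.1 + p.2))%:E))//=; last first.
  by apply: (measurableT_comp mBi); exact: measurable_funD.
rewrite [X in _ + X](_ : _ = 0) ?adde0; last first.
  apply: integral0_eq => a _.
  have mBa : measurable ((fun s : R => a + s)%R @^-1` B).
    by rewrite -[X in measurable X]setTI; apply: measurable_funD.
  apply: (ge0_integral_null _ (overshoot_AC mBa (lebesgue_null_translation a mB B0))) => //.
  - by apply: (measurableT_comp mBi); exact: measurable_funD.
  - by move=> z /= h; rewrite indicE memNset// addrC.
have ix0 : (0 < x0^-1)%R by rewrite invr_gt0.
rewrite EFinM -UE// -ge0_integralZl//; side_tac.
apply: ge0_le_integral => //; side_tac.
move=> a _; rewrite -!EFinM lee_fin; case: (ltP a x0) => ax0; rewrite ?mul0r ?mulr_ge0 ?expR_ge0// mul1r.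
apply: (@le_trans _ _ 1%R); first by rewrite indicE lern1 leq_b1.
rewrite -expRD -[leLHS]expR0 ler_expR subr_ge0 mulrC ler_pdivrMr// mul1r ltW//.
Qed.

(** By the decomposition, [phi t] is sg(t, oo) plus the [sg]-integral of phi(t - z). The exceptional
    levels of [phi], reflected at t, form a Lebesgue-null set, hence a null set of [sg], so that
    integral is the mass of z < t. The point t has no mass, and the two pieces add up to 1. *)
Lemma potential_tail_gt (t : R) : (x0 < t)%R -> phi t = 1.
Proof.
move=> x0t; rewrite /phi potential_decomposition//; last by move=> a; exact: tail_fun_ge0.
rewrite -/(S t) overshoot_tail ?ltW//.
have sgphi : \int[sg]_z \int[U]_a tail_fun nu (t - (z + a)) = \int[sg]_z ((z < t)%R%:R)%:E.
  apply: ge0_ae_eq_integral => //.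
  - apply: (measurable_fun_fubini_tonelli_F (m2 := U) (fun p : R * R => tail_fun nu (t - (p.1 + p.2)))) => //.
      by apply: (measurableT_comp (measurable_tail_fun nu)); meas_tac.
    by move=> p; exact: tail_fun_ge0.
  - by meas_tac.
  - by move=> z _; apply: integral_ge0 => a _; exact: tail_fun_ge0.
  have [E [mE E0 subE]] := potential_tail_ae.
  have mtE : measurable ((fun s : R => t - s)%R @^-1` E).
    by rewrite -[X in measurable X]setTI; exact: measurable_reflection.
  exists ((fun s : R => t - s)%R @^-1` E); split => //.
    by apply: overshoot_AC => //; exact: lebesgue_null_reflection.
  move=> z /= h; apply: subE => /= H; apply: h => _.
  have -> : ((z < t)%R%:R)%:E = phi (t - z) by rewrite H// subr_gt0.
  by apply: eq_integral => a _; rewrite opprD addrA.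
rewrite sgphi -ge0_integralD//; side_tac.
rewrite -[RHS]overshoot_total; apply: ge0_ae_eq_integral => //; side_tac.
  by move=> z _; rewrite adde_ge0// lee_fin.
exists [set t]; split => //; first by apply: overshoot_AC => //; exact: lebesgue_measure_set1.
move=> z /= h; apply: contrapT => /eqP zt; apply: h => _.
by rewrite -EFinD; case: ltgtP zt => //=; rewrite ?addr0 ?add0r.
Qed.

End overshoot.

Hypothesis nuAC : forall B : set R, measurable B -> leb B = 0 ->
  nu (B `&` `]0%R, +oo[) = 0.

Let good (e : R) : (0 < e)%R -> exists2 x0, (0 < x0 < e)%R & phi x0 = 1.
Proof.
move=> e0; have [y ye phiy] := ae_exists e0 potential_tail_ae.
by exists y => //; rewrite phiy//; case/andP: ye => ->.
Qed.

Lemma potential_tail (t : R) : (0 < t)%R -> \int[U]_a tail_fun nu (t - a) = 1.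
Proof.
move=> t0; have [x0 /andP[x00 x0t] phix0] := good t0.
have [sg sgE] := overshoot_exists phix0.
exact: (potential_tail_gt x00 phix0 sgE nuAC x0t).
Qed.

(** For s > x the integrand 1 - exp(-s/x) exceeds 1 - exp(-1). This makes f(1/x) unbounded as x
    tends to 0. *)
Let f_ge (x : R) : (0 < x)%R ->
  (1 - expR (- 1))%:E * nu `]x, +oo[%classic <= (f x^-1)%:E.
Proof.
move=> x0; rewrite -fE ?invr_gt0// measure_integral_indic; last exact: measurable_itv.
have e1 : (0 <= 1 - expR (- 1) :> R)%R by rewrite subr_ge0 expR_le1 lerN10.
rewrite -ge0_integralZl//; last exact: measurable_EFin_indic.
apply: ge0_le_integral => //.
- by apply: emeasurable_funM => //; exact: measurable_EFin_indic.
- by meas_tac.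
move=> s _; rewrite -EFinM lee_fin indicE mem_setE in_itv/= andbT.
case: ltP => xs; rewrite ?mulr1 ?mulr0.
  rewrite (lt_trans x0 xs) mul1r lerB// ler_expR lerN2.
  by rewrite mulrC ler_pdivlMr// mul1r ltW.
case: ltP => s0; rewrite ?mul0r// mul1r subr_ge0 expR_le1 oppr_le0 mulr_ge0//.
  by rewrite invr_ge0 ltW.
by rewrite ltW.
Qed.

Hypothesis nu_infinite : nu `]0%R, +oo[%classic = +oo.

(** If U B were positive, [potential_null_bound] would bound f(1/x0) by e / U B for arbitrarily
    small x0; then [f_ge] would bound all tails of [nu] by the constant [K], against the infinite
    mass of [nu] near 0. *)
Lemma potential_AC (B : set R) : measurable B -> leb B = 0 -> U B = 0.
Proof.
move=> mB B0; apply/eqP; rewrite eq_le measure_ge0 andbT leNgt; apply/negP => UB.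
have bound e : (0 < e)%R -> exists2 x0, (0 < x0 < e)%R &
    U B <= (expR 1 / f (x0^-1))%:E.
  move=> e0; have [x0 x0e phix0] := good e0; have /andP[x00 _] := x0e.
  have [sg sgE] := overshoot_exists phix0; exists x0 => //.
  exact: (potential_null_bound x00 phix0 sgE nuAC mB B0).
have UBfin : U B \is a fin_num.
  have [x0 _ h] := bound 1%R ltr01.
  by rewrite ge0_fin_numE// (le_lt_trans h)// ltry.
have e1 : (0 < 1 - expR (- 1) :> R)%R by rewrite subr_gt0 expR_lt1 ltrN10.
pose K := (expR 1 / (fine (U B) * (1 - expR (- 1))))%R.
have u0 : (0 < fine (U B))%R by rewrite fine_gt0// UB ltey_eq UBfin.
have nuK (n : nat) : nu `](n.+1%:R^-1)%R, +oo[%classic <= K%:E.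
  have n0 : (0 < n.+1%:R^-1 :> R)%R by rewrite invr_gt0.
  have [x0 /andP[x00 x0n] h] := bound _ n0.
  apply: (@le_trans _ _ (nu `]x0, +oo[%classic)).
    apply: le_measure; rewrite ?inE//; try exact: measurable_itv.
    by move=> y /=; rewrite !in_itv/= !andbT; exact: lt_trans.
  have := f_ge x00; have fx0 : (0 < f x0^-1)%R by rewrite f_gt0// invr_gt0.
  move: h; rewrite -(fineK UBfin) lee_fin ler_pdivlMr// => h1 h2.
  have := measure_ge0 nu `]x0, +oo[%classic; move: h2.
  case: (nu _) => [z| |]; [|by rewrite gt0_muley ?lte_fin// leye_eq|by move=> _ _; rewrite leNye].
  rewrite -EFinM !lee_fin => h2 z0; rewrite /K ler_pdivlMr ?mulr_gt0//.
  have h3 := ler_wpM2l (ltW u0) h2.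
  by apply: le_trans h1; rewrite mulrC -mulrA.
have : nu `]0%R, +oo[%classic <= K%:E.
  have h := @cvg_measure_itv0y R nu.
  rewrite -(cvg_lim (@ereal_hausdorff R) h); apply: lime_le; last exact: nearW.
  by apply/cvg_ex; eexists; exact: h.
by rewrite nu_infinite leye_eq.
Qed.

End potential.

(** * Recovering a function from its primitives, and bounds at a fixed time *)

Section densities.
Local Open Scope ereal_scope.
Context (R : realType).
Notation leb := (@lebesgue_measure R).

Lemma integral_expR_oy (r u : R) : (0 < r)%R -> (0 < u)%R ->
  \int[leb]_a (r * expR (- (r * a)) * (u < a)%R%:R)%:E = (expR (- (r * u)))%:E.
Proof.
move=> r0 u0.
have E : \int[leb]_a (r * expR (- (r * a)) * ((0 < a) && (a < u))%R%:R)%:E +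
    \int[leb]_a (r * expR (- (r * a)) * (u < a)%R%:R)%:E = 1.
  rewrite -(integral_expR_pos r0) -ge0_integralD//; side_tac.
  apply: ge0_ae_eq_integral => //; side_tac.
    by move=> a _; rewrite adde_ge0//; nonneg_tac.
  exists [set u]; split => //; first exact: lebesgue_measure_set1.
  move=> a /= h; apply: contrapT => /eqP au; apply: h => _.
  rewrite -EFinD -EFinM; congr (_%:E); case: (ltgtP a u) au => //= au _.
    by rewrite andbT mulr0 addr0.
  by rewrite andbF (lt_trans u0 au) mulr0 add0r.
move: E; rewrite integral_expR_itv// ?ltW// mulr0 oppr0 expR0.
by case: (integral _ _ _) => [z| |]//; rewrite -EFinD => -[zE]; congr (_%:E); lra.
Qed.

(** Since exp(-ru) is the integral of r exp(-ra) over a > u, the Laplace transform of a function is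
    an integral of its primitives; uniqueness of transforms then applies. *)
Lemma eq_primitive_ae (k l : R -> \bar R) :
  measurable_fun setT k -> measurable_fun setT l ->
  (forall u, 0 <= k u) -> (forall u, 0 <= l u) ->
  (forall u, (u <= 0)%R -> k u = 0) -> (forall u, (u <= 0)%R -> l u = 0) ->
  \int[leb]_u k u < +oo ->
  (forall a, (0 < a)%R -> \int[leb]_u ((u < a)%R%:R%:E * k u) =
    \int[leb]_u ((u < a)%R%:R%:E * l u)) ->
  ae_eq leb setT k l.
Proof.
move=> mk ml k0 l0 kn ln koo kl.
have E (h : R -> \bar R) r : (0 < r)%R -> measurable_fun setT h ->
    (forall u, 0 <= h u) -> (forall u, (u <= 0)%R -> h u = 0) ->
    \int[leb]_u ((expR (- (r * u)))%:E * h u) =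
    \int[leb]_a ((r * expR (- (r * a)))%:E * \int[leb]_u ((u < a)%R%:R%:E * h u)).
  move=> r0 mh h0 hn.
  transitivity (\int[leb]_u \int[leb]_a
      ((r * expR (- (r * a)) * (u < a)%R%:R)%:E * h u)).
    apply: eq_integral => u _; have [u0|u0] := leP u 0%R.
      by rewrite hn// mule0 integral0_eq// => a _; rewrite mule0.
    rewrite -integral_expR_oy// -ge0_integralZr//; side_tac.
  rewrite (fubini_tonelli (m1 := leb) (m2 := leb)
    (fun p : R * R => (r * expR (- (r * p.2)) * (p.1 < p.2)%R%:R)%:E * h p.1))/=; side_tac.
  apply: eq_integral => a _; rewrite -ge0_integralZl//; side_tac.
  by apply: eq_integral => u _; rewrite EFinM muleA.
apply: laplace_unique_fun => //.
- by move=> u u0; rewrite kn// ltW.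
- by move=> u u0; rewrite ln// ltW.
- move=> r r0; apply: le_lt_trans koo; apply: ge0_le_integral => //; side_tac.
  move=> u _; have [u0|u0] := leP u 0%R; first by rewrite kn// mule0.
  by rewrite -[leRHS]mul1e lee_wpmul2r// lee_fin expR_le1 oppr_le0 mulr_ge0// ltW.
- move=> r r0; rewrite !E//; apply: eq_integral => a _; congr (_ * _).
  have [a0|a0] := leP a 0%R; last exact: kl.
  rewrite !integral0_eq// => u _; case: ltP => ua; rewrite ?mul0e//.
    by rewrite ln ?mule0// (le_trans (ltW ua) a0).
  by rewrite kn ?mule0// (le_trans (ltW ua) a0).
Qed.

Variable nu : {sigma_finite_measure set (measurableTypeR R) -> \bar R}.

Lemma cvg_tail_fun (b : R) : (0 < b)%R ->
  tail_fun nu (b + n.+1%:R^-1) @[n --> \oo] --> tail_fun nu b.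
Proof.
move=> b0; rewrite /tail_fun b0.
under eq_fun => n do rewrite addr_gt0 ?invr_gt0//.
exact: cvg_measure_itvoy.
Qed.

Lemma tail_fun_le (b c : R) : (0 < b)%R -> (b <= c)%R ->
  tail_fun nu c <= tail_fun nu b.
Proof.
move=> b0 bc; rewrite /tail_fun b0 (lt_le_trans b0 bc).
apply: le_measure; rewrite ?inE; try exact: measurable_itv.
by move=> y /=; rewrite !in_itv/= !andbT; exact: le_lt_trans.
Qed.

(* A version of Fatou's lemma along times decreasing to t: it transfers an
   upper bound from almost every time to the given time t. *)
Lemma tail_conv_le d (X : measurableType d)
    (m : {sigma_finite_measure set X -> \bar R}) (c Z : X -> R) (G : R -> R) (t : R) :
  measurable_fun setT c -> (forall x, (0 <= c x)%R) -> measurable_fun setT Z ->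
  {ae leb, forall y : R, (0 < y)%R ->
    \int[m]_x ((c x)%:E * tail_fun nu (y - Z x)) = (G y)%:E} ->
  (0 < t)%R ->
  (forall e, (0 < e)%R -> exists n : nat,
     forall s, (t < s < t + n.+1%:R^-1)%R -> (G s <= G t + e)%R) ->
  \int[m]_x ((c x)%:E * tail_fun nu (t - Z x)) <= (G t)%:E.
Proof.
move=> mc c0 mZ phiG t0 Gt.
(* Where Z x < t, the tails at t + 1/(n+1) increase to the tail at t. Where Z x >= t, the tail at t
   is 0 while the later ones need not vanish; the cut makes the sequence monotone everywhere with
   the right limit. *)
pose g (n : nat) x := (c x * (Z x < t)%R%:R)%:E * tail_fun nu (t + n.+1%:R^-1 - Z x).
have mtl (y : R) : measurable_fun setT (fun x => tail_fun nu (y - Z x)).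
  by apply: (measurableT_comp (measurable_tail_fun nu)); meas_tac.
have mg n : measurable_fun setT (g n) by apply: emeasurable_funM => //; meas_tac.
have g0 n x : 0 <= g n x by rewrite mule_ge0// ?tail_fun_ge0// lee_fin mulr_ge0.
have ndg x : {homo g^~ x : n k / (n <= k)%N >-> n <= k}.
  move=> n k nk; rewrite /g; case: (ltP (Z x) t) => Zt; last by rewrite mulr0 !mul0e.
  rewrite mulr1; apply: lee_wpmul2l; first by rewrite lee_fin.
  apply: tail_fun_le; last first.
    by rewrite lerB// lerD2l lef_pV2 ?posrE// ler_nat.
  by rewrite subr_gt0 (lt_trans Zt)// ltrDl invr_gt0.
have lim x : limn (g^~ x) = (c x)%:E * tail_fun nu (t - Z x).
  apply/cvg_lim => //; rewrite /g; case: (ltP (Z x) t) => Zt.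
    under eq_fun do rewrite mulr1; apply: cvgeZl => //.
    have := @cvg_tail_fun (t - Z x); rewrite subr_gt0 => /(_ Zt).
    by under eq_fun do rewrite addrAC.
  under eq_fun do rewrite mulr0 mul0e.
  by rewrite /tail_fun subr_gt0 ltNge Zt/= mule0; exact: cvg_cst.
under eq_integral do rewrite -lim.
rewrite monotone_convergence//.
have nd : {homo (fun n => \int[m]_x g n x) : n k / (n <= k)%N >-> n <= k}.
  move=> n k nk; apply: ge0_le_integral => // x _; exact: ndg.
apply/lee_addgt0Pr => e e0; have [n0 hn0] := Gt e e0.
apply: lime_le; first exact: ereal_nondecreasing_is_cvgn.
near=> n.
have tn : (t < t + n.+1%:R^-1)%R by rewrite ltrDl invr_gt0.
(* A generic time before t + 1/(n+1): the tail decreases, so [g n] is dominated by the convolution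
   at s, whose value is known. *)
have [s /andP[ts sn] phis] := ae_exists tn phiG.
apply: (@le_trans _ _ (\int[m]_x ((c x)%:E * tail_fun nu (s - Z x)))).
  apply: ge0_le_integral => //.
  - by apply: emeasurable_funM => //; meas_tac.
  move=> x _; rewrite /g; case: (ltP (Z x) t) => Zt.
    rewrite mulr1; apply: lee_wpmul2l; first by rewrite lee_fin.
    by apply: tail_fun_le; [rewrite subr_gt0 (lt_trans Zt)|rewrite lerB// ltW].
  by rewrite mulr0 mul0e mule_ge0// ?lee_fin// tail_fun_ge0.
rewrite phis ?(lt_trans t0)// -EFinD lee_fin hn0// ts/=.
apply: (lt_le_trans sn); rewrite lerD2l lef_pV2 ?posrE// ler_nat ltnS.
by near: n; exact: nbhs_infty_ge.
Unshelve. all: by end_near. Qed.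

End densities.

Section right_continuous_process.
Context (R : realType) d (T : measurableType d) (X : R -> T -> R).
Hypotheses (mX : forall t : R, 0 <= t -> measurable_fun setT (X t))
  (ndX : forall w (s t : R), 0 <= s -> s <= t -> X s w <= X t w)
  (rcX : forall w (t : R), 0 <= t -> X u w @[u --> t^'+] --> X t w).

(** By right continuity and monotonicity, X u < a holds iff X q < a for some rational q > u, so a
    sublevel set is a countable union of rectangles. Clipping at 0 gives a function on the whole
    line. *)
Lemma measurable_right_continuous :
  measurable_fun setT (fun p : R * T => X (Num.max p.1 0) p.2).
Proof.
apply: (measurability (@measurable_realfun.RGenInftyO.G R)).
  exact: measurable_realfun.RGenInftyO.measurableE.
move=> _ [_ [a ->] <-]; rewrite setTI.
pose F (q : rat) : set (R * T) := if (0 < ratr q :> R) then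
  `]-oo, (ratr q : R)[%classic `*` (X (ratr q) @^-1` `]-oo, a[%classic) else set0.
have -> : (fun p : R * T => X (Num.max p.1 0) p.2) @^-1` `]-oo, a[%classic =
    \bigcup_q F q.
  apply/seteqP; split => [[u w]|[u w] [q _]]; rewrite /F /= ?in_itv/=.
    set v := Num.max u 0 => Xv.
    have v0 : 0 <= v by rewrite le_max lexx orbT.
    have [y vy Xy] : exists2 y, v < y & X y w < a.
      near (v^'+) => y; exists y => //.
      by near: y; have := cvgr_lt _ (@rcX w v v0); exact.
    have [q] := rat_in_itvoo vy; rewrite in_itv/= => /andP[vq qy].
    exists q => //; rewrite (le_lt_trans v0 vq); split => /=; rewrite in_itv/=.
      by rewrite (le_lt_trans _ vq)// le_max lexx.
    by apply: le_lt_trans Xy; apply: ndX; [exact: ltW (le_lt_trans v0 vq)|exact: ltW].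
  case: ifPn => // q0 [/=]; rewrite !in_itv/= => uq; apply: le_lt_trans.
  by apply: ndX; [rewrite le_max lexx orbT|rewrite ge_max (ltW uq) ltW].
apply: bigcupT_measurable_rat => q; rewrite /F; case: ifPn => // q0.
apply: measurableX; first exact: measurable_itv.
by have := mX (ltW q0) measurableT (measurable_itv `]-oo, a[); rewrite setTI.
Unshelve. all: by end_near. Qed.

End right_continuous_process.

(** * Operational time *)

Section clock.
Local Open Scope ereal_scope.
Context (R : realType) d (T : measurableType d) (P : probability T R).
Notation leb := (@lebesgue_measure R).
Variables (H : R -> T -> R) (f : R -> R).
Hypotheses (mH : forall t : R, (0 <= t)%R -> measurable_fun setT (H t))
  (H0 : forall w, H 0%R w = 0%R)
  (ndH : forall w (s t : R), (0 <= s)%R -> (s <= t)%R -> (H s w <= H t w)%R)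
  (rcH : forall w (t : R), (0 <= t)%R -> H u w @[u --> t^'+] --> H t w)
  (HL : forall t x : R, (0 <= t)%R -> (0 < x)%R ->
    \int[P]_w (expR (- (x * H t w)))%:E = (expR (- (t * f x)))%:E)
  (f_gt0 : forall r, (0 < r)%R -> (0 < f r)%R).
Variable m : {sigma_finite_measure set (measurableTypeR R * T)%type -> \bar R}.
Hypothesis mE : m = (leb \x P)%E :> (set (measurableTypeR R * T) -> \bar R).

Definition clock (p : R * T) : R := H (Num.max p.1 0%R) p.2.

Lemma measurable_clock : measurable_fun setT clock.
Proof. exact: measurable_right_continuous. Qed.

Lemma clock_ge0 p : (0 <= clock p)%R.
Proof. by rewrite -(H0 p.2); apply: ndH => //; rewrite le_max lexx orbT. Qed.

Lemma clock_integral (h : R * T -> \bar R) : measurable_fun setT h ->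
  (forall p, 0 <= h p) -> \int[m]_p h p = \int[leb]_u \int[P]_w h (u, w).
Proof. by move=> mh h0; rewrite mE (fubini_tonelli1 (m1 := leb) (m2 := P)). Qed.

Lemma clock_laplace (c : R -> R) (r : R) : measurable_fun setT c ->
  (forall u, (0 <= c u)%R) -> (forall u, (u <= 0)%R -> c u = 0%R) -> (0 < r)%R ->
  \int[m]_p (c p.1 * expR (- (r * clock p)))%:E =
  \int[leb]_u (c u * expR (- (u * f r)))%:E.
Proof.
move=> mc c0 cn r0; have mZ := measurable_clock.
rewrite clock_integral; side_tac.
apply: eq_integral => u _; have [u0|u0] := leP u 0%R.
  rewrite (cn u u0) mul0r integral0_eq// => w _ /=.
  by rewrite mul0r.
rewrite EFinM -HL// ?(ltW u0)// -ge0_integralZl//; side_tac.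
- by apply: eq_integral => w _; rewrite /clock /= max_l ?(ltW u0)// EFinM.
- have mHu := mH (ltW u0); by meas_tac.
Qed.

(** U is the image of Lebesgue measure on u > 0 times [P] under (u, w) -> H u w; its transform is
    the integral of exp(-u f(r)), that is 1/f(r). Sigma-finiteness follows from U(-oo, n] <= e^n /
    f(1). *)
Lemma clock_potential_exists :
  exists U : {sigma_finite_measure set (measurableTypeR R) -> \bar R},
  [/\ U `]-oo, 0%R[%classic = 0,
    (forall r, (0 < r)%R ->
      \int[U]_a (expR (- (r * a)))%:E = ((f r)^-1)%:E) &
    (forall g : R -> \bar R, measurable_fun setT g -> (forall y, 0 <= g y) ->
      \int[U]_a g a = \int[m]_p ((0 < p.1)%R%:R%:E * g (clock p)))].
Proof.
have mZ : measurable_fun setT (clock : R * T -> measurableTypeR R).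
  exact: measurable_clock.
have m0 : measurable_fun setT (fun p : R * T => (0 < p.1)%R%:R : R) by meas_tac.
have [U UE] := image_measure_exists m mZ m0 (fun=> ler0n _ _).
have Uneg : U `]-oo, 0%R[%classic = 0.
  rewrite measure_integral_indic// UE//; last exact: measurable_EFin_indic.
  apply: integral0_eq => p _; rewrite indicE memNset ?mule0//= in_itv/=.
  by apply/negP; rewrite -leNgt clock_ge0.
have UL r : (0 < r)%R -> \int[U]_a (expR (- (r * a)))%:E = ((f r)^-1)%:E.
  move=> r0; rewrite UE; side_tac.
  under eq_integral do rewrite -EFinM.
  rewrite (clock_laplace (c := fun u => (0 < u)%R%:R)) //; last 2 first.
  - by meas_tac.
  - by move=> u; rewrite leNgt => /negbTE ->.
  have := integral_expR_pos (f_gt0 r0).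
  have -> : \int[leb]_u ((f r * expR (- (f r * u)))%:E * (((0 < u)%R)%:R)%:E) =
     (f r)%:E * \int[leb]_u ((0 < u)%R%:R * expR (- (u * f r)))%:E.
    rewrite -ge0_integralZl//; side_tac; last by rewrite lee_fin ltW// f_gt0.
    apply: eq_integral => u _; rewrite -!EFinM; congr (_%:E).
    by rewrite (mulrC u); ring.
  case: (integral _ _ _) => [z| |].
  - by rewrite -EFinM => -[h]; congr (_%:E); rewrite -[LHS](mulKf (lt0r_neq0 (f_gt0 r0))) h mulr1.
  - by rewrite gt0_muley// lte_fin f_gt0.
  - by rewrite gt0_muleNy// lte_fin f_gt0.
have [|U' U'E] := sigma_finite_pack (mu := U).
  exists (fun n => `]-oo, (n%:R : R)]%classic) => [|n].
    apply/esym/seteqP; split => // y _; exists (Num.bound `|y|%R) => //=.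
    rewrite in_itv/= (le_trans (ler_norm y))// ltW//.
    exact: archi_boundP.
  split; first exact: measurable_itv.
  rewrite measure_integral_indic; last exact: measurable_itv.
  apply: (@le_lt_trans _ _ (\int[U]_a ((expR n%:R)%:E * (expR (- (1 * a)))%:E))).
    apply: ge0_le_integral => //; side_tac.
      exact: measurable_EFin_indic.
    move=> a _; rewrite indicE mem_setE in_itv/= -EFinM lee_fin.
    case: (leP a n%:R) => an; last by rewrite mulr_ge0 ?expR_ge0.
    by rewrite -expRD -[leLHS]expR0 ler_expR mul1r subr_ge0.
  rewrite ge0_integralZl//; side_tac.
  by rewrite UL// -EFinM ltry.
exists U'; rewrite U'E; split => //.
Qed.

Variable nu : {sigma_finite_measure set (measurableTypeR R) -> \bar R}.
Hypotheses
  (fE : forall r, (0 < r)%R ->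
    \int[nu]_s ((0 < s)%R%:R * (1 - expR (- (r * s))))%:E = (f r)%:E)
  (nuAC : forall B : set R, measurable B -> leb B = 0 ->
    nu (B `&` `]0%R, +oo[) = 0)
  (nu_infinite : nu `]0%R, +oo[%classic = +oo).

Lemma clock_AC (B : set R) : measurable B -> leb B = 0 ->
  \int[m]_p ((0 < p.1)%R%:R%:E * (\1_B (clock p))%:E) = 0.
Proof.
move=> mB B0; have [U [Un UL UE]] := clock_potential_exists.
rewrite -(UE (fun y => (\1_B y)%:E))//; last exact: measurable_EFin_indic.
rewrite -measure_integral_indic//.
exact: (potential_AC f_gt0 fE Un UL nuAC nu_infinite).
Qed.

Lemma clock_tail (t : R) : (0 < t)%R ->
  \int[m]_p ((0 < p.1)%R%:R%:E * tail_fun nu (t - clock p)) = 1.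
Proof.
move=> t0; have [U [Un UL UE]] := clock_potential_exists.
rewrite -[RHS](potential_tail f_gt0 fE Un UL nuAC t0) UE//.
- by apply: (measurableT_comp (measurable_tail_fun nu)); meas_tac.
- by move=> y; exact: tail_fun_ge0.
Qed.

Let mtail (t : R) : measurable_fun setT (fun p : R * T => tail_fun nu (t - clock p)).
Proof.
by have mZ := measurable_clock; apply: (measurableT_comp (measurable_tail_fun nu)); meas_tac.
Qed.

Let mHlt (a t : R) : (0 <= a)%R -> measurable [set w | (t < H a w)%R].
Proof.
move=> a0; have := mH a0 measurableT (measurable_itv `]t, +oo[).
rewrite setTI; congr measurable.
by apply/seteqP; split => w /=; rewrite in_itv/= andbT.
Qed.

Let PHlt (a t : R) : (0 <= a)%R ->
  P [set w | (t < H a w)%R] = (fine (P [set w | (t < H a w)%R]))%:E.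
Proof. by move=> a0; rewrite fineK// fin_num_measure//; exact: mHlt. Qed.

(** Both sides, as functions of y, have transform 1 - exp(-a f(r)) for the kernel r exp(-ry): the
    left one by integrating f(r) exp(-u f(r)) over 0 < u < a, the right one from the law of H a. *)
Let clock_lt_ae (a : R) : (0 < a)%R -> {ae leb, forall y : R, (0 < y)%R ->
  \int[m]_p (((0 < p.1) && (p.1 < a))%R%:R%:E * tail_fun nu (y - clock p)) =
  (fine (P [set w | (y < H a w)%R]))%:E}.
Proof.
move=> a0; have mZ := measurable_clock.
pose c (u : R) : R := (((0 < u) && (u < a))%R)%:R.
have mc : measurable_fun setT (fun p : R * T => c p.1) by rewrite /c; meas_tac.
have mcR : measurable_fun setT c by rewrite /c; meas_tac.
have cn u : (u <= 0)%R -> c u = 0%R by rewrite /c leNgt => /negbTE ->.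
pose F1 (y : R) := \int[m]_p ((c p.1)%:E * tail_fun nu (y - clock p)).
pose F2 (y : R) := \int[P]_w (((0 < y) && (y < H a w))%R%:R)%:E.
have mHa := mH (ltW a0).
have Ha0 w : (0 <= H a w)%R by rewrite -(H0 w); apply: ndH => //; exact: ltW.
have L1 r : (0 < r)%R -> \int[leb]_y ((r * expR (- (r * y)))%:E * F1 y) =
    (1 - expR (- (a * f r)))%:E.
  move=> r0; rewrite (laplace_tail_conv m mc (fun=> ler0n _ _) mZ r0 (fE r0)).
  rewrite clock_laplace// -ge0_integralZl//; side_tac; last by rewrite lee_fin ltW// f_gt0.
  transitivity (\int[leb]_u (f r * expR (- (f r * u)) * ((0 < u) && (u < a))%R%:R)%:E).
    apply: eq_integral => u _; rewrite -EFinM /c; congr (_%:E).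
    by rewrite (mulrC u); ring.
  by rewrite integral_expR_itv ?f_gt0 ?ltW// mulr0 oppr0 expR0 (mulrC a).
have L2 r : (0 < r)%R -> \int[leb]_y ((r * expR (- (r * y)))%:E * F2 y) =
    (1 - expR (- (a * f r)))%:E.
  move=> r0; rewrite (laplace_survival P mHa r0).
  have E w : ((0 < H a w)%R%:R * (1 - expR (- (r * H a w))) = 1 - expR (- (r * H a w)))%R.
    case: (ltgtP 0%R (H a w)) (Ha0 w) => // [_ _|<- _]; first by rewrite mul1r.
    by rewrite mulr0 oppr0 expR0 subrr mulr0.
  have : \int[P]_w ((0 < H a w)%R%:R * (1 - expR (- (r * H a w))))%:E +
      \int[P]_w (expR (- (r * H a w)))%:E = 1.
    rewrite -ge0_integralD//; side_tac; last first.
      by move=> w _; rewrite E lee_fin subr_ge0 expR_le1 oppr_le0 mulr_ge0// ltW.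
    under eq_integral do rewrite E -EFinD subrK.
    by rewrite integral_cst// mul1e; exact: probability_setT.
  rewrite (HL (ltW a0) r0); case: (integral _ _ _) => [z| |]//.
  by rewrite -EFinD => -[h]; congr (_%:E); rewrite -h addrK.
have F1n y : (y < 0)%R -> F1 y = 0.
  move=> y0; apply: integral0_eq => p _; rewrite /tail_fun subr_gt0.
  by rewrite ltNge (le_trans (ltW y0) (clock_ge0 p)) mule0.
have F2n y : (y < 0)%R -> F2 y = 0.
  by move=> y0; apply: integral0_eq => w _; rewrite ltNge (ltW y0).
have mF1 : measurable_fun setT F1.
  exact: (measurable_tail_conv nu m mc (fun=> ler0n _ _) mZ).
have mF2 : measurable_fun setT F2.
  apply: (measurable_fun_fubini_tonelli_F (m2 := P)
    (fun p : R * T => (((0 < p.1) && (p.1 < H a p.2))%R%:R)%:E)); side_tac.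
have F10 y : 0 <= F1 y.
  by apply: integral_ge0 => p _; rewrite mule_ge0 ?tail_fun_ge0// lee_fin.
have F20 y : 0 <= F2 y by apply: integral_ge0 => w _; rewrite lee_fin.
have := @laplace_unique_kernel R F1 F2 mF1 mF2 F10 F20 F1n F2n.
move=> /(_ _ _)[r r0|r r0|]; [by rewrite L1// ltry|by rewrite L1// L2|].
move=> Z [mZ' Z0 sub]; exists Z; split => // y /= ny; apply: sub => /= h; apply: ny => y0.
rewrite -/(F1 y) (h I) /F2 y0 -PHlt ?(ltW a0)//.
rewrite measure_integral_indic; last by apply: mHlt; exact: ltW.
apply: eq_integral => w _ /=; congr (_%:E); rewrite indicE; congr (_%:R).
case: (boolP (y < H a w)%R) => yH; first by rewrite mem_set.
by rewrite memNset//; exact/negP.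
Qed.

(* The parts p.1 < a and a <= p.1 have total mass 1 by clock_tail, and both are
   bounded above by limits along generic times; hence both bounds are sharp. *)
Lemma clock_lt (a t : R) : (0 < a)%R -> (0 < t)%R ->
  \int[m]_p (((0 < p.1) && (p.1 < a))%R%:R%:E * tail_fun nu (t - clock p)) =
  P [set w | (t < H a w)%R].
Proof.
move=> a0 t0; have mZ := measurable_clock.
pose c (p : R * T) : R := (((0 < p.1) && (p.1 < a))%R)%:R.
pose c' (p : R * T) : R := ((a <= p.1)%R)%:R.
have mc : measurable_fun setT c by rewrite /c; meas_tac.
have mc' : measurable_fun setT c' by rewrite /c'; meas_tac.
have c0 p : (0 <= c p)%R by [].
have c'0 p : (0 <= c' p)%R by [].
pose G y := fine (P [set w | (y < H a w)%R]).
have GE y : P [set w | (y < H a w)%R] = (G y)%:E by rewrite PHlt// ltW.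
have sum y : (0 < y)%R ->
    \int[m]_p ((c p)%:E * tail_fun nu (y - clock p)) +
    \int[m]_p ((c' p)%:E * tail_fun nu (y - clock p)) = 1.
  move=> y0; rewrite -(clock_tail y0) -ge0_integralD//.
  - apply: eq_integral => p _; rewrite -ge0_muleDl ?lee_fin//.
    congr (_ * _); rewrite -EFinD /c /c'; congr (_%:E).
    case: (ltP p.1 a) => pa; first by rewrite andbT addr0.
    by rewrite andbF add0r (lt_le_trans a0 pa).
  - by move=> p _; rewrite mule_ge0 ?tail_fun_ge0// lee_fin.
  - by apply: emeasurable_funM; [exact/measurable_EFinP|exact: mtail].
  - by move=> p _; rewrite mule_ge0 ?tail_fun_ge0// lee_fin.
  - by apply: emeasurable_funM; [exact/measurable_EFinP|exact: mtail].
have Gnd s : (t < s)%R -> (G s <= G t)%R.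
  move=> ts; rewrite -lee_fin -!GE; apply: le_measure; rewrite ?inE.
  - by apply: mHlt; exact: ltW.
  - by apply: mHlt; exact: ltW.
  - by move=> w /=; exact: lt_trans.
have le1 : \int[m]_p ((c p)%:E * tail_fun nu (t - clock p)) <= (G t)%:E.
  apply: tail_conv_le => //; first exact: clock_lt_ae.
  move=> e e0; exists 0%N => s /andP[ts _].
  by rewrite (le_trans (Gnd s ts))// lerDl ltW.
have le2 : \int[m]_p ((c' p)%:E * tail_fun nu (t - clock p)) <= (1 - G t)%:E.
  apply: (@tail_conv_le _ _ _ _ m c' clock (fun y => 1 - G y)%R) => //.
    have [Z [mZ' Z0 sub]] := clock_lt_ae a0; exists Z; split => // y /= ny.
    apply: sub => /= h; apply: ny => y0; have := sum y y0; rewrite /c h//; case: (integral _ _ _) => [z| |]//.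
    by rewrite -EFinD => -[<-]; rewrite addrAC subrr add0r.
  (* Monotonicity of [G] sufficed for the first bound. As 1 - G increases, the second one needs
     right continuity of [G] at t, obtained from continuity of [P] along the increasing events
     [FF n]. *)
  move=> e e0; pose FF (n : nat) := [set w | (t + n.+1%:R^-1 < H a w)%R].
  have FU : [set w | (t < H a w)%R] = \bigcup_n FF n.
    apply/seteqP; split => w; rewrite /FF /=.
      rewrite -subr_gt0 => y0.
      have /ltW/archi_boundP yb : (0 < (H a w - t)^-1)%R by rewrite invr_gt0.
      exists (Num.bound (H a w - t)^-1) => //=.
      rewrite -ltrBrDl invf_plt ?posrE//; apply: lt_trans yb _.
      by rewrite ltr_nat.
    by move=> [n _] /=; apply: lt_trans; rewrite ltrDl invr_gt0.
  have : P (FF n) @[n --> \oo] --> P [set w | (t < H a w)%R].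
    rewrite FU; apply: nondecreasing_cvg_mu.
    - by move=> n; apply: mHlt; exact: ltW.
    - by apply: bigcup_measurable => n _; apply: mHlt; exact: ltW.
    - move=> i j ij; apply/subsetPset => w; rewrite /FF /=.
      by apply: le_lt_trans; rewrite lerD2l lef_pV2 ?posrE// ler_nat.
  rewrite GE => /fine_cvgP[_] /cvgr_ge /(_ (G t - e)%R).
  rewrite ltrBlDr ltrDl => /(_ e0) [n _ hn]; exists n => s /andP[ts sn].
  have := hn n (leqnn n); rewrite /= => hGn.
  suff : (fine (P (FF n)) <= G s)%R by lra.
  rewrite -lee_fin -GE fineK ?fin_num_measure//; last by apply: mHlt; exact: ltW.
  apply: le_measure; rewrite ?inE.
  - by apply: mHlt; exact: ltW.
  - by apply: mHlt; exact: ltW.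
  - by move=> w; rewrite /FF /=; exact: lt_trans.
have := sum t t0; rewrite GE; move: le1 le2.
case: (integral _ _ _) => [x1| |]; case: (integral _ _ _) => [x2| |]//.
rewrite !lee_fin => h1 h2; rewrite -EFinD => -[h3]; congr (_%:E).
lra.
Qed.

End clock.

Section inverse_process.
Context (R : realType) d (T : measurableType d).
Variable H : R -> T -> R.
Hypotheses (mH : forall t : R, 0 <= t -> measurable_fun setT (H t))
  (ndH : forall w (s t : R), 0 <= s -> s <= t -> H s w <= H t w).

Let S (t : R) w := [set s : R | 0 <= s /\ t < H s w].

Let S_lb t w : has_lbound (S t w).
Proof. by exists 0 => s []. Qed.

Lemma inverse_process_ge0 t w : 0 <= inverse_process H t w.
Proof.
rewrite /inverse_process; have [S0|/set0P S0] := eqVneq (S t w) set0.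
  by rewrite -/(S t w) S0 inf0.
by apply: lb_le_inf => // s [].
Qed.

Lemma inverse_process_le t a w : 0 <= a -> t < H a w -> inverse_process H t w <= a.
Proof. by move=> a0 ta; apply: ge_inf => //; exact: S_lb. Qed.

(** Nonemptiness matters: the infimum of the empty set is 0, which would pass for an immediate
    crossing. *)
Lemma inverse_process_lt t a w : S t w !=set0 -> inverse_process H t w < a ->
  t < H a w.
Proof.
move=> S0 Ya.
have [s [s0 ts] sa] := inf_lt S0 Ya.
by apply: (lt_le_trans ts); apply: ndH => //; exact: ltW.
Qed.

Lemma inverse_process_neq0 t w : 0 < inverse_process H t w -> S t w !=set0.
Proof.
move=> Y0; apply/set0P/negP => /eqP S0; move: Y0.
by rewrite /inverse_process -/(S t w) S0 inf0 ltxx.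
Qed.

(** The event Y < x is a countable union over rational q < x of the events t < H q, together with
    the outcomes that never exceed t, where Y is 0 by convention; by monotonicity the latter are
    detected at integer times. *)
Lemma measurable_inverse_process t : measurable_fun setT (inverse_process H t).
Proof.
apply: (measurability (@measurable_realfun.RGenInftyO.G R)).
  exact: measurable_realfun.RGenInftyO.measurableE.
move=> _ [_ [x ->] <-]; rewrite setTI.
have mlt (a : R) : 0 <= a -> measurable [set w | t < H a w].
  move=> a0; have := mH a0 measurableT (measurable_itv `]t, +oo[).
  rewrite setTI; congr measurable.
  by apply/seteqP; split => w /=; rewrite in_itv/= andbT.
pose E := [set w | S t w = set0 /\ 0 < x].
pose F (q : rat) := if (0 <= (ratr q : R)) && (ratr q < x) then
  [set w | t < H (ratr q) w] else set0.
have -> : inverse_process H t @^-1` `]-oo, x[%classic = E `|` \bigcup_q F q.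
  apply/seteqP; split => w /=; rewrite in_itv/=.
    move=> Yx; have [S0|/set0P S0] := eqVneq (S t w) set0.
      by left; split => //; apply: le_lt_trans Yx; exact: inverse_process_ge0.
    right; have [q] := rat_in_itvoo Yx; rewrite in_itv/= => /andP[Yq qx].
    have q0 := le_trans (inverse_process_ge0 t w) (ltW Yq).
    by exists q => //; rewrite /F q0 qx/=; exact: inverse_process_lt.
  move=> [[S0 x0]|[q _]]; first by rewrite /inverse_process -/(S t w) S0 inf0.
  rewrite /F; case: ifPn => // /andP[q0 qx] tq.
  by apply: le_lt_trans qx; exact: inverse_process_le.
apply: measurableU; last first.
  apply: bigcupT_measurable_rat => q; rewrite /F; case: ifPn => // /andP[q0 _].
  exact: mlt.
have -> : E = (if 0 < x then ~` \bigcup_n [set w | t < H n%:R w] else set0).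
  apply/seteqP; split => w; rewrite /E /=.
    move=> [S0 ->] [n _] /= tn; suff : S t w n%:R by rewrite S0.
    by split.
  case: ifPn => // x0 nS; split => //; apply/seteqP; split => // s [s0 ts].
  apply: nS; exists (Num.bound s) => //=; apply: (lt_le_trans ts).
  by apply: ndH => //; apply/ltW/archi_boundP.
case: ifPn => // _; apply: measurableC; apply: bigcupT_measurable => n.
exact: mlt.
Qed.

End inverse_process.

(** * The Lévy measure charges no Lebesgue-null set of positive numbers *)

Section tail_null.
Local Open Scope ereal_scope.
Context (R : realType).
Notation leb := (@lebesgue_measure R).
Variable nu : {measure set (measurableTypeR R) -> \bar R}.
Hypotheses (nu_fin : forall s, (0 < s)%R -> nu `]s, +oo[%classic < +oo)
  (htail : forall a b : R, (0 < a)%R -> (a <= b)%R ->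
     abs_continuous_on a b (levy_tail nu)).

Let nu_itv (a b : R) : (0 < a)%R -> (a <= b)%R ->
  nu `]a, b]%classic = (levy_tail nu a - levy_tail nu b)%:E.
Proof.
move=> a0 ab.
have tf s : (0 < s)%R -> nu `]s, +oo[%classic = (levy_tail nu s)%:E.
  by move=> s0; rewrite /levy_tail fineK// ge0_fin_numE// nu_fin.
have : nu `]a, +oo[%classic = nu `]a, b]%classic + nu `]b, +oo[%classic.
  rewrite -measureU//; last first.
    by apply/seteqP; split => // y []/=; rewrite !in_itv/= andbT leNgt => /andP[_ /negP].
  congr (nu _); apply/seteqP; split => y /=; rewrite !in_itv/= !andbT.
    by move=> ->; case: (leP y b); [left|right].
  by move=> [/andP[]//|]; exact: le_lt_trans.
rewrite !tf ?(lt_le_trans a0)//; case: (nu `]a, b]%classic) => [z| |]//.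
by rewrite -EFinD => -[->]; rewrite addrK.
Qed.

Let cell (a h : R) (k : nat) : set R := `](a + h * k%:R)%R, (a + h * k.+1%:R)%R]%classic.

(* Absolute continuity of the tail bounds nu on finite unions of disjoint
   intervals; an open set is an increasing union of such sets (dyadic cells). *)
Let nu_null_itv (a b : R) (B : set R) : (0 < a)%R -> (a < b)%R -> measurable B ->
  leb B = 0 -> B `<=` `]a, b[%classic -> nu B = 0.
Proof.
move=> a0 ab mB B0 Bab; apply/eqP; rewrite eq_le measure_ge0 andbT.
apply/lee_addgt0Pr => e e0; rewrite add0e.
have [dl dl0 hdl] := htail a0 (ltW ab) e0.
have leBoo : leb B < +oo by rewrite B0 ltry.
have [V [oV BV leV]] := lebesgue_regularity_outer mB leBoo dl0.
pose W := V `&` `]a, b[%classic.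
have oW : open W by apply: openI => //; exact: interval_open.
have mW : measurable W by exact: open_measurable.
have BW : B `<=` W by move=> y By; split; [exact: BV|exact: Bab].
have lW : leb W < dl%:E.
  have mVB : measurable (V `\` B) by apply: measurableD => //; exact: open_measurable.
  apply: le_lt_trans leV; apply: (@le_trans _ _ (leb (B `|` (V `\` B)))).
    apply: le_measure; rewrite ?inE//; first exact: measurableU.
    by move=> y [Vy _]; have [By|nBy] := pselect (B y); [left|right].
  have -> : leb (B `|` (V `\` B)) = leb B + leb (V `\` B).
    by apply: measureU => //; apply/seteqP; split => // y [By []].
  by rewrite B0 add0e.
apply: (le_trans (le_measure nu _ _ BW)); rewrite ?inE//.
pose h (n : nat) : R := ((b - a) / (2 ^ n)%:R)%R.
have h0 n : (0 < h n)%R by rewrite divr_gt0 ?subr_gt0// ltr0n expn_gt0.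
pose C (n k : nat) := cell a (h n) k.
pose good (n k : nat) := `[< C n k `<=` W >].
pose D (n k : nat) := if good n k then C n k else set0.
pose O (n : nat) : set R := \big[setU/set0]_(k < 2 ^ n) D n k.
have mD n k : measurable (D n k).
  by rewrite /D; case: ifP => // _; exact: measurable_itv.
have mO n : measurable (O n) by apply: bigsetU_measurable => k _; exact: mD.
have DW n k : D n k `<=` W by rewrite /D; case: ifPn => // /asboolP.
have OW n : O n `<=` W.
  by move=> y; rewrite /O -bigcup_mkord => -[k _]; exact: DW.
have cell_disj n i j y : C n i y -> C n j y -> (i <= j)%N.
  rewrite /C /cell /= !in_itv/= => /andP[iy _] /andP[_ yj].
  rewrite leqNgt; apply/negP => ji; have := lt_le_trans iy yj.
  by rewrite ltrD2l ltr_pM2l// ltr_nat ltnS leqNgt ji.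
have OE (m : {measure set (measurableTypeR R) -> \bar R}) n :
    m (O n) = \sum_(k < 2 ^ n) m (D n k).
  apply: measure_semi_additive_ord => //; [by move=> k; exact: mD| |exact: mO].
  apply/trivIsetP => i j _ _ ij; apply/seteqP; split => // y []; rewrite /D.
  case: ifP => // _ yi; case: ifP => // _ yj; move/eqP: ij; apply.
  by apply/val_inj/eqP; rewrite eqn_leq (cell_disj n i j y)// (cell_disj n j i y).
pose lo n k := (a + h n * k%:R)%R.
(* Rejected cells become degenerate intervals, so that absolute continuity applies to exactly 2^n
   intervals indexed by k. *)
pose hi n k := if good n k then (a + h n * k.+1%:R)%R else lo n k.
have hiE n : (a + h n * (2 ^ n)%:R = b)%R.
  by rewrite /h divfK ?subrKC// pnatr_eq0 -lt0n expn_gt0.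
have lohi n k : (lo n k <= hi n k)%R.
  by rewrite /hi; case: ifP => // _; rewrite lerD2l ler_pM2l// ler_nat.
have ale n k : (a <= lo n k)%R by rewrite lerDl mulr_ge0// ltW.
have DE n k : D n k = `](lo n k), (hi n k)]%classic.
  by rewrite /D /hi; case: ifP => // _; rewrite set_itvoc0.
have nuO n : nu (O n) <= e%:E.
  rewrite OE; have := hdl (2 ^ n)%N (lo n) (hi n).
  have S1 : (\sum_(i < 2 ^ n) (hi n i - lo n i) < dl)%R.
    rewrite -lte_fin; apply: le_lt_trans lW.
    apply: (@le_trans _ _ (leb (O n))); last first.
      exact: (le_measure leb (mem_set (mO n)) (mem_set mW) (@OW n)).
    rewrite (OE leb) -sumEFin; apply: lee_sum => k _.
    have : (hi n k - lo n k)%:E <= @lebesgue_measure R (D n k); last by [].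
    rewrite DE lebesgue_measure_itv/= lte_fin; case: ltP => //.
    by rewrite lee_fin subr_le0.
  move=> /(_ _ _ S1) h'; apply: (@le_trans _ _ (\sum_(i < 2 ^ n) `|levy_tail nu (hi n i) - levy_tail nu (lo n i)|%:E)).
    apply: lee_sum => k _; rewrite DE nu_itv//; last by apply: lt_le_trans (ale n k).
    by rewrite lee_fin distrC ler_norm.
  rewrite sumEFin lee_fin ltW//; apply: h' => [i ip|i j ip jp ij].
    split; first exact: ale.
    split; first exact: lohi.
    apply: (@le_trans _ _ (lo n i.+1)).
      by rewrite /hi; case: ifP => // _; rewrite lerD2l ler_pM2l// ler_nat.
    by rewrite -(hiE n) lerD2l ler_pM2l// ler_nat.
  have hl i' j' : (i' < j')%N -> (hi n i' <= lo n j')%R.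
    move=> ij'; apply: (@le_trans _ _ (lo n i'.+1)).
      by rewrite /hi; case: ifP => // _; rewrite lerD2l ler_pM2l// ler_nat.
    by rewrite lerD2l ler_pM2l// ler_nat.
  by case: (ltngtP i j) ij => // ij _; [left|right]; exact: hl.
have findk n y : (a < y)%R -> (y <= b)%R -> exists2 k, (k < 2 ^ n)%N & C n k y.
  move=> ay yb; have ex : exists j, (y <= a + h n * j%:R)%R.
    by exists (2 ^ n)%N; rewrite hiE.
  case: (ex_minnP ex) => -[|k] yk kmin.
    by move: yk; rewrite mulr0 addr0 leNgt ay.
  exists k; first by apply: kmin; rewrite hiE.
  rewrite /C /cell /= in_itv/= yk andbT ltNge; apply/negP => /kmin.
  by rewrite ltnn.
have WO : W = \bigcup_n O n.
  apply/seteqP; split => y; last by move=> [n _]; exact: OW.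
  move=> Wy; have := Wy => -[_ /=]; rewrite in_itv/= => /andP[ay yb].
  have := oW y Wy; rewrite /= => /nbhs_ballP[r /= r0 ballr].
  have [n hn] : exists n, (h n < r)%R.
    exists (Num.bound ((b - a) / r)); rewrite /h ltr_pdivrMr ?ltr0n ?expn_gt0//.
    rewrite mulrC -ltr_pdivrMr//.
    have : (0 <= (b - a) / r)%R by rewrite divr_ge0 ?subr_ge0// ltW.
    by move=> /archi_boundP/lt_trans; apply; rewrite ltr_nat ltn_expl.
  have [k k2 Cy] := findk n y ay (ltW yb).
  exists n => //; rewrite /O -bigcup_mkord; exists k => //=.
  rewrite /D; suff -> : good n k by [].
  apply/asboolP => z Cz; apply: ballr.
  rewrite /ball/=; move: Cy Cz; rewrite /C /cell /= !in_itv/= => /andP[y1 y2] /andP[z1 z2].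
  apply: lt_trans hn; rewrite ltr_norml.
  have hk : (h n * k.+1%:R = h n * k%:R + h n)%R by rewrite -natr1 mulrDr mulr1.
  rewrite hk in y2 z2; apply/andP; split; lra.
have ndO : nondecreasing_seq O.
  apply/nondecreasing_seqP => n; apply/subsetPset => y; rewrite /O -!bigcup_mkord.
  move=> [k /= k2]; rewrite {1}/D; case: ifPn => // /asboolP gk Cy.
  have := gk y Cy => -[_ /=]; rewrite in_itv/= => /andP[ay yb].
  have [j j2 Cj] := findk n.+1 y ay (ltW yb).
  exists j => //; rewrite /D; suff -> : good n.+1 j by [].
  apply/asboolP; apply: subset_trans gk => z.
  have hh : (h n = h n.+1 * 2)%R.
    by rewrite /h expnS natrM invfM -mulrA (mulrC _ 2%:R)%R mulVKf.
  move: Cy Cj; rewrite /C /cell /= !in_itv/= => /andP[y1 y2] /andP[z1 z2].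
  (* The cell j of level n + 1 meets the cell k of level n, hence is one of its two halves: 2k <= j
     < 2k + 2. *)
  have h1 : (k * 2 < j.+1)%N.
    rewrite -(ltr_nat R) -(ltr_pM2l (h0 n.+1)) natrM; move: y1 z2; rewrite hh; lra.
  have h2 : (j < k.+1 * 2)%N.
    rewrite -(ltr_nat R) -(ltr_pM2l (h0 n.+1)) natrM; move: y2 z1; rewrite hh; lra.
  move=> /andP[w1 w2]; rewrite hh -!(mulrA (h n.+1)) -!natrM.
  apply/andP; split; [apply: le_lt_trans w1|apply: (le_trans w2)].
    by rewrite lerD2l ler_pM2l// ler_nat mulnC.
  by rewrite lerD2l ler_pM2l// ler_nat mulnC.
have : nu (O n) @[n --> \oo] --> nu W.
  by rewrite WO; apply: nondecreasing_cvg_mu => //; rewrite -WO.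
move=> h1; have le : limn (nu \o O) <= e%:E.
  apply: lime_le; last exact: nearW.
  by apply/cvg_ex; eexists; exact: h1.
exact: (eq_ind _ (fun z => z <= e%:E) le _ (cvg_lim (@ereal_hausdorff R) h1)).
Qed.

Lemma tail_AC (B : set R) : measurable B -> leb B = 0 ->
  nu (B `&` `]0%R, +oo[) = 0.
Proof.
move=> mB B0.
pose I (n : nat) : set R := `](n.+2%:R^-1)%R, (n.+2%:R)%R[%classic.
have -> : B `&` `]0%R, +oo[ = \bigcup_n (B `&` I n).
  rewrite -setI_bigcupr; congr (_ `&` _); apply/seteqP; split => y; rewrite /I /= in_itv/=.
    rewrite andbT => y0; exists (maxn (Num.bound y^-1) (Num.bound y)) => //=.
    rewrite in_itv/=; apply/andP; split.
      have /ltW/archi_boundP yb : (0 < y^-1)%R by rewrite invr_gt0.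
      rewrite invf_plt ?posrE//; apply: lt_trans yb _.
      by rewrite ltr_nat ltnS leqW// leq_maxl.
    have yb := archi_boundP (ltW y0); apply: lt_trans yb _.
    by rewrite ltr_nat ltnS leqW// leq_maxr.
  move=> [n _] /=; rewrite in_itv/= andbT => /andP[+ _]; apply: lt_trans.
  by rewrite invr_gt0.
have mI n : measurable (B `&` I n) by apply: measurableI => //; exact: measurable_itv.
apply/eqP; rewrite eq_le measure_ge0 andbT.
apply: (le_trans (generalized_Boole_inequality _ _ _)) => //.
  by apply: bigcup_measurable => n _; exact: mI.
rewrite eseries0// => n _ _; apply: (@nu_null_itv n.+2%:R^-1 n.+2%:R).
- by rewrite invr_gt0.
- by rewrite (@le_lt_trans _ _ 1%R) ?invf_le1 ?ler1n ?ltr1n.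
- exact: mI.
- apply/eqP; rewrite eq_le measure_ge0 andbT -B0.
  by apply: le_measure; rewrite ?inE//; exact: mI.
- by move=> y [].
Qed.

End tail_null.

(** * The density of the inverse process in terms of the tail *)

Section density.
Local Open Scope ereal_scope.
Context (R : realType) d (T : measurableType d) (P : probability T R).
Notation leb := (@lebesgue_measure R).

(** Extension by zero from the positive half-line, not the maximum of [g] and 0: a density on
    positives is unconstrained at nonpositive arguments. *)
Definition positive_part_fun (g : R -> R) : R -> R := g \_ `]0%R, +oo[.
Local Notation ppf := positive_part_fun.

Lemma positive_part_funE g u : ppf g u = if (0 < u)%R then g u else 0%R.
Proof. by rewrite /ppf patchE mem_setE in_itv/= andbT. Qed.

Lemma measurable_positive_part_fun (g : R -> R) :
  measurable_fun (`]0%R, +oo[%classic : set R) g -> measurable_fun setT (ppf g).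
Proof. by move=> mg; apply/(measurable_restrictT _ (measurable_itv _)). Qed.

Lemma positive_part_fun_ge0 (g : R -> R) u :
  (forall u, (0 < u)%R -> (0 <= g u)%R) -> (0 <= ppf g u)%R.
Proof. by move=> g0; rewrite positive_part_funE; case: ifP => // /g0. Qed.

Lemma positive_part_integral (g : R -> R) (h : R -> R) (A : set R) : measurable A ->
  \int[leb]_(u in A `&` `]0%R, +oo[) (h u * g u)%:E =
  \int[leb]_u (\1_A u * h u * ppf g u)%:E.
Proof.
move=> mA; rewrite integral_mkcond; apply: eq_integral => u _.
rewrite patchE in_setI mem_setE in_itv/= andbT positive_part_funE indicE.
by case: (u \in A); case: (0 < u)%R => /=; rewrite ?mulr0 ?mul0r ?mul1r.
Qed.

Section identification.
Variables (H : R -> T -> R) (t : R) (lt : R -> R).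
Hypotheses (mH : forall t : R, (0 <= t)%R -> measurable_fun setT (H t))
  (ndH : forall w (s t : R), (0 <= s)%R -> (s <= t)%R -> (H s w <= H t w)%R).
Hypothesis hd : density_on_positives P (inverse_process H t) lt.
Let Y := inverse_process H t.
Let L := ppf lt.

Let mL : measurable_fun setT L.
Proof. by case: hd => ? _ _; exact: measurable_positive_part_fun. Qed.

Let L0 u : (0 <= L u)%R.
Proof. by case: hd => _ ? _; exact: positive_part_fun_ge0. Qed.

Lemma density_preimage (A : set R) : measurable A ->
  P (Y @^-1` A) = \int[leb]_u (\1_A u * L u)%:E.
Proof.
move=> mA; case: hd => _ _ ->//.
transitivity (\int[leb]_(u in A `&` `]0%R, +oo[) (1 * lt u)%:E).
  by apply: eq_integral => u _; rewrite mul1r.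
rewrite positive_part_integral//.
by apply: eq_integral => u _; rewrite mulr1.
Qed.

(** The law has a density carried by ]0, oo[. In particular, almost surely H exceeds t at some time,
    since otherwise Y would be 0 by convention. *)
Lemma inverse_process_le0 : P (Y @^-1` `]-oo, 0%R]) = 0.
Proof.
rewrite density_preimage; last exact: measurable_itv.
apply: integral0_eq => u _; rewrite indicE mem_setE in_itv/= /L positive_part_funE.
by case: ltP => _; rewrite ?mulr0 ?mul0r.
Qed.

(** The event t < H a contains 0 < Y < a and is contained in Y <= a; the two bounds agree because Y
    has a density. *)
Lemma density_lt (a : R) : (0 < a)%R ->
  P [set w | (t < H a w)%R] = \int[leb]_u ((u < a)%R%:R * L u)%:E.
Proof.
move=> a0; have mHa : measurable [set w | (t < H a w)%R].
  have := mH (ltW a0) measurableT (measurable_itv `]t, +oo[).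
  by rewrite setTI; congr measurable; apply/seteqP; split => w /=; rewrite in_itv/= andbT.
have mYA (A : set R) : measurable A -> measurable (Y @^-1` A).
  move=> mA; have := measurable_inverse_process mH ndH t measurableT mA.
  by rewrite setTI.
apply/eqP; rewrite eq_le; apply/andP; split.
  apply: (@le_trans _ _ (P (Y @^-1` `]-oo, a]))).
    apply: le_measure; rewrite ?inE//; first by apply: mYA; exact: measurable_itv.
    by move=> w /= ta; rewrite in_itv/=; apply: inverse_process_le => //; exact: ltW.
  rewrite density_preimage; last exact: measurable_itv.
  rewrite (@ae_eq_integral _ _ _ leb setT (fun u => ((u < a)%R%:R * L u)%:E))//; side_tac.
    apply/measurable_EFinP; apply: measurable_funM => //; exact: measurable_indic.
  exists [set a]; split; [exact: measurable_set1|exact: lebesgue_measure_set1|].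
  move=> u /= hu; apply/eqP/negPn/negP => ua; apply: hu => _.
  by rewrite indicE mem_setE in_itv/= le_eqVlt (negPf ua).
apply: (@le_trans _ _ (P (Y @^-1` `]0%R, a[))); last first.
  apply: le_measure; rewrite ?inE//; first by apply: mYA; exact: measurable_itv.
  move=> w /=; rewrite in_itv/= => /andP[Y0 Ya].
  by apply: inverse_process_lt Ya => //; exact: inverse_process_neq0.
rewrite density_preimage; last exact: measurable_itv.
rewrite le_eqVlt; apply/orP; left; apply/eqP; apply: eq_integral => u _.
rewrite indicE mem_setE in_itv/= /L positive_part_funE.
by case: (ltP 0%R u) => _; rewrite ?mulr0.
Qed.

Variable m : {sigma_finite_measure set (measurableTypeR R * T)%type -> \bar R}.
Hypothesis mE : m = (leb \x P)%E :> (set (measurableTypeR R * T) -> \bar R).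
Variable nu : {sigma_finite_measure set (measurableTypeR R) -> \bar R}.
Hypotheses (mZ : measurable_fun setT (clock H : R * T -> R))
  (clock1 : \int[m]_p ((0 < p.1)%R%:R%:E * tail_fun nu (t - clock H p)) = 1)
  (clocka : forall a, (0 < a)%R ->
    \int[m]_p (((0 < p.1) && (p.1 < a))%R%:R%:E * tail_fun nu (t - clock H p)) =
    P [set w | (t < H a w)%R]).

Let mtail : measurable_fun setT (fun p : R * T => tail_fun nu (t - clock H p)).
Proof. by apply: (measurableT_comp (measurable_tail_fun nu)); meas_tac. Qed.

Let F u := \int[P]_w tail_fun nu (t - clock H (u, w)).
Let mF : measurable_fun setT F.
Proof.
apply: (measurable_fun_fubini_tonelli_F (m2 := P)
  (fun p : R * T => tail_fun nu (t - clock H p))) => //.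
by move=> p; exact: tail_fun_ge0.
Qed.

Let F0 u : 0 <= F u.
Proof. by apply: integral_ge0 => w _; exact: tail_fun_ge0. Qed.

Let clockF (h : R -> R) : measurable_fun setT h -> (forall u, (0 <= h u)%R) ->
  \int[m]_p ((h p.1)%:E * tail_fun nu (t - clock H p)) =
  \int[leb]_u ((h u)%:E * F u).
Proof.
move=> mh h0; rewrite (clock_integral mE); last 2 first.
- by apply: emeasurable_funM => //; apply/measurable_EFinP; meas_tac.
- by move=> p; rewrite mule_ge0 ?tail_fun_ge0// lee_fin.
apply: eq_integral => u _ /=; rewrite ge0_integralZl//.
- exact: (measurableT_comp mtail (measurable_pair1 _)).
- by move=> w _; exact: tail_fun_ge0.
- by rewrite lee_fin.
Qed.

(** The functions E tl(t - H u) and l t u have the same primitives over 0 < u < a, by [clocka] and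
    [density_lt], and the first has total mass 1; hence they agree almost everywhere and may be
    exchanged under any weight. *)
Lemma density_clock (h : R -> R) : measurable_fun setT h -> (forall u, (0 <= h u)%R) ->
  \int[m]_p (((0 < p.1)%R%:R * h p.1)%:E * tail_fun nu (t - clock H p)) =
  \int[leb]_u (h u * L u)%:E.
Proof.
move=> mh h0.
pose K u := (0 < u)%R%:R%:E * F u.
have mK : measurable_fun setT K by apply: emeasurable_funM => //; meas_tac.
have K0 u : 0 <= K u by rewrite mule_ge0// lee_fin.
have KL : ae_eq leb setT K (EFin \o L).
  apply: eq_primitive_ae => //.
  - exact/measurable_EFinP.
  - by move=> u; rewrite /K leNgt => /negbTE ->; rewrite mul0e.
  - by move=> u; rewrite /= /L positive_part_funE leNgt => /negbTE ->.
  - rewrite -(clockF (h := fun u => (0 < u)%R%:R)) ?clock1 ?ltry//; meas_tac.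
  - move=> a a0; transitivity (\int[leb]_u (((0 < u) && (u < a))%R%:R%:E * F u)).
      apply: eq_integral => u _; rewrite /K muleA -EFinM.
      by case: (0 < u)%R; case: (u < a)%R; rewrite ?mulr0 ?mul0r ?mulr1.
    rewrite -(clockF (h := fun u => ((0 < u) && (u < a))%R%:R)) ?clocka ?density_lt//; meas_tac.
rewrite (clockF (h := fun u => ((0 < u)%R%:R * h u)%R)); last 2 first.
- by meas_tac.
- by move=> u; rewrite mulr_ge0.
apply: ae_eq_integral => //.
- by apply: emeasurable_funM => //; meas_tac.
- by apply/measurable_EFinP; meas_tac.
have [Z [mZ' Z0 sub]] := KL; exists Z; split => // u /= nu'; apply: sub => /= hu.
by apply: nu' => _; rewrite mulrC EFinM -muleA -/(K u) hu// -EFinM.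
Qed.

End identification.
End density.

(** * Poisson probabilities *)

Section poisson_weights.
Context (R : realType).
Implicit Types (x : nat) (y z : R).

Definition poisson_weight x y : R := expR (- y) * y ^+ x / x`!%:R.

Definition poisson_cumul x y : R := \sum_(j < x.+1) poisson_weight j y.

Local Notation poi := poisson_weight.
Local Notation cum := poisson_cumul.

Let is_derive_expRN y : is_derive y 1 (fun z => expR (- z)) (- expR (- y)).
Proof.
rewrite -[X in is_derive _ _ _ X]mulrN1.
exact: (is_derive1_comp (is_derive_expR (- y)) (is_deriveNid y 1)).
Qed.

Lemma is_derive_poisson_weight0 y : is_derive y 1 (poi 0) (- poi 0 y).
Proof.
rewrite (_ : poi 0 = fun z => expR (- z)); first exact: is_derive_expRN.
by apply/funext => z; rewrite /poi expr0 fact0 divr1 mulr1.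
Qed.

Lemma is_derive_poisson_weightS x y :
  is_derive y 1 (poi x.+1) (poi x y - poi x.+1 y).
Proof.
have E : poi x.+1 = x.+1`!%:R^-1 \*: ((fun z => expR (- z)) * (id ^+ x.+1)).
  by apply/funext => z; rewrite /poi [LHS]mulrC !fctE.
rewrite [X in is_derive _ _ X _]E; apply: is_derive_eq (is_deriveZ _ (is_deriveM (is_derive_expRN y)
  (is_deriveX x.+1 (is_derive_id y 1)))) _.
rewrite /GRing.scale/= exprfctE /= /poi factS natrM invfM exprS.
have f0 : x`!%:R != 0 :> R by rewrite pnatr_eq0 -lt0n fact_gt0.
have x0 : x.+1%:R != 0 :> R by rewrite pnatr_eq0.
move: f0 x0; move: (x`!%:R : R) (x.+1%:R : R) => p q p0 q0.
by field; rewrite p0 q0.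
Qed.

(** The derivatives of the weights telescope. This is why distribution functions are integrated
    instead of single weights. *)
Lemma is_derive_poisson_cumul x y : is_derive y 1 (cum x) (- poi x y).
Proof.
elim: x => [|x IH].
  rewrite (_ : cum 0 = poi 0); first exact: is_derive_poisson_weight0.
  by apply/funext => z; rewrite /cum big_ord_recr big_ord0/= add0r.
rewrite (_ : cum x.+1 = cum x + poi x.+1); last first.
  by apply/funext => z; rewrite /cum big_ord_recr.
apply: is_derive_eq (is_deriveD IH (is_derive_poisson_weightS x y)) _.
by rewrite addrA addNr add0r.
Qed.

Lemma poisson_weight_ge0 x y : 0 <= y -> 0 <= poi x y.
Proof. by move=> y0; rewrite /poi divr_ge0// mulr_ge0 ?expR_ge0// exprn_ge0. Qed.

Lemma poisson_cumul0 x : cum x 0 = 1.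
Proof.
rewrite /cum big_ord_recl big1 => [|i _]; last by rewrite /poi exprS mul0r mulr0 mul0r.
by rewrite /poi expr0 oppr0 expR0 fact0 divr1 mulr1 addr0.
Qed.

Let within_cont (f df : R -> R) a b : (forall y, is_derive y 1 f (df y)) ->
  {within `[a, b], continuous f}.
Proof.
move=> fdf; apply: continuous_subspaceT => y.
by apply/differentiable_continuous/derivable1_diffP; case: (fdf y).
Qed.

Lemma poisson_cumul_le1 x y : 0 <= y -> cum x y <= 1.
Proof.
move=> y0; have [c cy E] := MVT_segment y0 (fun z _ => is_derive_poisson_cumul x z)
  (within_cont (is_derive_poisson_cumul x)).
rewrite -subr_le0 -[X in _ - X](poisson_cumul0 x) E mulNr oppr_le0 mulr_ge0 ?subr_ge0//.
by apply: poisson_weight_ge0; move: cy; rewrite in_itv/= => /andP[].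
Qed.

Lemma poisson_weight_le_cumul x y : 0 <= y -> poi x y <= cum x y.
Proof.
move=> y0; rewrite /cum big_ord_recr/= lerDr sumr_ge0// => i _.
exact: poisson_weight_ge0.
Qed.

Lemma poisson_cumul_ge0 x y : 0 <= y -> 0 <= cum x y.
Proof. by move=> y0; rewrite sumr_ge0// => i _; exact: poisson_weight_ge0. Qed.

Lemma poisson_weight_le1 x y : 0 <= y -> poi x y <= 1.
Proof.
by move=> y0; rewrite (le_trans (poisson_weight_le_cumul x y0))// poisson_cumul_le1.
Qed.

(** The derivative of a weight is, up to sign, a weight or a difference of two weights, each in
    [0, 1]; hence the constant 1. *)
Lemma poisson_weight_lipschitz x y z : 0 <= y -> y <= z ->
  `|poi x z - poi x y| <= z - y.
Proof.
move=> y0 yz; case: x => [|x].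
  have [c cy ->] := MVT_segment yz (fun z _ => is_derive_poisson_weight0 z)
    (within_cont is_derive_poisson_weight0).
  have c0 : 0 <= c by move: cy; rewrite in_itv/= => /andP[/(le_trans y0)].
  rewrite normrM (ger0_norm (_ : 0 <= z - y)) ?subr_ge0// ler_piMl ?subr_ge0//.
  by rewrite normrN ger0_norm ?poisson_weight_ge0// poisson_weight_le1.
have [c cy ->] := MVT_segment yz (fun z _ => is_derive_poisson_weightS x z)
  (within_cont (is_derive_poisson_weightS x)).
have c0 : 0 <= c by move: cy; rewrite in_itv/= => /andP[/(le_trans y0)].
rewrite normrM (ger0_norm (_ : 0 <= z - y)) ?subr_ge0// ler_piMl ?subr_ge0//.
have := poisson_weight_ge0 x c0; have := poisson_weight_le1 x c0.
have := poisson_weight_ge0 x.+1 c0; have := poisson_weight_le1 x.+1 c0.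
by move=> *; rewrite ler_norml; apply/andP; split; lra.
Qed.

Lemma poisson_cumul_expansion x y z : 0 <= y -> y <= z ->
  `|cum x z - cum x y + poi x y * (z - y)| <= (z - y) ^+ 2.
Proof.
move=> y0 yz; have [c cy ->] := MVT_segment yz (fun z _ => is_derive_poisson_cumul x z)
  (within_cont (is_derive_poisson_cumul x)).
rewrite -mulrDl normrM (ger0_norm (_ : 0 <= z - y)) ?subr_ge0// expr2 ler_wpM2r ?subr_ge0//.
move: cy; rewrite in_itv/= => /andP[yc cz].
rewrite addrC distrC; apply: le_trans (poisson_weight_lipschitz x y0 yc) _.
by rewrite lerD2r.
Qed.

End poisson_weights.

(** * Chain rule along the cumulative intensity *)

Section cumulative_intensity.
Context (R : realType).
Notation leb := (@lebesgue_measure R).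
Variables (lam : R -> R) (v : R).
Hypotheses (v0 : 0 <= v) (lam0 : forall u : R, 0 <= u -> 0 <= lam u)
  (lam_int : forall t : R, 0 <= t -> leb.-integrable `[0, t] (EFin \o lam)).
Let Lam := cumulative_intensity lam v.

Let intv b : v <= b -> leb.-integrable `[v, b] (EFin \o lam).
Proof.
move=> vb; apply: integrableS (lam_int (le_trans v0 vb)) => //.
by apply: subset_itvr; rewrite bnd_simp.
Qed.

Let intab a b : v <= a -> a <= b -> leb.-integrable `]a, b] (EFin \o lam).
Proof.
move=> va ab; apply: integrableS (intv (le_trans va ab)) => //.
by apply: subset_itvr; rewrite bnd_simp.
Qed.

Lemma cumulative_intensityB a b : v <= a -> a <= b ->
  Lam b - Lam a = \int[leb]_(u in `]a, b]) lam u.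
Proof.
by move=> va ab; apply: Rintegral_itvB; rewrite ?bnd_simp//; apply: intv; exact: le_trans ab.
Qed.

Lemma cumulative_intensity_le a b : v <= a -> a <= b -> Lam a <= Lam b.
Proof.
move=> va ab; rewrite -subr_ge0 cumulative_intensityB//; apply: Rintegral_ge0 => //.
move=> u /=; rewrite in_itv/= => /andP[au _].
by rewrite lam0// (le_trans v0)// (le_trans va)// ltW.
Qed.

Lemma cumulative_intensity0 : Lam v = 0.
Proof. by rewrite /Lam /cumulative_intensity set_itv1 Rintegral_set1. Qed.

Lemma cumulative_intensity_ge0 a : v <= a -> 0 <= Lam a.
Proof. by move=> va; rewrite -cumulative_intensity0; exact: cumulative_intensity_le. Qed.

Lemma continuous_cumulative_intensity b : v <= b -> {within `[v, b], continuous Lam}.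
Proof. by move=> vb; apply: (@parameterized_integral_continuous _ v b lam vb); exact: intv. Qed.

Let h (x : nat) u := poisson_weight x (Lam u) * lam u.

Lemma poisson_chain_integrable x b : v <= b ->
  leb.-integrable `[v, b] (EFin \o (fun u => poisson_weight x (Lam u) * lam u)).
Proof.
move=> vb; apply: (le_integrable _ _ _ (intv vb)) => //.
- apply/measurable_EFinP; apply: measurable_funM; last first.
    by have /integrableP[/measurable_EFinP] := intv vb.
  have mL : measurable_fun `[v, b] Lam.
    apply: subspace_continuous_measurable_fun => //.
    exact: continuous_cumulative_intensity.
  rewrite /poisson_weight; apply: measurable_funM => //.
  apply: measurable_funM; last exact: measurable_funX.
  by apply: (measurableT_comp (@measurable_expR R)); exact: measurableT_comp.
- move=> u /=; rewrite in_itv/= => /andP[vu ub]; rewrite lee_fin.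
  have L0 := cumulative_intensity_ge0 vu.
  rewrite normrM ger0_norm ?poisson_weight_ge0// ler_piMl//.
  exact: poisson_weight_le1.
Qed.

(** As [lam] is merely integrable, [Lam] need not be differentiable at a given point, and no
    pointwise chain rule is used. On ]a, c] the integral and the increment of [poisson_cumul] are
    each compared with the weight at a times the increment of [Lam]; each error is at most the
    square of that increment, whence the factor 2 in [DB]. *)
Lemma poisson_chain_rule x b : v <= b ->
  \int[leb]_(u in `[v, b]) (poisson_weight x (Lam u) * lam u) =
  1 - poisson_cumul x (Lam b).
Proof.
move=> vb.
pose D s := poisson_cumul x (Lam s) + \int[leb]_(u in `[v, s]) h x u.
have DB a c : v <= a -> a <= c -> `|D c - D a| <= 2 * (Lam c - Lam a) ^+ 2.
  move=> va ac; have vc := le_trans va ac.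
  have La := cumulative_intensity_ge0 va.
  have Lac := cumulative_intensity_le va ac.
  have hB : \int[leb]_(u in `[v, c]) h x u - \int[leb]_(u in `[v, a]) h x u =
      \int[leb]_(u in `]a, c]) h x u.
    by apply: Rintegral_itvB; rewrite ?bnd_simp//; exact: poisson_chain_integrable.
  have hac : leb.-integrable `]a, c] (EFin \o h x).
    apply: integrableS (poisson_chain_integrable x vc) => //; apply: subset_itvr; rewrite bnd_simp//.
  have klam k : leb.-integrable `]a, c] (EFin \o (fun u => k * lam u)).
    by apply: (eq_integrable _ _ _ _ (integrableZl _ k (intab va ac))).
  have E2 : `|\int[leb]_(u in `]a, c]) h x u - poisson_weight x (Lam a) * (Lam c - Lam a)|
      <= (Lam c - Lam a) ^+ 2.
    rewrite cumulative_intensityB// -RintegralZl//; last exact: intab.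
    rewrite -RintegralB//.
    apply: le_trans (le_normr_Rintegral _ _) _ => //.
      by apply: (eq_integrable _ _ _ _ (integrableB _ hac (klam _))).
    rewrite expr2 -{1}(cumulative_intensityB va ac) -RintegralZl//; last exact: intab.
    apply: le_Rintegral => //.
      apply: integrable_norm.
      by apply: (eq_integrable _ _ _ _ (integrableB _ hac (klam _))).
    move=> u /=; rewrite in_itv/= => /andP[au uc].
    have vu := le_trans va (ltW au).
    have l0 : 0 <= lam u by rewrite lam0// (le_trans v0).
    rewrite /h -mulrBl normrM (ger0_norm l0) ler_wpM2r//.
    apply: le_trans (poisson_weight_lipschitz _ La _) _.
      by apply: cumulative_intensity_le => //; exact: ltW.
    by rewrite lerD2r; exact: cumulative_intensity_le.
  have := poisson_cumul_expansion x La Lac; rewrite /D.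
  move: E2; rewrite -hB; move: (Rintegral _ _ _) (Rintegral _ _ _) => I1 I2.
  rewrite !ler_norml => /andP[? ?] /andP[? ?]; apply/andP; split; lra.
(* D is quadratically small with respect to Lam; bisecting the values of Lam
   halves the bound at each step, so that D is constant. *)
have DBn n a c : v <= a -> a <= c -> `|D c - D a| <= 2 * (Lam c - Lam a) ^+ 2 / 2 ^+ n.
  elim: n a c => [|n IH] a c va ac; first by rewrite expr0 divr1; exact: DB.
  have Lac := cumulative_intensity_le va ac.
  (* The interval is split where [Lam] takes its mean value: each half contributes a quarter of the
     squared increment, and together they give one half. *)
  have [e] : exists2 e, e \in `[a, c] & Lam e = (Lam a + Lam c) / 2.
    apply: IVT => //.
      apply: continuous_subspaceW (continuous_cumulative_intensity (le_trans va ac)).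
      by apply: subset_itvr; rewrite bnd_simp.
    rewrite (min_idPl Lac) (max_idPr Lac); apply/andP; split; lra.
  rewrite in_itv/= => /andP[ae ec] Le.
  have := IH _ _ va ae; have := IH _ _ (le_trans va ae) ec; rewrite Le (exprS (2 : R) n) invfM.
  set k := (2 ^+ n)^-1; move=> h1 h2.
  have -> : 2 * (Lam c - Lam a) ^+ 2 * (2^-1 * k) =
    2 * (Lam c - (Lam a + Lam c) / 2) ^+ 2 * k + 2 * ((Lam a + Lam c) / 2 - Lam a) ^+ 2 * k.
    by field.
  apply: le_trans (lerD h1 h2).
  by rewrite -[X in X <= _](_ : `|(D c - D e) + (D e - D a)| = _) ?ler_normD// addrA subrK.
have Dvb : D b = D v.
  apply/eqP; rewrite -subr_eq0 -normr_le0; apply/ler_addgt0Pr => e e0; rewrite add0r.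
  pose k := 2 * (Lam b - Lam v) ^+ 2.
  have k0 : 0 <= k by rewrite mulr_ge0// sqr_ge0.
  have kb := archi_boundP (divr_ge0 k0 (ltW e0)).
  apply: le_trans (DBn (Num.bound (k / e)) v b (lexx _) vb) _; rewrite -/k.
  rewrite ler_pdivrMr ?exprn_gt0// mulrC -ler_pdivrMr//.
  apply: ltW; apply: lt_trans kb _.
  by rewrite -natrX ltr_nat ltn_expl.
move: Dvb; rewrite /D cumulative_intensity0 poisson_cumul0.
rewrite [X in _ = _ + X](_ : _ = 0) ?addr0; last by rewrite set_itv1 Rintegral_set1.
by rewrite -/(h x) => <-; rewrite addrC addKr.
Qed.

End cumulative_intensity.

Section poisson_increment_density.
Context (R : realType).
Notation leb := (@lebesgue_measure R).
Variables (lam : R -> R) (v : R).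
Hypotheses (v0 : 0 <= v) (lam0 : forall u : R, 0 <= u -> 0 <= lam u)
  (lam_int : forall t : R, 0 <= t -> leb.-integrable `[0, t] (EFin \o lam)).
Let Lam := cumulative_intensity lam v.
Let h (x : nat) u := poisson_weight x (Lam u) * lam u.
(** After the shift by v, [pk x u] is lam(u + v) p_x(u, v) for u > 0: the rate at which the count x
    is left at time u. It vanishes for u <= 0. *)
Let k x := h x \_ `]v, +oo[.
Let pk x u := k x (v + u).

Let kE x s : k x s = if v < s then h x s else 0.
Proof. by rewrite /k patchE mem_setE in_itv/= andbT. Qed.

Let h0 x s : v <= s -> 0 <= h x s.
Proof.
move=> vs; rewrite mulr_ge0 ?lam0//; last exact: le_trans vs.
by apply: poisson_weight_ge0; exact: cumulative_intensity_ge0.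
Qed.

Let k0 x s : 0 <= k x s.
Proof. by rewrite kE; case: ifPn => // /ltW; exact: h0. Qed.

Let mk x : measurable_fun setT (k x).
Proof.
apply/(measurable_restrictT _ (measurable_itv _)).
have -> : `]v, +oo[%classic = \bigcup_n `]v, v + n%:R]%classic.
  apply/seteqP; split => s /=; rewrite in_itv/=.
    rewrite andbT => vs; exists (Num.bound (s - v)) => //=; rewrite in_itv/= vs/=.
    by rewrite -lerBlDl ltW// archi_boundP// subr_ge0 ltW.
  by move=> [n _] /=; rewrite in_itv/= andbT => /andP[].
apply/measurable_fun_bigcup => n; first exact: measurable_itv.
have vn : v <= v + n%:R by rewrite lerDl.
have /integrableP[/measurable_EFinP mh _] := poisson_chain_integrable v0 lam0 lam_int x vn.
by apply: measurable_funS mh => //; apply: subset_itvr; rewrite bnd_simp.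
Qed.

Let pk0 x u : 0 <= pk x u.
Proof. exact: k0. Qed.

Let mpk x : measurable_fun setT (pk x).
Proof. by apply: (measurableT_comp (mk x)); meas_tac. Qed.

Let pk_integral x b : 0 <= b ->
  (\int[leb]_u ((u < b)%R%:R * pk x u)%:E = (1 - poisson_cumul x (Lam (b + v)))%:E)%E.
Proof.
move=> b0; have vb : v <= b + v by rewrite lerDr.
rewrite -(poisson_chain_rule v0 lam0 lam_int x vb) -/Lam.
transitivity (\int[leb]_u (((v + u < b + v)%R%:R * k x (v + u))%:E))%E.
  by apply: eq_integral => u _; rewrite (addrC b) ltrD2l.
rewrite (@ge0_integral_translation _ v (fun s => ((s < b + v)%R%:R * k x s)%:E)); last 2 first.
- by apply/measurable_EFinP; have mkx := @mk x; meas_tac.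
- by move=> s; rewrite lee_fin mulr_ge0.
have hint := poisson_chain_integrable v0 lam0 lam_int x vb.
have /integrableP[mh _] := hint.
rewrite /Rintegral fineK; last exact: integrable_fin_num.
rewrite -integral_itv_obnd_cbnd; last first.
  by apply: measurable_funS mh => //; apply: subset_itvr; rewrite bnd_simp.
rewrite -integral_itv_bndo_bndc; last first.
  by apply: measurable_funS mh => //; apply: subset_itv; rewrite bnd_simp.
rewrite [RHS]integral_mkcond; apply: eq_integral => s _.
rewrite patchE mem_setE in_itv/= kE.
by case: (v < s); case: (s < b + v); rewrite /= ?mulr0 ?mul0r ?mul1r.
Qed.

(** Monotone limit of 1 minus a Poisson distribution function. Thus the rate is integrable on the
    whole half-line even when [lam] is not. *)
Let pk_le1 x : (\int[leb]_u (pk x u)%:E <= 1)%E.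
Proof.
have mF (n : nat) : measurable_fun setT (fun u : R => ((u < n%:R)%R%:R * pk x u)%:E).
  by apply/measurable_EFinP; have mpx := @mpk x; meas_tac.
have cv u : ((u < n%:R)%R%:R * pk x u)%:E @[n --> \oo] --> (pk x u)%:E.
  apply: cvg_near_cst; near=> n; rewrite (_ : u < n%:R) ?mul1r//.
  by near: n; exact: nbhs_infty_gtr.
have -> : (\int[leb]_u (pk x u)%:E =
    limn (fun n => \int[leb]_u ((u < n%:R)%R%:R * pk x u)%:E))%E.
  rewrite -monotone_convergence//.
  - by apply: eq_integral => u _; apply/esym/cvg_lim => //; exact: cv.
  - by move=> n u _; rewrite lee_fin mulr_ge0.
  - move=> u _ n m nm; rewrite lee_fin ler_wpM2r//; case: (ltP u n%:R) => // un.
    by rewrite (lt_le_trans un)// ler_nat.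
apply: lime_le.
  apply: ereal_nondecreasing_is_cvgn => n m nm.
  apply: ge0_le_integral => //.
  - by move=> u _; rewrite lee_fin mulr_ge0.
  - exact: mF.
  - exact: mF.
  - move=> u _; rewrite lee_fin ler_wpM2r//; case: (ltP u n%:R) => // un.
    by rewrite (lt_le_trans un)// ler_nat.
apply: nearW => n; rewrite pk_integral// lee_fin gerBl poisson_cumul_ge0//.
by apply: cumulative_intensity_ge0 => //; rewrite lerDr.
Unshelve. all: by end_near. Qed.

Definition poisson_weight_pred (x : nat) (y : R) : R :=
  if x is x'.+1 then poisson_weight x' y else 0.

(** [gp] and [gn] are the positive and negative parts of inflow minus outflow. The last clause is
    the forward equation integrated up to b, with the negative part moved across so that nothing is
    subtracted in the extended reals; the indicator of x = 0 is the initial value. The identity with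
    the absolute value later bounds each part by the governing integrand. *)
Lemma poisson_increment_density (x : nat) : exists gp gn : R -> R,
  [/\ measurable_fun setT gp /\ measurable_fun setT gn,
    (forall u, 0 <= gp u) /\ (forall u, 0 <= gn u),
    (\int[leb]_u (gp u)%:E < +oo)%E /\ (\int[leb]_u (gn u)%:E < +oo)%E,
    (forall u : R, 0 < u -> gp u - gn u =
      lam (u + v) * (- poisson_weight x (Lam (u + v)) + poisson_weight_pred x (Lam (u + v)))
      /\ gp u + gn u = `|gp u - gn u|) &
    (forall b : R, (0 <= b)%R ->
      \int[leb]_u ((0 < u)%R%:R * gp u * (u < b)%R%:R)%:E + ((x == 0%N)%:R)%:E =
      \int[leb]_u ((0 < u)%R%:R * gn u * (u < b)%R%:R)%:E + (poisson_weight x (Lam (b + v)))%:E)%E].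
Proof.
pose q u := if x is x'.+1 then pk x' u else 0.
have mq : measurable_fun setT q by rewrite /q; case: (x) => // n; exact: mpk.
have q0 u : 0 <= q u by rewrite /q; case: (x).
have q1 : (\int[leb]_u (q u)%:E <= 1)%E.
  rewrite /q; case: (x) => [|n]; last exact: pk_le1.
  by rewrite integral0_eq// lee01.
have mp := @mpk x.
exists (fun u => Num.max (q u - pk x u) 0), (fun u => Num.max (pk x u - q u) 0).
have mgp : measurable_fun setT (fun u => Num.max (q u - pk x u) 0).
  by apply: measurable_maxr => //; meas_tac.
have mgn : measurable_fun setT (fun u => Num.max (pk x u - q u) 0).
  by apply: measurable_maxr => //; meas_tac.
split => //.
- by split => u; rewrite le_max lexx orbT.
- split; [apply: (@le_lt_trans _ _ 1%E); last exact: ltry; apply: le_trans q1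
         |apply: (@le_lt_trans _ _ 1%E); last exact: ltry; apply: le_trans (pk_le1 x)].
    apply: ge0_le_integral => //; side_tac.
      by move=> u _; rewrite lee_fin le_max lexx orbT.
    by move=> u _; rewrite lee_fin ge_max q0 gerBl pk0.
  apply: ge0_le_integral => //; side_tac.
    by move=> u _; rewrite lee_fin le_max lexx orbT.
  by move=> u _; rewrite lee_fin ge_max pk0 gerBl q0.
- move=> u u0; split.
    transitivity (q u - pk x u).
      by case: (ltP (q u - pk x u) 0); case: (ltP (pk x u - q u) 0); lra.
    rewrite /q /poisson_weight_pred /pk kE ltrDl u0 /h (addrC v).
    by case: (x) => [|n]; rewrite ?kE ?ltrDr ?u0 /h; ring.
  by case: (ltP (q u - pk x u) 0); case: (ltP (pk x u - q u) 0) => ? ?;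
    [rewrite ger0_norm|rewrite ler0_norm|rewrite ger0_norm|rewrite ger0_norm]; lra.
move=> b b0.
pose I (g : R -> R) := (\int[leb]_u ((u < b)%R%:R * g u)%:E)%E.
have I0 (g : R -> R) : (forall u, u <= 0 -> g u = 0) ->
    (\int[leb]_u ((0 < u)%R%:R * g u * (u < b)%R%:R)%:E = I g)%E.
  move=> gn; apply: eq_integral => u _; congr (_%:E).
  by case: (ltP 0 u) => [_|/gn ->]; rewrite ?mul1r ?mulr0 ?mul0r// mulrC.
have ID (g1 g2 : R -> R) : measurable_fun setT g1 -> measurable_fun setT g2 ->
    (forall u, 0 <= g1 u) -> (forall u, 0 <= g2 u) ->
    (I (fun u => g1 u + g2 u)%R = I g1 + I g2)%E.
  move=> mg1 mg2 g10 g20; rewrite /I -ge0_integralD//.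
  - by apply: eq_integral => u _; rewrite mulrDr.
  - by move=> u _; rewrite lee_fin mulr_ge0.
  - by apply/measurable_EFinP; meas_tac.
  - by move=> u _; rewrite lee_fin mulr_ge0.
  - by apply/measurable_EFinP; meas_tac.
have pn u : u <= 0 -> pk x u = 0 by rewrite /pk kE ltrDl ltNge => ->.
have qn u : u <= 0 -> q u = 0.
  by rewrite /q; case: (x) => // n u0; rewrite /pk kE ltrDl ltNge u0.
rewrite !I0; last 2 first.
- by move=> u u0; rewrite pn// qn// subrr maxxx.
- by move=> u u0; rewrite pn// qn// subrr maxxx.
set gp : R -> R := fun u => Num.max (q u - pk x u) 0.
set gn : R -> R := fun u => Num.max (pk x u - q u) 0.
(* Pointwise, max(q - p, 0) + p = max(p - q, 0) + q. The integrals of [pk x] and [q] are known in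
   closed form, which gives the claim by cancellation. *)
have E : (I gp + I (pk x) = I gn + I q)%E.
  rewrite -!ID//.
  - congr I; apply/funext => u; rewrite /gp /gn.
    by case: (ltP (q u - pk x u) 0); case: (ltP (pk x u - q u) 0); lra.
  - by move=> u; rewrite le_max lexx orbT.
  - by move=> u; rewrite le_max lexx orbT.
have Iq : (I q = (if x is x'.+1 then 1 - poisson_cumul x' (Lam (b + v)) else 0)%R%:E)%E.
  rewrite /I /q; case: (x) => [|n]; last exact: pk_integral.
  by apply: integral0_eq => u _; rewrite mulr0.
have Ige (g : R -> R) : (forall u, 0 <= g u) -> (0 <= I g)%E.
  by move=> g0; apply: integral_ge0 => u _; rewrite lee_fin mulr_ge0.
have a1 : (0 <= I gp)%E by apply: Ige => u; rewrite le_max lexx orbT.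
have a2 : (0 <= I gn)%E by apply: Ige => u; rewrite le_max lexx orbT.
move: E.
rewrite Iq (_ : I (pk x) = (1 - poisson_cumul x (Lam (b + v)))%:E); last exact: pk_integral.
case: (I gp) a1 => [a| |]//; case: (I gn) a2 => [c| |]// _ _.
rewrite -!EFinD => -[E]; congr (_%:E).
case: (x) E => [|n]; rewrite /poisson_cumul big_ord_recr/= ?big_ord0.
  by move=> ?; lra.
by move=> ?; lra.
Qed.

End poisson_increment_density.

(** * Time change *)

Section freezing.
Local Open Scope ereal_scope.
Context (R : realType) d d1 d2 (T : measurableType d) (P : probability T R)
  (T1 : measurableType d1) (T2 : measurableType d2).
Variables (X : T -> T1) (Z : T -> T2).
Hypotheses (mX : measurable_fun setT X) (mZ : measurable_fun setT Z)
  (XZ : forall (A : set T1) (B : set T2), measurable A -> measurable B ->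
    P (Z @^-1` B `&` X @^-1` A) = P (Z @^-1` B) * P (X @^-1` A)).

Let law_exists d' (T' : measurableType d') (W : T -> T') : measurable_fun setT W ->
  exists mu : {finite_measure set T' -> \bar R},
    (forall A, measurable A -> mu A = P (W @^-1` A)) /\
    (forall g : T' -> \bar R, measurable_fun setT g -> (forall y, 0 <= g y) ->
      \int[mu]_y g y = \int[P]_w g (W w)).
Proof.
move=> mW; have [mu muE] := image_measure_exists P mW (measurable_cst (1%R : R)) (fun=> ler01).
have muA A : measurable A -> mu A = P (W @^-1` A).
  move=> mA; rewrite measure_integral_indic// muE//; last exact: measurable_EFin_indic.
  rewrite measure_integral_indic; last by rewrite -[X in measurable X]setTI; exact: mW.
  by apply: eq_integral => w _; rewrite mul1e !indicE; congr (_%:R%:E); apply/idP/idP; rewrite !inE.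
have [|mu' mu'E] := finite_pack (mu := mu).
  by rewrite muA// preimage_setT; apply: le_lt_trans (probability_le1 _ _) _; rewrite ?ltry.
exists mu'; rewrite mu'E; split=> // g mg g0; rewrite muE//.
by apply: eq_integral => w _; rewrite mul1e.
Qed.

(** Independence on rectangles makes the joint law of (X, Z) the product of the laws, and the mass
    of a product measure is an integral of the masses of its sections. *)
Lemma freezing (E : set (T1 * T2)) : measurable E ->
  measurable_fun setT (fun w => P [set w' | E (X w, Z w')]) /\
  P [set w | E (X w, Z w)] = \int[P]_w P [set w' | E (X w, Z w')].
Proof.
move=> mE.
have [m1 [m1E m1I]] := law_exists mX.
have [m2 [m2E m2I]] := law_exists mZ.
have mXZ : measurable_fun setT (fun w => (X w, Z w)) by exact: measurable_fun_pair.
have [m12 [m12E m12I]] := law_exists mXZ.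
have E2 y : m2 (xsection E y) = P [set w' | E (y, Z w')].
  rewrite m2E; last exact: measurable_xsection.
  by congr (P _); apply/seteqP; split => w /=; rewrite /xsection /= inE.
have mF : measurable_fun setT (fun y => m2 (xsection E y)).
  exact: measurable_fun_xsection.
split.
  rewrite (_ : (fun _ => _) = (fun y => m2 (xsection E y)) \o X); last first.
    by apply/funext => w /=; rewrite E2.
  exact: measurableT_comp.
transitivity (m12 E); first by rewrite m12E.
rewrite -(@product_measure_unique _ _ T1 T2 R m1 m2 m12 _ E mE); last first.
  move=> A B mA mB.
  transitivity (P ((fun w => (X w, Z w)) @^-1` (A `*` B))).
    by apply: m12E; exact: measurableX.
  transitivity (P (X @^-1` A) * P (Z @^-1` B)); last first.
    by congr (_ * _); apply/esym; [exact: m1E|exact: m2E].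
  by rewrite muleC -XZ//; congr (P _); apply/seteqP; split => w /= [].
rewrite /product_measure1 m1I//.
by apply: eq_integral => w _ /=; rewrite E2.
Qed.

End freezing.

Lemma cvg_at_right_shift (R : realType) (f : R -> R) (t v l : R) :
  f u @[u --> (t + v)^'+] --> l -> f (u + v) @[u --> t^'+] --> l.
Proof.
move=> fl A /fl [e /= e0 sub]; exists e => //= u; rewrite /ball/= => ut tu.
by apply: sub; rewrite /ball/= ?ltrD2r// opprD addrACA subrr addr0.
Qed.

Section time_change.
Local Open Scope ereal_scope.
Context (R : realType) d (T : measurableType d) (P : probability T R).
Variables (N : R -> T -> nat) (v : R) (Y : T -> R).
Hypotheses (v0 : (0 <= v)%R)
  (mN : forall t : R, (0 <= t)%R -> measurable_fun setT (real_process N t))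
  (ndN : forall w (s t : R), (0 <= s)%R -> (s <= t)%R -> (N s w <= N t w)%N)
  (rcN : forall w (t : R), (0 <= t)%R ->
    real_process N u w @[u --> t^'+] --> real_process N t w)
  (mY : measurable_fun setT Y) (Y0 : forall w, (0 <= Y w)%R)
  (YN : forall (A : set T) (B : set R), process_sigma_algebra (real_process N) A ->
    measurable B -> P (A `&` Y @^-1` B) = P A * P (Y @^-1` B)).

Lemma time_change_law (x : nat) :
  measurable_fun setT (fun w => P [set w' | (N (Y w + v) w' - N v w')%N = x]) /\
  P [set w | (N (Y w + v) w - N v w)%N = x] =
  \int[P]_w P [set w' | (N (Y w + v) w' - N v w')%N = x].
Proof.
pose G := [set E | exists (t : R) (B : set R),
  [/\ (0 <= t)%R, measurable B & E = real_process N t @^-1` B]].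
(* Independence is only available on the sigma-algebra generated by N, so the
   sample space of N carries that sigma-algebra. *)
pose TN : measurableType G.-sigma := g_sigma_algebraType G.
have mid : measurable_fun setT (id : T -> TN).
  move=> _ A mA; rewrite setTI preimage_id.
  apply: (smallest_sub _ _ mA); first exact: sigma_algebra_measurable.
  by move=> _ [t [B [t0 mB ->]]]; rewrite -[X in measurable X]setTI; exact: mN.
have mNt t : (0 <= t)%R -> measurable_fun setT (real_process N t : TN -> R).
  move=> t0 _ B mB; rewrite setTI; apply: sub_sigma_algebra; exists t, B; split => //.
have mNv : measurable_fun setT
    (fun p : R * TN => real_process N (Num.max p.1 0 + v)%R p.2).
  apply: (@measurable_right_continuous R _ TN (fun u => real_process N (u + v))).
  - by move=> t t0; apply: mNt; rewrite addr_ge0.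
  - by move=> w s t s0 st; rewrite ler_nat ndN ?addr_ge0// lerD2r.
  - by move=> w t t0; apply: (@cvg_at_right_shift R (fun u => real_process N u w)); apply: rcN; rewrite addr_ge0.
(* The event is written with real differences and a clipped time, which makes it measurable on the
   whole product; monotonicity of N makes the truncated subtraction of naturals agree with it. *)
pose E := [set p : R * TN |
  (real_process N (Num.max p.1 0 + v)%R p.2 - real_process N v p.2 = x%:R)%R].
have mE : measurable E.
  have mNv0 := mNt v v0.
  have mD : measurable_fun setT (fun p : R * TN =>
      real_process N (Num.max p.1 0 + v)%R p.2 - real_process N v p.2)%R.
    apply: measurable_funB => //.
    exact: (measurableT_comp mNv0 measurable_snd).
  by have := mD measurableT [set (x%:R : R)] (measurable_set1 _); rewrite setTI.
have EE u w : (0 <= u)%R -> E (u, w) = ((N (u + v) w - N v w)%N = x).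
  move=> u0; rewrite /E /= max_l// /real_process -natrB; last first.
    by apply: ndN => //; rewrite lerDr.
  by apply/propext; split => [/eqP|->//]; rewrite eqr_nat => /eqP.
have [|h1 h2] := freezing (P := P) (X := Y) (Z := id : T -> TN) mY mid _ mE.
  by move=> A B mA mB; apply: YN.
split.
  rewrite (_ : (fun _ => _) = (fun w => P [set w' | E (Y w, w')]))//.
  by apply/funext => w; congr (P _); apply/seteqP; split => w' /=; rewrite EE.
transitivity (P [set w | E (Y w, w)]).
  by congr (P _); apply/seteqP; split => w' /=; rewrite EE.
rewrite h2; apply: eq_integral => w _.
by congr (P _); apply/seteqP; split => w' /=; rewrite EE.
Qed.

End time_change.

Section occupation.
Local Open Scope ereal_scope.
Context (R : realType) d (T : measurableType d) (P : probability T R).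
Notation leb := (@lebesgue_measure R).
Variables (H : R -> T -> R).
Hypotheses (mH : forall t : R, (0 <= t)%R -> measurable_fun setT (H t))
  (ndH : forall w (s t : R), (0 <= s)%R -> (s <= t)%R -> (H s w <= H t w)%R)
  (mZ : measurable_fun setT (clock H : R * T -> R))
  (Y0 : forall t, (0 < t)%R -> P (inverse_process H t @^-1` `]-oo, 0%R]) = 0).
Variable m : {sigma_finite_measure set (measurableTypeR R * T)%type -> \bar R}.
Hypothesis mE : m = (leb \x P)%E :> (set (measurableTypeR R * T) -> \bar R).

(** The conditions u < Y t and H u <= t are equivalent for u > 0 except on the graph u = Y t, null
    for each outcome, and on the outcomes whose path may never exceed t, null by [Y0]. *)
Lemma clock_occupation (g : R -> R) (t : R) : measurable_fun setT g ->
  (forall u, (0 <= g u)%R) -> (0 <= t)%R ->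
  \int[P]_w \int[leb]_u ((0 < u)%R%:R * g u * (u < inverse_process H t w)%R%:R)%:E =
  \int[m]_p (((0 < p.1)%R%:R * g p.1)%:E * (\1_(`]-oo, t]%classic) (clock H p))%:E).
Proof.
(* The time t = 0 is allowed while [Y0] speaks of positive times; positivity of the inverse at t + 1
   already shows that the path exceeds t. *)
move=> mg g0 t0; pose Y := inverse_process H t; pose Y' := inverse_process H (t + 1).
have mY : measurable_fun setT Y by exact: measurable_inverse_process.
have mY' : measurable_fun setT Y' by exact: measurable_inverse_process.
pose F (p : R * T) := ((0 < p.1)%R%:R * g p.1 * (p.1 < Y p.2)%R%:R)%:E.
have mF : measurable_fun setT F by rewrite /F; meas_tac.
have F0 p : 0 <= F p by rewrite lee_fin !mulr_ge0.
transitivity (\int[m]_p F p).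
  by rewrite mE (fubini_tonelli2 (m1 := leb) (m2 := P)).
pose Z1 := [set p : R * T | p.1 = Y p.2].
pose Z2 := [set p : R * T | (Y' p.2 <= 0)%R].
have mYp : measurable_fun setT (fun p : R * T => p.1 - Y p.2)%R by meas_tac.
have mZ1 : measurable Z1.
  have := mYp measurableT [set 0%R] (measurable_set1 _); rewrite setTI.
  congr measurable; apply/seteqP; split => p; rewrite /Z1 /=; last by move=> ->; rewrite subrr.
  by move/eqP; rewrite subr_eq0 => /eqP.
have mY2 : measurable_fun setT (fun p : R * T => Y' p.2) by meas_tac.
have mZ2 : measurable Z2.
  have := mY2 measurableT _ (measurable_itv `]-oo, 0%R]); rewrite setTI.
  by congr measurable; apply/seteqP; split => p; rewrite /Z2 /= in_itv.
have Z10 : m Z1 = 0.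
  transitivity (\int[m]_p (\1_Z1 p)%:E); first exact: measure_integral_indic.
  rewrite mE (fubini_tonelli2 (m1 := leb) (m2 := P)); last 2 first.
  - exact: measurable_EFin_indic.
  - by move=> p; rewrite lee_fin.
  apply: integral0_eq => w _; rewrite /fubini_G /=.
  transitivity (\int[leb]_u (\1_[set Y w] u)%:E).
    by apply: eq_integral => u _; rewrite !indicE; congr (_%:R%:E).
  transitivity (leb [set Y w]); last exact: lebesgue_measure_set1.
  exact/esym/measure_integral_indic.
have Z20 : m Z2 = 0.
  transitivity (\int[m]_p (\1_Z2 p)%:E); first exact: measure_integral_indic.
  rewrite mE (fubini_tonelli1 (m1 := leb) (m2 := P)); last 2 first.
  - exact: measurable_EFin_indic.
  - by move=> p; rewrite lee_fin.
  apply: integral0_eq => u _; rewrite /fubini_F /=.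
  have t1 : (0 < t + 1)%R by rewrite ltr_wpDl.
  rewrite -(Y0 t1) measure_integral_indic; last first.
    by rewrite -[X in measurable X]setTI; apply: mY' => //; exact: measurable_itv.
  by apply: eq_integral => w _; rewrite !indicE; congr (_%:R%:E).
apply: ae_eq_integral => //.
  apply: emeasurable_funM; first by meas_tac.
  exact: (measurableT_comp (measurable_EFin_indic (measurable_itv `]-oo, t])) mZ).
exists (Z1 `|` Z2); split; first exact: measurableU.
  apply/eqP; rewrite eq_le measure_ge0 andbT.
  have le := @measureU2 _ _ _ m _ _ mZ1 mZ2; apply: (le_trans le).
  suff -> : m Z1 + m Z2 = 0 + 0 by rewrite adde0.
  by congr (_ + _); [exact: Z10|exact: Z20].
move=> [u w] /= nF; apply: contrapT => /not_orP[n1 n2].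
apply: nF => _; rewrite /F -EFinM; congr (_%:E) => /=.
rewrite indicE mem_setE in_itv/=; case: (ltP 0%R u) => u0; last by rewrite !mul0r.
congr (_ * _%:R)%R; rewrite /clock /= max_l ?(ltW u0)//.
have [s [s0 ts]] : [set s : R | 0 <= s /\ t + 1 < H s w]%R !=set0.
  apply: inverse_process_neq0; rewrite ltNge; apply/negP => Y'0; exact: n2.
have f1 : (u < Y w)%R -> (H u w <= t)%R.
  rewrite ltNge => /negP uY; rewrite leNgt; apply/negP => tH; apply: uY.
  by apply: inverse_process_le => //; exact: ltW.
have f2 : (H u w <= t)%R -> (u < Y w)%R.
  rewrite leNgt => /negP Ht; rewrite ltNge; apply/negP.
  rewrite le_eqVlt => /orP[/eqP Yu|Yu]; first by apply: n1; rewrite /Z1 /= Yu.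
  apply: Ht; apply: inverse_process_lt Yu => //; exists s; split => //.
  by apply: lt_trans ts; rewrite ltrDl.
case: (boolP (u < Y w)%R) => [/f1 ->//|/negP uY].
by case: (boolP (H u w <= t)%R) => // /f2.
Qed.

End occupation.

(** * The convolution-type derivative *)

Section dominated.
Local Open Scope ereal_scope.
Context (R : realType).
Notation leb := (@lebesgue_measure R).
Variable M : {finite_measure set (measurableTypeR R) -> \bar R}.
Hypothesis MAC : forall B : set R, measurable B -> leb B = 0 -> M B = 0.

(** Otherwise there are sets of Lebesgue measure below 2^-(n+1) and [M]-mass at least e. By
    Borel-Cantelli their limit superior is Lebesgue-null, yet finiteness of [M] gives it mass at
    least e. *)
Lemma dominated_eps_delta (e : R) : (0 < e)%R -> exists2 dl : R, (0 < dl)%R &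
  forall B : set R, measurable B -> leb B < dl%:E -> M B < e%:E.
Proof.
move=> e0; apply: contrapT => /forall2NP nex.
have bad (n : nat) : exists B : set R,
    [/\ measurable B, leb B < ((2 ^ n.+1)%:R^-1)%:E & e%:E <= M B].
  have [|/existsNP[B /not_implyP[mB /not_implyP[lB MB]]]] := nex ((2 ^ n.+1)%:R^-1)%R.
    by rewrite invr_gt0 ltr0n expn_gt0.
  by exists B; split => //; rewrite leNgt; apply/negP.
have [B hB] := choice bad.
have mB n : measurable (B n) by case: (hB n).
have lB : leb (lim_sup_set B) = 0.
  apply: lim_sup_set_cvg0 => //.
  apply: (@le_lt_trans _ _ (\sum_(0 <= n <oo) (1 / (2 ^ n.+1)%:R)%:E)).
    apply: lee_nneseries => // n _.
    by case: (hB n) => _ /ltW + _; rewrite div1r.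
  exact: le_lt_trans (epsilon_trick0 xpredT ler01) (ltry 1).
have mU n : measurable (\bigcup_(k in [set k | (n <= k)%N]) B k).
  by apply: bigcup_measurable => k _.
have mls : measurable (lim_sup_set B).
  by apply: bigcap_measurable => [|n _]; [exists 0%N|exact: mU].
have Mfin A : measurable A -> M A < +oo.
  by move=> mA; rewrite ltey_eq fin_num_measure.
have cv := @lim_sup_set_cvg _ _ _ M B mB (Mfin _ (mU 0%N)).
have : e%:E <= limn (fun n => M (\bigcup_(k in [set k | (n <= k)%N]) B k)).
  apply: lime_ge; first by apply/cvg_ex; eexists; exact: cv.
  apply: nearW => n; case: (hB n) => _ _ /le_trans; apply.
  apply: (le_measure M (mem_set (mB n)) (mem_set (mU n))).
  by move=> y By; exists n => /=.
have E : limn (fun n => M (\bigcup_(k in [set k | (n <= k)%N]) B k)) =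
    M (lim_sup_set B).
  by apply: (cvg_lim (@ereal_hausdorff R)); exact: cv.
move=> /le_trans /(_ (eq_ind_r (fun z => z <= 0) (lexx 0)
  (eq_trans E (MAC mls lB)))).
by rewrite lee_fin leNgt e0.
Qed.

Let cdf (t : R) := fine (M `]-oo, t]%classic).

Let cdfB (a b : R) : (a <= b)%R -> M `]a, b]%classic = (cdf b - cdf a)%:E.
Proof.
move=> ab; have fn A : measurable A -> M A = (fine (M A))%:E.
  by move=> mA; rewrite fineK// fin_num_measure.
have : M `]-oo, b]%classic = M `]-oo, a]%classic + M `]a, b]%classic.
  rewrite -measureU//; last first.
    by apply/seteqP; split => // y []/=; rewrite !in_itv/= => ya /andP[]; rewrite ltNge ya.
  congr (M _); apply/seteqP; split => y /=; rewrite !in_itv/=.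
    by move=> yb; case: (leP y a) => ya; [left|right; rewrite yb].
  by move=> [ya|/andP[]//]; exact: le_trans ab.
rewrite (fn _ (measurable_itv `]-oo, b])) (fn _ (measurable_itv `]-oo, a])).
rewrite (fn _ (measurable_itv `]a, b])).
by rewrite -EFinD => -[h]; congr (_%:E); rewrite /cdf h addrC addKr.
Qed.

Let nd : {homo cdf : a b / (a <= b)%R}.
Proof. by move=> a b ab; rewrite -subr_ge0 -lee_fin -cdfB//. Qed.

Lemma abs_continuous_cdf (a b : R) : abs_continuous_on a b cdf.
Proof.
move=> e e0; have [dl dl0 hdl] := dominated_eps_delta e0; exists dl => //.
move=> n l r lr disj S1.
pose U : set R := \big[setU/set0]_(k < n) `](l k), (r k)]%classic.
have mU : measurable U by apply: bigsetU_measurable => k _; exact: measurable_itv.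
have UE (m : {measure set (measurableTypeR R) -> \bar R}) :
    m U = \sum_(k < n) m `](l k), (r k)]%classic.
  apply: measure_semi_additive_ord => //.
  apply/trivIsetP => i j _ _ ij; apply/seteqP; split => // y [] /=.
  rewrite !in_itv/= => /andP[iy yi] /andP[jy yj].
  have [|h|h] := disj i j (ltn_ord i) (ltn_ord j).
  - by move=> /val_inj; apply/eqP.
  - by have := lt_le_trans jy (le_trans yi h); rewrite ltxx.
  - by have := lt_le_trans iy (le_trans yj h); rewrite ltxx.
have : M U < e%:E.
  apply: hdl => //; rewrite (UE leb) (le_lt_trans _ (_ : (\sum_(k < n) (r k - l k))%:E < _))//.
  rewrite -sumEFin; apply: lee_sum => k _.
  have : @lebesgue_measure R `](l k), (r k)]%classic <= (r k - l k)%:E; last by [].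
  rewrite lebesgue_measure_itv/= lte_fin; case: ltP => // _.
  by rewrite lee_fin subr_ge0; case: (lr k (ltn_ord k)) => _ [].
rewrite (UE M) -lte_fin; apply: le_lt_trans; rewrite -sumEFin; apply: lee_sum => k _.
have [_ [lrk _]] := lr k (ltn_ord k).
by rewrite ger0_norm ?subr_ge0 ?nd// -cdfB.
Qed.

Lemma continuous_cdf : continuous cdf.
Proof.
move=> t; apply/cvgrPdist_lt => e e0.
have [dl dl0 hdl] := dominated_eps_delta e0.
exists dl => //= s; rewrite /ball/= => ts.
have key a b : (a <= b)%R -> (b - a < dl)%R -> (`|cdf b - cdf a| < e)%R.
  move=> ab bal; rewrite ger0_norm ?subr_ge0 ?nd//.
  rewrite -lte_fin -cdfB//; apply: hdl; first exact: measurable_itv.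
  have : @lebesgue_measure R `]a, b]%classic < dl%:E; last by [].
  rewrite lebesgue_measure_itv/= lte_fin; have [_|_] := ltP a b; last by [].
  by rewrite -EFinB lte_fin.
case: (leP s t) => st; first by apply: key => //; move: ts; rewrite ger0_norm// subr_ge0.
by rewrite distrC; apply: key (ltW st) _; move: ts; rewrite distrC ger0_norm// subr_ge0 ltW.
Qed.

Lemma density_exists : exists p : R -> R, [/\ measurable_fun setT p,
  (forall y, (0 <= p y)%R), leb.-integrable setT (EFin \o p) &
  forall g : R -> \bar R, measurable_fun setT g -> (forall y, 0 <= g y) ->
    \int[M]_y g y = \int[leb]_y ((p y)%:E * g y)].
Proof.
have dom : M `<< (leb : {sigma_finite_measure set (measurableTypeR R) -> \bar R}).
  by apply/null_content_dominatesP => A mA; exact: MAC.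
have [q [q0 qfin qint ME]] := radon_nikodym_sigma_finite dom.
have qE : EFin \o (fine \o q) = q by apply/funext => y /=; rewrite fineK.
have mp : measurable_fun setT (fine \o q).
  by apply/measurable_EFinP; rewrite qE; case/integrableP: qint.
have p0 y : (0 <= (fine \o q) y)%R by rewrite /= fine_ge0.
exists (fine \o q); split => //; first by rewrite qE.
have mid : measurable_fun [set: measurableTypeR R] (@id (measurableTypeR R)) by [].
have [mu muE] := image_measure_exists leb mid mp p0.
move=> g mg g0; rewrite -muE//; apply: eq_measure_integral => A mA _.
transitivity (\int[leb]_(y in A) q y); first exact: ME.
transitivity (\int[mu]_y (\1_A y)%:E); last exact/esym/measure_integral_indic.
rewrite muE//; last exact: measurable_EFin_indic.
rewrite [LHS]integral_mkcond; apply: eq_integral => y _ /=.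
rewrite patchE indicE; case: (y \in A); last by rewrite mule0.
by rewrite mule1 fineK.
Qed.

End dominated.

Section derivative.
Context (R : realType).
Variable F : R -> R.
Hypothesis cF : continuous F.

Let q (h y : R) := h^-1 * (F (h + y) - F y).

Let q_cont h : continuous (q h).
Proof.
move=> y; apply: cvgM; first exact: cvg_cst.
apply: cvgB; last exact: cF.
apply: (@continuous_comp _ _ _ (fun y => h + y) F); last exact: cF.
by apply: cvgD; [exact: cvg_cst|exact: cvg_id].
Qed.

(* The points of differentiability of F are those in A k n for all k and some n
   (Cauchy's criterion), and A k n is closed because F is continuous. *)
Let A (k n : nat) := [set y : R | forall h h' : R, h != 0 -> h' != 0 ->
  `|h| < n.+1%:R^-1 -> `|h'| < n.+1%:R^-1 -> `|q h y - q h' y| <= k.+1%:R^-1].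

Let closed_A k n : closed (A k n).
Proof.
have -> : A k n = \bigcap_(p in [set p : R * R | [/\ p.1 != 0, p.2 != 0,
    `|p.1| < n.+1%:R^-1 & `|p.2| < n.+1%:R^-1]])
  ((fun y => `|q p.1 y - q p.2 y|) @^-1` [set z | z <= k.+1%:R^-1]).
  apply/seteqP; split => y.
    by move=> Ay [h h'] /= [h0 h'0 hn h'n]; exact: Ay.
  by move=> Ay h h' h0 h'0 hn h'n; exact: (Ay (h, h')).
apply: closed_bigI => p _; apply: closed_comp; last exact: closed_le.
move=> y _; apply: (@continuous_comp _ _ _ (fun y => q p.1 y - q p.2 y) (fun z : R => `|z|)).
  by apply: cvgB; exact: q_cont.
exact: norm_continuous.
Qed.

Let D := \bigcap_k \bigcup_n A k n.

Let mD : measurable D.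
Proof.
apply: bigcap_measurable => [|k _]; first by exists 0%N.
by apply: bigcup_measurable => n _; apply: closed_measurable; exact: closed_A.
Qed.

Let D_cvg y : D y <-> cvg (q h y @[h --> 0^']).
Proof.
split=> [Dy|/cvg_ex[/= l ql] k _].
  apply/cauchy_cvgP/cauchy_exP => e e0.
  have e0' : 0 <= e^-1 by rewrite invr_ge0 ltW.
  have [n _ An] := Dy (Num.bound e^-1) I.
  have n2 : 0 < n.+2%:R^-1 :> R by rewrite invr_gt0.
  exists (q n.+2%:R^-1 y); exists n.+1%:R^-1; first by rewrite /= invr_gt0.
  move=> h; rewrite /ball/= sub0r normrN => hn h0; rewrite /ball/=.
  apply: (@le_lt_trans _ _ (Num.bound e^-1).+1%:R^-1).
    apply: An => //.
    by rewrite gtr0_norm// ltf_pV2 ?posrE// ltr_nat.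
  rewrite invf_plt ?posrE//; apply: lt_trans (archi_boundP e0') _.
  by rewrite ltr_nat.
have k0 : 0 < (k.+1%:R^-1 / 2 : R) by rewrite divr_gt0 ?invr_gt0.
move/cvgrPdist_lt : ql => /(_ _ k0) [r /= r0 sub].
have r0' : 0 <= r^-1 by rewrite invr_ge0 ltW.
exists (Num.bound r^-1) => // h h' h0 h'0 hn h'n.
have hr : (Num.bound r^-1).+1%:R^-1 < r.
  rewrite invf_plt ?posrE//; apply: lt_trans (archi_boundP r0') _.
  by rewrite ltr_nat.
have key z : z != 0 -> `|z| < (Num.bound r^-1).+1%:R^-1 -> `|l - q z y| < k.+1%:R^-1 / 2.
  by move=> z0 zn; apply: sub => //; rewrite /ball/= sub0r normrN (lt_trans zn).
have := key _ h0 hn; have := key _ h'0 h'n.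
move: (q h y) (q h' y) (k.+1%:R^-1 : R) => a b c.
by rewrite !ltr_norml => /andP[? ?] /andP[? ?]; rewrite ler_norml; apply/andP; split; lra.
Qed.

(* The limit defining derive1 has the fixed value point where it does not exist. *)
Lemma measurable_derive1 : measurable_fun setT (derive1 F).
Proof.
pose g n y := q n.+1%:R^-1 y * \1_D y + \1_(~` D) y * (point : R).
apply: (@measurable_fun_cvg _ _ R setT g) => [n|y _].
  apply: measurable_funD; apply: measurable_funM => //.
  - by apply: continuous_measurable_fun; exact: q_cont.
  - by apply: measurable_indic; exact: measurableC.
rewrite /g; have [Dy|nDy] := pselect (D y).
  rewrite !indicE mem_set// memNset; last by move=> /(_ Dy).
  under eq_fun do rewrite mulr1 mul0r addr0.
  have /D_cvg qc := Dy.
  have : (q h y @[h --> 0^'] --> derive1 F y) by exact: qc.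
  move/cvgrPdist_lt => ql; apply/cvgrPdist_lt => e e0.
  have [r /= r0 sub] := ql e e0.
  have r0' : 0 <= r^-1 by rewrite invr_ge0 ltW.
  exists (Num.bound r^-1) => // n /= nb; apply: sub; last by rewrite invr_eq0 pnatr_eq0.
  rewrite /ball/= sub0r normrN gtr0_norm ?invr_gt0//.
  rewrite invf_plt ?posrE//; apply: lt_le_trans (archi_boundP r0') _.
  by rewrite ler_nat leqW.
rewrite !indicE memNset// mem_set//.
under eq_fun do rewrite mulr0 mul1r add0r.
rewrite (_ : derive1 F y = point); first exact: cvg_cst.
rewrite /derive1 /lim /lim_in; apply: getPN => l ql; apply: nDy.
by apply/D_cvg/cvg_ex; exists l.
Qed.

End derivative.

Section convolution.
Local Open Scope ereal_scope.
Context (R : realType).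
Notation leb := (@lebesgue_measure R).
Variables (Mp Mn : {finite_measure set (measurableTypeR R) -> \bar R}).
Hypotheses (MpAC : forall B : set R, measurable B -> leb B = 0 -> Mp B = 0)
  (MnAC : forall B : set R, measurable B -> leb B = 0 -> Mn B = 0)
  (Mp0 : Mp `]-oo, 0%R]%classic = 0) (Mn0 : Mn `]-oo, 0%R]%classic = 0).
Variables (nu : {sigma_finite_measure set (measurableTypeR R) -> \bar R})
  (nub : {measure set (measurableTypeR R) -> \bar R}).
Hypotheses (nubE : nub = nu :> (set (measurableTypeR R) -> \bar R))
  (nu_fin : forall s, (0 < s)%R -> nu `]s, +oo[%classic < +oo).
Variables (w : R -> R) (c : R).

Let G (y : R) := (fine (Mp `]-oo, y]%classic) - fine (Mn `]-oo, y]%classic))%R.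
Hypothesis wE : forall t, (0 <= t)%R -> w t = (c + G t)%R.

Let cG : continuous G.
Proof. by move=> y; apply: cvgB; exact: continuous_cdf. Qed.

Lemma abs_continuous_difference (b : R) : abs_continuous_on 0 b w.
Proof.
move=> e e0; have e2 : (0 < e / 2)%R by rewrite divr_gt0.
have [d1 d10 h1] := abs_continuous_cdf MpAC 0 b e2.
have [d2 d20 h2] := abs_continuous_cdf MnAC 0 b e2.
exists (Num.min d1 d2); first by rewrite lt_min d10.
move=> n l r lr disj; rewrite lt_min => /andP[s1 s2].
have {}h1 := h1 n l r lr disj s1; have {}h2 := h2 n l r lr disj s2.
rewrite (splitr e); apply: le_lt_trans (ltrD h1 h2).
rewrite -big_split/=; apply: ler_sum => i _.
have [l0 [lri _]] := lr i (ltn_ord i).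
rewrite !wE ?(le_trans l0)// /G.
set a1 := fine _; set a2 := fine _; set a3 := fine _; set a4 := fine _.
have -> : (c + (a1 - a2) - (c + (a3 - a4)) = (a1 - a3) - (a2 - a4))%R by ring.
exact: ler_normB.
Qed.

Let derive_w (t s : R) : (s < t)%R ->
  derive1 (fun r => w (r - s)%R) t = derive1 G (t - s)%R.
Proof.
move=> st; transitivity (derive1 (fun r => c + G (r - s))%R t).
  rewrite !derive1E; apply: near_eq_derive.
  near=> r; rewrite wE// subr_ge0 ltW//; near: r.
  exact: lt_nbhsr.
rewrite /derive1.
rewrite (_ : (fun h => _) = (fun h => h^-1 *: (G (h + (t - s)) - G (t - s)))%R)//.
by apply/funext => h; rewrite -(addrA h); congr (_ *: _)%R; ring.
Unshelve. all: by end_near. Qed.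

(** Radon-Nikodym provides the densities; Lebesgue differentiation of the indefinite integral of
    their difference, which is [G], provides the derivative almost everywhere. *)
Let density_difference : exists p1 p2 : R -> R, [/\
  measurable_fun setT p1 /\ measurable_fun setT p2,
  (forall y, (0 <= p1 y)%R) /\ (forall y, (0 <= p2 y)%R),
  (forall g : R -> \bar R, measurable_fun setT g -> (forall y, 0 <= g y) ->
    \int[Mp]_y g y = \int[leb]_y ((p1 y)%:E * g y)),
  (forall g : R -> \bar R, measurable_fun setT g -> (forall y, 0 <= g y) ->
    \int[Mn]_y g y = \int[leb]_y ((p2 y)%:E * g y)) &
  {ae leb, forall y, derive1 G y = (p1 y - p2 y)%R}].
Proof.
have [p1 [mp1 p10 ip1 E1]] := density_exists MpAC.
have [p2 [mp2 p20 ip2 E2]] := density_exists MnAC.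
exists p1, p2; split => //.
pose p y := (p1 y - p2 y)%R.
have ip : leb.-integrable setT (EFin \o p).
  by apply: (eq_integrable _ _ _ _ (integrableB _ ip1 ip2)).
have ipS (q : R -> R) y : leb.-integrable setT (EFin \o q) ->
    leb.-integrable `]-oo, y] (EFin \o q).
  by move=> iq; apply: integrableS iq => //; exact: measurable_itv.
have := @FTC1Ny _ p (fun y => ipS p y ip) (open_integrable_locally openT ip).
have cdfE (M : {finite_measure set (measurableTypeR R) -> \bar R}) (q : R -> R) y :
    (forall g : R -> \bar R, measurable_fun setT g -> (forall y, 0 <= g y) ->
    \int[M]_y g y = \int[leb]_y ((q y)%:E * g y)) ->
    (\int[leb]_(s in `]-oo, y]) q s)%R = fine (M `]-oo, y]%classic).
  move=> E; rewrite /Rintegral; congr fine.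
  rewrite measure_integral_indic; last exact: measurable_itv.
  rewrite E//; last by apply: measurable_EFin_indic; exact: measurable_itv.
  rewrite integral_mkcond; apply: eq_integral => s _; rewrite patchE indicE.
  by case: (s \in _); rewrite ?mule1 ?mule0.
have -> : (fun x : R => \int[leb]_(s in `]-oo, x]) p s)%R = G.
  apply/funext => y; rewrite RintegralB; [|exact: measurable_itv|exact: ipS|exact: ipS].
  by rewrite (cdfE Mp)// (cdfE Mn).
move=> [Z [mZ Z0 sub]]; exists Z; split => // y /= ny; apply: sub => /= -[_ h].
exact: ny.
Qed.

Let tail_levy s : (0 < s)%R -> (levy_tail nub s)%:E = tail_fun nu s.
Proof.
move=> s0; rewrite /tail_fun s0 /levy_tail nubE fineK// ge0_fin_numE//.
exact: nu_fin.
Qed.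

(** With a density q of [M], the reflection s = t - y turns the integral of tl(t - y) against [M]
    into that of q(t - s) nu(s, oo) over 0 < s < t. At almost every s the difference of the two
    densities at t - s is the derivative of w(. - s) at t. *)
Lemma convolution_derivative (t : R) : (0 < t)%R ->
  \int[Mp]_y tail_fun nu (t - y) < +oo -> \int[Mn]_y tail_fun nu (t - y) < +oo ->
  leb.-integrable `]0%R, t[ (EFin \o conv_integrand nub w t) /\
  conv_derivative nub w t =
    (fine (\int[Mp]_y tail_fun nu (t - y)) - fine (\int[Mn]_y tail_fun nu (t - y)))%R.
Proof.
move=> t0 Mpoo Mnoo.
have [p1 [p2 [[mp1 mp2] [p10 p20] E1 E2 aeG]]] := density_difference.
have mtail : measurable_fun setT (fun y : R => tail_fun nu (t - y)).
  by apply: (measurableT_comp (measurable_tail_fun nu)); meas_tac.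
pose lt (s : R) := fine (tail_fun nu s).
have mlt : measurable_fun setT lt by apply: measurableT_comp => //; exact: measurable_tail_fun.
pose K (q : R -> R) s := (q (t - s) * lt s)%R.
have key (M : {finite_measure set (measurableTypeR R) -> \bar R}) (q : R -> R) :
    M `]-oo, 0%R]%classic = 0 ->
    measurable_fun setT q -> (forall y, (0 <= q y)%R) ->
    (forall g : R -> \bar R, measurable_fun setT g -> (forall y, 0 <= g y) ->
    \int[M]_y g y = \int[leb]_y ((q y)%:E * g y)) ->
    \int[M]_y tail_fun nu (t - y) = \int[leb]_(s in `]0%R, t[) (K q s)%:E.
  move=> M0 mq q0 E.
  transitivity (\int[M]_y ((0 < y)%R%:R%:E * tail_fun nu (t - y))).
    apply: ae_eq_integral => //.
      by apply: emeasurable_funM => //; meas_tac.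
    exists `]-oo, 0%R]%classic; split => //.
    move=> y /= hy; rewrite in_itv/= leNgt; apply/negP => y0; apply: hy => _.
    by rewrite y0 mul1e.
  rewrite E; last 2 first.
  - by apply: emeasurable_funM => //; meas_tac.
  - by move=> y; rewrite mule_ge0 ?tail_fun_ge0// lee_fin.
  rewrite -(@ge0_integral_reflection R t); last 2 first.
  - by apply: emeasurable_funM; [exact/measurable_EFinP|apply: emeasurable_funM => //; meas_tac].
  - by move=> y; rewrite !mule_ge0 ?tail_fun_ge0// lee_fin.
  rewrite [RHS]integral_mkcond; apply: eq_integral => s _.
  rewrite patchE mem_setE in_itv/= subr_gt0 subKr /K /lt.
  case: (ltP 0%R s) => s0; last first.
    by rewrite (_ : tail_fun nu s = 0) ?mule0// /tail_fun ltNge s0.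
  case: (ltP s t) => st; last by rewrite mul0e mule0.
  by rewrite mul1e EFinM -tail_levy.
have mK q : measurable_fun setT q -> measurable_fun setT (K q).
  by move=> mq; rewrite /K; apply: measurable_funM => //; apply: measurableT_comp => //; meas_tac.
have K0 q s : (forall y, (0 <= q y)%R) -> (0 <= K q s)%R.
  by move=> q0; rewrite mulr_ge0// fine_ge0// tail_fun_ge0.
have iK (M : {finite_measure set (measurableTypeR R) -> \bar R}) (q : R -> R) :
    M `]-oo, 0%R]%classic = 0 -> measurable_fun setT q ->
   (forall y, (0 <= q y)%R) ->
    (forall g : R -> \bar R, measurable_fun setT g -> (forall y, 0 <= g y) ->
    \int[M]_y g y = \int[leb]_y ((q y)%:E * g y)) ->
    \int[M]_y tail_fun nu (t - y) < +oo ->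
    leb.-integrable `]0%R, t[ (EFin \o K q).
  move=> M0 mq q0 E; rewrite (key M q M0 mq q0 E) => Moo.
  apply/integrableP; split.
    by apply/measurable_EFinP; apply: measurable_funTS; exact: mK.
  apply: le_lt_trans Moo; rewrite le_eqVlt; apply/orP; left; apply/eqP.
  by apply: eq_integral => s _; rewrite /= ger0_norm// K0.
have i1 := iK Mp p1 Mp0 mp1 p10 E1 Mpoo.
have i2 := iK Mn p2 Mn0 mp2 p20 E2 Mnoo.
(* Equality almost everywhere with a measurable function does not yield Borel measurability; that of
   the derivative itself is required here. *)
have mI : measurable_fun `]0%R, t[%classic (conv_integrand nub w t).
  have mG : measurable_fun `]0%R, t[%classic (fun s => derive1 G (t - s) * lt s)%R.
    apply: measurable_funTS; apply: measurable_funM => //.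
    by apply: (measurableT_comp (measurable_derive1 cG)); meas_tac.
  apply: eq_measurable_fun mG => s; rewrite inE/= in_itv/= => /andP[s0 st].
  by rewrite /conv_integrand derive_w// /lt -tail_levy.
have aeK : ae_eq leb `]0%R, t[%classic (EFin \o conv_integrand nub w t)
    (fun s => (K p1 s - K p2 s)%:E).
  have [Z [mZ Z0 sub]] := aeG; exists ((fun s : R => t - s)%R @^-1` Z); split.
  - rewrite -[X in measurable X]setTI.
    have mr : measurable_fun setT (fun s : R => t - s)%R by meas_tac.
    exact: mr.
  - exact: lebesgue_null_reflection.
  move=> s /= hs; apply: sub => /= h; apply: hs; rewrite in_itv/= => /andP[s0 st].
  congr (_%:E); rewrite /conv_integrand derive_w// h /K mulrBl.
  by rewrite /lt -tail_levy.
have i12 : leb.-integrable `]0%R, t[ (fun s => (K p1 s - K p2 s)%:E).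
  by apply: (eq_integrable _ _ _ _ (integrableB _ i1 i2)).
split.
  apply/integrableP; split; first exact/measurable_EFinP.
  have /integrableP[m12 +] := i12; apply: le_lt_trans.
  rewrite le_eqVlt; apply/orP; left; apply/eqP.
  apply: ae_eq_integral => //.
  - by apply: measurableT_comp => //; exact/measurable_EFinP.
  - by apply: measurableT_comp.
  have [Z [mZ Z0 sub]] := aeK; exists Z; split => // s /= hs; apply: sub => /= h.
  by apply: hs => sD; have [->] := h sD.
rewrite /conv_derivative (key Mp p1)// (key Mn p2)// -[RHS]RintegralB//.
rewrite /Rintegral; congr fine; apply: ae_eq_integral => //.
- exact/measurable_EFinP.
- by have /integrableP[] := i12.
Qed.

End convolution.

(** * Finiteness of the tail and positivity of the Laplace exponent *)

Section levy.
Local Open Scope ereal_scope.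
Context (R : realType) (nub : {measure set (measurableTypeR R) -> \bar R}).
Notation leb := (@lebesgue_measure R).
Hypothesis hlevy : levy_measure nub.

Let mmin : measurable_fun setT (fun s : R => (Num.min s 1)%:E).
Proof. by apply/measurable_EFinP; apply: measurable_minr. Qed.

Let min0 (s : R) : (0 <= s)%R -> (0 <= Num.min s 1)%R.
Proof. by move=> s0; rewrite le_min s0 ler01. Qed.

(** Markov's inequality for min(., 1), which is at least min(s, 1) > 0 beyond s. *)
Lemma levy_tail_fin (s : R) : (0 < s)%R -> nub `]s, +oo[%classic < +oo.
Proof.
move=> s0; case: hlevy => _ hoo.
have ms : (0 < Num.min s 1)%R by rewrite lt_min s0 ltr01.
have : (Num.min s 1)%:E * nub `]s, +oo[%classic < +oo.
  apply: le_lt_trans hoo.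
  rewrite -integral_cst; last exact: measurable_itv.
  apply: (@le_trans _ _ (\int[nub]_(y in `]s, +oo[) (Num.min y 1)%:E)).
    apply: ge0_le_integral => //.
    - by move=> y _; rewrite lee_fin ltW.
    - exact: measurable_funTS.
    - move=> y /=; rewrite in_itv/= andbT => sy; rewrite lee_fin.
      by rewrite le_min !ge_min (ltW sy) lexx orbT.
  apply: ge0_subset_integral => //.
  - exact: measurable_funTS.
  - by move=> y /=; rewrite in_itv/= andbT => y0; rewrite lee_fin min0// ltW.
  - by apply: subset_itvr; rewrite bnd_simp ltW.
have := measure_ge0 nub `]s, +oo[%classic.
case: (nub _) => [z _ _| |]//; first exact: ltry.
by rewrite gt0_muley// lte_fin.
Qed.

Lemma levy_measure_pack :
  exists nu : {sigma_finite_measure set (measurableTypeR R) -> \bar R},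
    nu = nub :> (set (measurableTypeR R) -> \bar R).
Proof.
case: (hlevy) => nub0 _.
have [|nu nuE] := sigma_finite_pack (mu := nub); last by exists nu.
exists (fun n => `]-oo, 0%R]%classic `|` `](n.+1%:R^-1)%R, +oo[%classic) => [|n].
  apply/esym/seteqP; split => // y _; case: (leP y 0%R) => y0.
    by exists 0%N => //; left; rewrite /= in_itv.
  have y0' : (0 <= y^-1)%R by rewrite invr_ge0 ltW.
  exists (Num.bound y^-1) => //; right; rewrite /= in_itv/= andbT.
  rewrite invf_plt ?posrE//; apply: lt_trans (archi_boundP y0') _.
  by rewrite ltr_nat.
have n0 : (0 < n.+1%:R^-1 :> R)%R by rewrite invr_gt0.
split; first by apply: measurableU; exact: measurable_itv.
rewrite measureU; [|exact: measurable_itv|exact: measurable_itv|].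
  have h0 : nub `]-oo, 0%R]%classic < +oo by rewrite nub0 ltry.
  by apply: lte_add_pinfty; [exact: h0|exact: levy_tail_fin].
apply/seteqP; split => // y []/=; rewrite !in_itv/= andbT => y0 /(lt_trans n0).
by rewrite ltNge y0.
Qed.

Hypothesis hinf : nub `]0%R, +oo[%classic = +oo.
Variable f : R -> R.
Hypothesis hf : forall x : R, (0 < x)%R ->
  f x = (\int[nub]_(s in `]0, +oo[) (1 - expR (- (x * s))))%R.

Let mexp (x : R) : measurable_fun setT (fun s : R => (1 - expR (- (x * s)))%:E).
Proof. by meas_tac. Qed.

Let exp_gt0 (x s : R) : (0 < x)%R -> (0 < s)%R -> (0 < 1 - expR (- (x * s)))%R.
Proof. by move=> x0 s0; rewrite subr_gt0 expR_lt1 oppr_lt0 mulr_gt0. Qed.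

(** The real-valued integral defining [f] would be 0 if the integral were infinite. It is finite, as
    1 - exp(-xs) <= max(x, 1) min(s, 1). *)
Lemma laplace_exponentE (x : R) : (0 < x)%R ->
  \int[nub]_s ((0 < s)%R%:R * (1 - expR (- (x * s))))%:E = (f x)%:E.
Proof.
move=> x0; case: hlevy => _ hoo.
transitivity (\int[nub]_(s in `]0%R, +oo[) (1 - expR (- (x * s)))%:E).
  rewrite [RHS]integral_mkcond; apply: eq_integral => s _.
  by rewrite patchE mem_setE in_itv/= andbT; case: ifP; rewrite ?mul1r ?mul0r.
rewrite hf// /Rintegral fineK// ge0_fin_numE; last first.
  apply: integral_ge0 => s /=; rewrite in_itv/= andbT => s0.
  by rewrite lee_fin ltW// exp_gt0.
pose k := Num.max x 1%R.
have k0 : (0 < k)%R by rewrite lt_max x0.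
apply: (@le_lt_trans _ _ (\int[nub]_(s in `]0%R, +oo[) (k%:E * (Num.min s 1)%:E))).
  apply: ge0_le_integral => //.
  - by move=> s /=; rewrite in_itv/= andbT => s0; rewrite lee_fin ltW// exp_gt0.
  - by apply: measurable_funTS; exact: mexp.
  - by apply: measurable_funTS; apply: emeasurable_funM.
  - move=> s /=; rewrite in_itv/= andbT => s0; rewrite -EFinM lee_fin.
    have [s1|s1] := leP s 1%R.
      apply: (@le_trans _ _ (x * s)%R); last first.
        by apply: ler_wpM2r; [exact: ltW|rewrite le_max lexx].
      by have := expR_ge1Dx (- (x * s)); lra.
    have := expR_ge0 (- (x * s)); have : (1 <= k)%R by rewrite le_max lexx orbT.
    by move=> *; lra.
rewrite ge0_integralZl//.
- by apply: lte_mul_pinfty => //; rewrite ?fin_numE// lee_fin ltW.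
- exact: measurable_funTS.
- by move=> s /=; rewrite in_itv/= andbT => s0; rewrite lee_fin min0// ltW.
- by rewrite lee_fin ltW.
Qed.

(** The integrand is strictly positive on ]0, oo[, so f x = 0 would make this half-line null,
    against its infinite mass. *)
Lemma laplace_exponent_gt0 (x : R) : (0 < x)%R -> (0 < f x)%R.
Proof.
move=> x0; rewrite lt_neqAle; apply/andP; split; last first.
  rewrite -lee_fin -laplace_exponentE//; apply: integral_ge0 => s _.
  case: (ltP 0%R s) => s0; last by rewrite mul0r.
  by rewrite mul1r lee_fin ltW// exp_gt0.
apply/eqP => f0; have := laplace_exponentE x0; rewrite -f0.
have m1 : measurable_fun setT (fun s : R => ((0 < s)%R%:R * (1 - expR (- (x * s))))%:E).
  by meas_tac.
move=> E; have /(ae_eq_integral_abs nub measurableT m1)[Z [mZ Z0 sub]] :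
    \int[nub]_s `|((0 < s)%R%:R * (1 - expR (- (x * s))))%:E| = 0.
  rewrite -[RHS]E; apply: eq_integral => s _; rewrite gee0_abs//.
  case: (ltP 0%R s) => s0; last by rewrite mul0r.
  by rewrite mul1r lee_fin ltW// exp_gt0.
have : nub `]0%R, +oo[%classic <= nub Z.
  apply: (le_measure nub (mem_set (measurable_itv _)) (mem_set mZ)).
  move=> s /=; rewrite in_itv/= andbT => s0; apply: sub => /= /(_ I) [].
  by rewrite s0 mul1r => /eqP; rewrite gt_eqF// exp_gt0.
by rewrite hinf Z0.
Qed.

End levy.

(** * Images of densities in operational time *)

Section clock_image.
Local Open Scope ereal_scope.
Context (R : realType) d (T : measurableType d) (P : probability T R).
Notation leb := (@lebesgue_measure R).
Variable H : R -> T -> R.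
Variable m : {sigma_finite_measure set (measurableTypeR R * T)%type -> \bar R}.
Hypotheses (mE : m = (leb \x P)%E :> (set (measurableTypeR R * T) -> \bar R))
  (mZ : measurable_fun setT (clock H : R * T -> R))
  (clock0 : forall p, (0 <= clock H p)%R)
  (clockAC : forall B : set R, measurable B -> leb B = 0 ->
    \int[m]_p ((0 < p.1)%R%:R%:E * (\1_B (clock H p))%:E) = 0).

(** M(B) is the integral of g(u) P(H u in B) over u > 0. It charges only sets that U charges, so it
    inherits absolute continuity, and its mass is at most the integral of [g]. On ]-oo, 0] only the
    point 0 can be reached, which is Lebesgue-null. *)
Lemma clock_image_exists (g : R -> R) : measurable_fun setT g ->
  (forall u, (0 <= g u)%R) -> \int[leb]_u (g u)%:E < +oo ->
  exists M : {finite_measure set (measurableTypeR R) -> \bar R}, [/\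
    forall B : set R, measurable B -> leb B = 0 -> M B = 0,
    M `]-oo, 0%R]%classic = 0 &
    forall h : R -> \bar R, measurable_fun setT h -> (forall y, 0 <= h y) ->
      \int[M]_y h y = \int[m]_p (((0 < p.1)%R%:R * g p.1)%:E * h (clock H p))].
Proof.
move=> mg g0 goo.
have mc : measurable_fun setT (fun p : R * T => (0 < p.1)%R%:R * g p.1)%R by meas_tac.
have c0 (p : R * T) : (0 <= (0 < p.1)%R%:R * g p.1)%R by rewrite mulr_ge0.
have mZ' : measurable_fun setT (clock H : R * T -> measurableTypeR R) by exact: mZ.
have [mu muE] := image_measure_exists m mZ' mc c0.
have muA (A : set R) : measurable A ->
    mu A = \int[m]_p (((0 < p.1)%R%:R * g p.1)%:E * (\1_A (clock H p))%:E).
  move=> mA; rewrite -(muE (fun y => (\1_A y)%:E))//.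
    exact: measure_integral_indic.
  exact: measurable_EFin_indic.
have mind (A : set R) : measurable A ->
    measurable_fun setT (fun p : R * T => (\1_A (clock H p))%:E : \bar R).
  by move=> mA; exact: (measurableT_comp (measurable_EFin_indic mA) mZ).
have AC (B : set R) : measurable B -> leb B = 0 -> mu B = 0.
  move=> mB B0; rewrite muA//.
  pose Z := [set p : R * T | (0 < p.1)%R] `&` clock H @^-1` B.
  have mZB : measurable Z.
    apply: measurableI; last by rewrite -[X in measurable X]setTI; exact: mZ.
    have mfst : measurable_fun setT (fun p : R * T => p.1) by meas_tac.
    have := mfst measurableT _ (measurable_itv `]0%R, +oo[).
    by rewrite setTI; congr measurable; apply/seteqP; split => p /=; rewrite in_itv/= andbT.
  have ZE p : (0 < p.1)%R%:R%:E * (\1_B (clock H p))%:E = (\1_Z p)%:E :> \bar R.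
    rewrite -EFinM !indicE; congr (_%:E); case: (ltP 0%R p.1) => p0.
      rewrite mul1r; congr (_%:R); case: (boolP (clock H p \in B)) => hB.
        by rewrite (mem_set (A := Z))//; split => //=; exact: set_mem.
      by rewrite (memNset (A := Z))// => -[_ /= /mem_set]; apply/negP.
    by rewrite mul0r memNset// => -[/=]; rewrite ltNge p0.
  apply: (ge0_integral_null (m := m) mZB).
  - transitivity (\int[m]_p (\1_Z p)%:E); first exact: measure_integral_indic.
    by rewrite -(clockAC mB B0); apply: eq_integral => p _; rewrite ZE.
  - by apply: emeasurable_funM; [exact/measurable_EFinP|exact: mind].
  - by move=> p; rewrite mule_ge0// lee_fin.
  - move=> p nZ; rewrite EFinM muleAC ZE indicE memNset//.
    by rewrite mul0e.
have muoo : mu setT < +oo.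
  rewrite muA//; apply: le_lt_trans goo.
  rewrite (clock_integral mE); last 2 first.
  - by apply: emeasurable_funM; [exact/measurable_EFinP|exact: mind].
  - by move=> p; rewrite mule_ge0// lee_fin.
  apply: ge0_le_integral => //.
  - by move=> u _; apply: integral_ge0 => w _; rewrite mule_ge0// lee_fin mulr_ge0.
  - apply: (measurable_fun_fubini_tonelli_F (m2 := P) (fun p : R * T =>
      ((0 < p.1)%R%:R * g p.1)%:E * (\1_setT (clock H p))%:E)).
      by apply: emeasurable_funM; [exact/measurable_EFinP|exact: mind].
    by move=> p; rewrite mule_ge0// lee_fin.
  - exact/measurable_EFinP.
  - move=> u _ /=; under eq_integral do rewrite indicT mule1.
    rewrite integral_cst// [X in _ * X](_ : _ = 1); last exact: probability_setT.
    by rewrite mule1 lee_fin; case: (0 < u)%R; rewrite ?mul1r// mul0r.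
have [M ME] := finite_pack muoo.
exists M; rewrite ME; split => //.
have s0 : leb [set 0%R] = 0 by exact: lebesgue_measure_set1.
rewrite -(AC _ (measurable_set1 _) s0) !muA//.
apply: eq_integral => p _; congr (_ * _%:E).
rewrite !indicE mem_setE in_itv/=; congr (_%:R).
case: (leP (clock H p) 0%R) => h.
  by rewrite mem_set//=; apply/eqP; rewrite eq_le h clock0.
by rewrite memNset//= => h'; move: h; rewrite h' ltxx.
Qed.

End clock_image.

(** Absolute continuity of [pf] places it in the domain of the convolution-type derivative. As [lam]
    is only locally integrable, absolute convergence of the right-hand side is proved for almost
    every t, and the equation is asserted at every t where it holds. *)
Theorem theorem1 (R : realType) (d : measure_display) (T : measurableType d)
  (P : probability T R)
  (nub : {measure set (measurableTypeR R) -> \bar R}) (f : R -> R)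
  (hlevy : levy_measure nub)
  (hf : forall x : R, 0 < x ->
     f x = \int[nub]_(s in `]0, +oo[) (1 - expR (- (x * s))))
  (hinf : nub `]0, +oo[%classic = +oo%E)
  (htail : forall a b : R, 0 < a -> a <= b ->
     abs_continuous_on a b (levy_tail nub))
  (H : R -> T -> R) (hH : subordinator P H) (hHf : laplace_exponent P H f)
  (l : R -> R -> R)
  (hl : forall t : R, 0 < t ->
     density_on_positives P (inverse_process H t) (l t))
  (lam : R -> R) (hlam0 : forall u : R, 0 <= u -> 0 <= lam u)
  (hlam : forall t : R, 0 <= t ->
     (@lebesgue_measure R).-integrable `[0, t] (EFin \o lam))
  (N : R -> T -> nat) (hN : nonhomogeneous_poisson P lam N)
  (hindep : independent_processes P (real_process N) (inverse_process H))
  (v : R) (hv : 0 <= v) (x : nat) :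
  let Y := inverse_process H in
  let pf := fun t : R => time_changed_prob P N Y x t v in
  [/\ forall b : R, 0 < b -> abs_continuous_on 0 b pf,
      {ae @lebesgue_measure R, forall t : R, 0 < t ->
        (@lebesgue_measure R).-integrable `]0, +oo[
          (EFin \o governing_integrand P lam N l x v t)},
      forall t : R, 0 < t ->
        (@lebesgue_measure R).-integrable `]0, +oo[
          (EFin \o governing_integrand P lam N l x v t) ->
        (@lebesgue_measure R).-integrable `]0, t[
          (EFin \o conv_integrand nub pf t) /\
        conv_derivative nub pf t =
          \int[@lebesgue_measure R]_(u in `]0, +oo[)
            governing_integrand P lam N l x v t u
    & pf 0 = if x == 0%N then 1 else 0].
Proof.
move=> Y pf; pose leb := @lebesgue_measure R.
have [nu nuE] := levy_measure_pack hlevy.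
have nu_fin s : 0 < s -> (nu `]s, +oo[%classic < +oo)%E.
  by move=> s0; rewrite nuE; exact: levy_tail_fin.
have fE r : 0 < r ->
    (\int[nu]_s ((0 < s)%R%:R * (1 - expR (- (r * s))))%:E = (f r)%:E)%E.
  by move=> r0; have := laplace_exponentE hlevy hf r0; rewrite -nuE.
have f0 := laplace_exponent_gt0 hlevy hinf hf.
have nuAC (B : set R) : measurable B -> leb B = 0%E -> nu (B `&` `]0, +oo[) = 0%E.
  by move=> mB B0; rewrite nuE; exact: (tail_AC (levy_tail_fin hlevy) htail mB B0).
have nuinf : nu `]0, +oo[%classic = +oo%E by rewrite nuE.
case: hH => mH H0 ndH rcH _ _.
have HL (t y : R) : 0 <= t -> 0 < y ->
    (\int[P]_w (expR (- (y * H t w)))%:E = (expR (- (t * f y)))%:E)%E.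
  by move=> t0 y0; have := hHf t y t0 y0; rewrite unlock.
have [m mE] := sigma_finite_product (@lebesgue_measure R) P.
have mZ := measurable_clock mH ndH rcH.
have Y_le0 t : 0 < t -> P (Y t @^-1` `]-oo, 0]) = 0%E.
  by move=> t0; exact: (inverse_process_le0 (hl t t0)).
have Yge0 t w : 0 <= Y t w by exact: inverse_process_ge0.
have mY t : measurable_fun setT (Y t) by exact: measurable_inverse_process.
have [gp [gn [[mgp mgn] [gp0 gn0] [gpoo gnoo] gE gI]]] :=
  poisson_increment_density hv hlam0 hlam x.
have clockAC B mB B0 := clock_AC mH H0 ndH rcH HL f0 mE fE nuAC nuinf (B := B) mB B0.
have cl0 := clock_ge0 H0 ndH.
have [Mp [MpAC Mp0 MpE]] := clock_image_exists mE mZ cl0 clockAC mgp gp0 gpoo.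
have [Mn [MnAC Mn0 MnE]] := clock_image_exists mE mZ cl0 clockAC mgn gn0 gnoo.
have incE y u : 0 <= u -> increment_prob P N y u v =
    poisson_weight y (cumulative_intensity lam v (u + v)).
  by move=> u0; rewrite /increment_prob (nhp_law hN).
have pfE t : 0 <= t -> pf t = (x == 0%N)%:R +
    (fine (Mp `]-oo, t]%classic) - fine (Mn `]-oo, t]%classic)).
  move=> t0; pose A (g : R -> R) w :=
    (\int[leb]_u ((0 < u)%R%:R * g u * (u < Y t w)%R%:R)%:E)%E.
  have mA (g : R -> R) : measurable_fun setT g -> (forall u, 0 <= g u) -> measurable_fun setT (A g).
    move=> mg g0; apply: (measurable_fun_fubini_tonelli_G (m1 := @lebesgue_measure R)
      (fun p : R * T => ((0 < p.1)%R%:R * g p.1 * (p.1 < Y t p.2)%R%:R)%:E)).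
      by have mYt := mY t; meas_tac.
    by move=> p; rewrite lee_fin !mulr_ge0.
  have A0 (g : R -> R) w : (forall u, 0 <= g u) -> (0 <= A g w)%E.
    by move=> g0; apply: integral_ge0 => u _; rewrite lee_fin !mulr_ge0.
  have MA (M : {finite_measure set (measurableTypeR R) -> \bar R}) (g : R -> R) :
      measurable_fun setT g -> (forall u, 0 <= g u) ->
      (forall h : R -> \bar R, measurable_fun setT h -> (forall y, 0 <= h y)%E ->
      \int[M]_y h y = \int[m]_p (((0 < p.1)%R%:R * g p.1)%:E * h (clock H p)))%E ->
      (\int[P]_w A g w)%E = (fine (M `]-oo, t]%classic))%:E.
    move=> mg g0 ME; rewrite fineK; last by apply: fin_num_measure; exact: measurable_itv.
    rewrite (clock_occupation mH ndH mZ Y_le0 mE mg g0 t0).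
    rewrite -(ME (fun y => (\1_(`]-oo, t]%classic) y)%:E))//.
      by apply/esym/measure_integral_indic; exact: measurable_itv.
    by apply: measurable_EFin_indic; exact: measurable_itv.
  have indY (B : set T) (C : set R) : process_sigma_algebra (real_process N) B ->
      measurable C -> P (B `&` Y t @^-1` C) = (P B * P (Y t @^-1` C))%E.
    move=> sB mC; apply: hindep => //.
    by apply: sub_sigma_algebra; exists t, C.
  have [mF PE] := time_change_law hv (nhp_meas hN) (nhp_nondecreasing hN)
    (nhp_right_continuous hN) (mY t) (Yge0 t) indY x.
  pose F w := P [set w' | (N (Y t w + v)%R w' - N v w')%N = x].
  have FE w : F w = (poisson_weight x (cumulative_intensity lam v (Y t w + v)))%:E.
    by rewrite /F (nhp_law hN).
  (* The integrated forward equation at the random time b = Y t w, averaged over [P]. The occupation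
     identity turns the averages of [A gp] and [A gn] into the distribution functions of [Mp] and
     [Mn]. *)
  have : (\int[P]_w A gp w + ((x == 0%N)%:R)%:E = \int[P]_w A gn w + \int[P]_w F w)%E.
    rewrite -ge0_integralD//; [|by move=> w _; exact: A0|exact: mA].
    transitivity (\int[P]_w (A gp w + ((x == 0%N)%:R)%:E))%E; last first.
      by apply: eq_integral => w _; rewrite FE gI.
    rewrite [RHS]ge0_integralD//; try solve
      [by move=> w _; exact: A0|exact: mA|by move=> w _; rewrite lee_fin].
    congr (_ + _)%E; rewrite integral_cst// [X in (_ * X)%E](_ : _ = 1%E) ?mule1//.
    exact: probability_setT.
  rewrite (MA Mp)// (MA Mn)// -PE.
  rewrite /pf /time_changed_prob /time_changed_increment -/Y.
  case: (P _) (measure_ge0 P [set w | (N (Y t w + v)%R w - N v w)%N = x]) => [z _| |]//.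
  by rewrite -!EFinD => -[h]; rewrite [LHS]/=; lra.
have tailE (M : {finite_measure set (measurableTypeR R) -> \bar R}) (g : R -> R) t :
    measurable_fun setT g -> (forall u, 0 <= g u) -> 0 < t ->
    (forall h : R -> \bar R, measurable_fun setT h -> (forall y, 0 <= h y)%E ->
      \int[M]_y h y = \int[m]_p (((0 < p.1)%R%:R * g p.1)%:E * h (clock H p)))%E ->
    (\int[M]_y tail_fun nu (t - y) = \int[leb]_(u in `]0%R, +oo[) (g u * l t u)%:E)%E.
  move=> mg g0 t0 ME; rewrite ME; last 2 first.
  - by apply: (measurableT_comp (measurable_tail_fun nu)); meas_tac.
  - by move=> y; exact: tail_fun_ge0.
  rewrite (density_clock mH ndH (hl t t0) mE mZ
    (clock_tail mH H0 ndH rcH HL f0 mE fE nuAC t0)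
    (fun a a0 => clock_lt mH H0 ndH rcH HL f0 mE fE nuAC a0 t0) mg g0).
  rewrite -[X in (_ = \int[_]_(_ in X) _)%E]setTI positive_part_integral//.
  by apply: eq_integral => u _; rewrite indicT mul1r.
have govE t u : 0 < u -> governing_integrand P lam N l x v t u = gp u * l t u - gn u * l t u.
  move=> u0; rewrite -mulrBl (gE u u0).1 /governing_integrand incE ?(ltW u0)//.
  congr (_ * (_ + _) * _); rewrite /increment_prob_pred /poisson_weight_pred.
  by case: (x) => // y; rewrite incE// ltW.
have mgl (g : R -> R) t : measurable_fun setT g -> 0 < t ->
    measurable_fun (`]0%R, +oo[%classic : set R) (fun u : R => g u * l t u).
  move=> mg t0; apply: measurable_funM; first exact: measurable_funTS.
  by case: (hl t t0).
have lt0 t u : 0 < t -> 0 < u -> 0 <= l t u by move=> t0; case: (hl t t0) => _ + _; apply.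
have intE (g : R -> R) t : measurable_fun setT g -> (forall u, 0 <= g u) -> 0 < t ->
    (\int[leb]_(u in `]0%R, +oo[) (g u * l t u)%:E < +oo)%E ->
    leb.-integrable `]0, +oo[ (EFin \o (fun u : R => g u * l t u)).
  move=> mg g0 t0 goo; apply/integrableP; split.
    by apply/measurable_EFinP; exact: mgl.
  apply: le_lt_trans goo; rewrite le_eqVlt; apply/orP; left; apply/eqP.
  apply: eq_integral => u; rewrite inE/= in_itv/= andbT => u0.
  by rewrite ger0_norm// mulr_ge0// lt0.
(* As a function of t, the integral of g l(t, .) has a transform at r = 1 bounded by f(1) times the
   total mass of [M]; hence it is finite for almost every t. *)
have tail_ae (M : {finite_measure set (measurableTypeR R) -> \bar R}) (g : R -> R) :
    measurable_fun setT g -> (forall u, 0 <= g u) ->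
    (forall h : R -> \bar R, measurable_fun setT h -> (forall y, 0 <= h y)%E ->
      \int[M]_y h y = \int[m]_p (((0 < p.1)%R%:R * g p.1)%:E * h (clock H p)))%E ->
    {ae leb, forall t : R, 0 < t ->
      leb.-integrable `]0, +oo[ (EFin \o (fun u : R => g u * l t u))}.
  move=> mg g0 ME.
  have mc : measurable_fun setT (fun p : R * T => (0 < p.1)%R%:R * g p.1) by meas_tac.
  have c0 (p : R * T) : 0 <= (0 < p.1)%R%:R * g p.1 by rewrite mulr_ge0.
  pose I y := (\int[m]_p (((0 < p.1)%R%:R * g p.1)%:E * tail_fun nu (y - clock H p)))%E.
  have IE y : (\int[M]_z tail_fun nu (y - z) = I y)%E.
    rewrite ME//; last by move=> z; exact: tail_fun_ge0.
    by apply: (measurableT_comp (measurable_tail_fun nu)); meas_tac.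
  have I0 y : (0 <= I y)%E.
    by apply: integral_ge0 => p _; rewrite mule_ge0 ?tail_fun_ge0// lee_fin.
  have mI : measurable_fun setT I by exact: (measurable_tail_conv nu m mc c0 mZ).
  have iI : leb.-integrable setT (fun y : R => ((1 * expR (- (1 * y)))%:E * I y)%E).
    apply/integrableP; split.
      by apply: emeasurable_funM => //; meas_tac.
    rewrite (_ : (\int[_]_(_ in _) _)%E = (\int[leb]_y ((1 * expR (- (1 * y)))%:E * I y))%E).
      rewrite (laplace_tail_conv m mc c0 mZ ltr01 (fE 1 ltr01)).
      apply: lte_mul_pinfty => //; first by rewrite lee_fin ltW// f0.
      apply: (@le_lt_trans _ _ (M setT)); last by rewrite ltey_eq fin_num_measure.
      have -> : M setT = (\int[M]_y (\1_setT y)%:E)%E by exact: measure_integral_indic.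
      rewrite ME//; last exact: measurable_EFin_indic.
      apply: ge0_le_integral => //.
      - by move=> p _; rewrite lee_fin mulr_ge0 ?expR_ge0.
      - by apply/measurable_EFinP; meas_tac.
      - by under eq_fun do rewrite indicT mule1; exact/measurable_EFinP.
      - move=> p _; rewrite indicT mule1 lee_fin ler_piMr//.
        by rewrite expR_le1 mul1r oppr_le0.
    by apply: eq_integral => y _; rewrite gee0_abs// mule_ge0// lee_fin mul1r expR_ge0.
  have [Z [mZ' Z0 sub]] := integrable_ae measurableT iI.
  exists Z; split => // t /= nt; apply: sub => /= fin_t; apply: nt => t0.
  apply: intE => //; rewrite -(tailE M g t mg g0 t0 ME) IE.
  have := fin_t Logic.I; have := I0 t; case: (I t) => [z| |]// _; first by rewrite ltry.
  by rewrite gt0_muley// lte_fin mul1r expR_gt0.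
split.
- move=> b b0; exact: (abs_continuous_difference MpAC MnAC pfE).
- have [Z1 [mZ1 Z10 sub1]] := tail_ae Mp gp mgp gp0 MpE.
  have [Z2 [mZ2 Z20 sub2]] := tail_ae Mn gn mgn gn0 MnE.
  exists (Z1 `|` Z2); split; first exact: measurableU.
    apply/eqP; rewrite eq_le measure_ge0 andbT.
    have le := @measureU2 _ _ _ (@lebesgue_measure R) _ _ mZ1 mZ2; apply: (le_trans le).
    suff -> : (leb Z1 + leb Z2 = 0 + 0)%E by rewrite adde0.
    by congr (_ + _)%E; [exact: Z10|exact: Z20].
  move=> t /= nt; apply: contrapT => /not_orP[n1 n2]; apply: nt => t0.
  have i1 : leb.-integrable `]0, +oo[ (EFin \o (fun u : R => gp u * l t u)).
    by apply: contrapT => n; apply: n1; apply: sub1 => /= /(_ t0).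
  have i2 : leb.-integrable `]0, +oo[ (EFin \o (fun u : R => gn u * l t u)).
    by apply: contrapT => n; apply: n2; apply: sub2 => /= /(_ t0).
  apply: (eq_integrable _ _ _ _ (integrableB _ i1 i2)) => // u.
  by rewrite inE/= in_itv/= andbT => u0; rewrite govE.
- move=> t t0 hgov.
  have mg : measurable_fun setT (fun u => gp u + gn u) by exact: measurable_funD.
  (* [gp] + [gn] is the absolute value of g, so absolute convergence of the right-hand side bounds
     both parts, and the two tail convolutions become finite and can be subtracted. *)
  have goo : (\int[leb]_(u in `]0%R, +oo[) ((gp u + gn u) * l t u)%:E < +oo)%E.
    have /integrableP[_] := hgov; apply: le_lt_trans.
    rewrite le_eqVlt; apply/orP; left; apply/eqP.
    apply: eq_integral => u; rewrite inE/= in_itv/= andbT => u0.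
    by rewrite govE// -mulrBl normrM -(gE u u0).2 (ger0_norm (lt0 _ _ t0 u0)).
  have half (g : R -> R) : measurable_fun setT g -> (forall u, 0 <= g u) ->
      (forall u, g u <= gp u + gn u) ->
      (\int[leb]_(u in `]0%R, +oo[) (g u * l t u)%:E < +oo)%E.
    move=> mg' g0 gle; apply: le_lt_trans goo; apply: ge0_le_integral => //.
    - by move=> u /=; rewrite in_itv/= andbT => u0; rewrite lee_fin mulr_ge0// lt0.
    - by apply/measurable_EFinP; exact: mgl.
    - by apply/measurable_EFinP; exact: mgl.
    - move=> u /=; rewrite in_itv/= andbT => u0.
      by rewrite lee_fin ler_wpM2r// lt0.
  have hp : (\int[leb]_(u in `]0%R, +oo[) (gp u * l t u)%:E < +oo)%E.
    by apply: half => // u; rewrite lerDl.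
  have hn : (\int[leb]_(u in `]0%R, +oo[) (gn u * l t u)%:E < +oo)%E.
    by apply: half => // u; rewrite lerDr.
  have [] := convolution_derivative MpAC MnAC Mp0 Mn0 (esym nuE) nu_fin pfE t0.
  + by rewrite (tailE Mp gp).
  + by rewrite (tailE Mn gn).
  move=> -> ->; split => //; rewrite (tailE Mp gp)// (tailE Mn gn)//.
  rewrite -[LHS]RintegralB//; [|exact: intE|exact: intE].
  apply: eq_Rintegral => u; rewrite inE/= in_itv/= andbT => u0.
  by rewrite govE.
- rewrite pfE// Mp0 Mn0 subrr addr0; by case: eqP.
Qed.
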